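(* Let $X$ be a smooth projective geometrically irreducible curve over $\mathbb{F}_q$ of genus $g_X$, $x$ a closed point of $X$ of degree $d_x$, $q_x=q^{d_x}$, and $[D]\in\mathrm{Cl}\,X$ a divisor class of non-negative degree. The $\Phi_x$-neighbours $v$ of $c_D$ with $\delta(v)=\deg D+d_x$ are given by the following list: - $(c_0,c_x,q+1)\in\mathcal{U}_x(c_0)$; - $(c_D,c_{D+x},2)\in\mathcal{U}_x(c_D)$ if $[D]\in(\mathrm{Cl}^0X)[2]-\{0\}$; - $(c_D,c_{D+x},1),\,(c_D,c_{-D+x},1)\in\mathcal{U}_x(c_D)$ if $[D]\in\mathrm{Cl}^0X-(\mathrm{Cl}^0X)[2]$; - $(c_D,c_{D+x},1)\in\mathcal{U}_x(c_D)$ if $\deg D$ is positive. For all $\Phi_x$-neighbours $v$ of $c_D$ not occurring in this list, $\delta(v)<\delta(c_D)+d_x$. If furthermore $\deg D>d_x$, then $\delta(v)=\deg D-d_x$ for all these $v$, and if $\deg D>m_X+d_x$ where $m_X=\max\{2g_X-2,0\}$, then $$\mathcal{U}_x(c_D)=\{(c_D,c_{D-x},q_x),\,(c_D,c_{D+x},1)\}.$$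
   Context: $\mathbb{P}\mathrm{Bun}_2X$ is the set of isomorphism classes of rank $2$ vector bundles on $X$ modulo tensoring with line bundles; $\mathcal{M}\sim\mathcal{M}'$ means equality of the classes $[\mathcal{M}]=[\mathcal{M}']$. $\mathrm{Cl}\,X$ is the divisor class group, $\mathrm{Cl}^0X$ its degree $0$ part and $(\mathrm{Cl}^0X)[2]$ the $2$-torsion of the latter; $\mathcal{L}_D$ is the line bundle associated to the divisor $D$, and $c_D=[\mathcal{L}_D\oplus\mathcal{O}_X]\in\mathbb{P}\mathrm{Bun}_2X$. Let $\mathcal{K}_x$ be the torsion sheaf supported at $x$ with stalk the residue field $\kappa_x$. Let $m_x([\mathcal{M}],[\mathcal{M}'])$ be the number of subsheaves $\mathcal{M}''\subset\mathcal{M}$ with $\mathcal{M}/\mathcal{M}''\simeq\mathcal{K}_x$ and $\mathcal{M}''\sim\mathcal{M}'$ (independent of the representative $\mathcal{M}$), and $$\mathcal{U}_x([\mathcal{M}])=\{([\mathcal{M}],[\mathcal{M}'],m)\mid m=m_x([\mathcal{M}],[\mathcal{M}'])\ne0\}.$$ The classes $[\mathcal{M}']$ occurring here are called the $\Phi_x$-neighbours of $[\mathcal{M}]$. A line subbundle of $\mathcal{M}$ is an injective morphism $\mathcal{L}\to\mathcal{M}$ from a line bundle with locally free cokernel. For a rank $2$ bundle, $\delta(\mathcal{M})=\sup(2\deg\mathcal{L}-\deg\mathcal{M})$ over all line subbundles $\mathcal{L}\to\mathcal{M}$; $\delta([\mathcal{M}])=\delta(\mathcal{M})$ is well defined. 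*)

(* Defs.v *)
From HB Require Import structures.
From mathcomp Require Import all_boot all_order all_algebra.
From mathcomp Require Import generic_quotient ring_quotient freeg.
From mathcomp Require Import mathcomp_extra boolp classical_sets.
From mathcomp Require Import functions cardinality.

Set Implicit Arguments.
Unset Strict Implicit.
Unset Printing Implicit Defensive.

Import Order.TTheory GRing.Theory Num.Theory.
Local Open Scope classical_set_scope.
Local Open Scope ring_scope.
Local Open Scope quotient_scope.

(* A smooth projective curve X over a finite field k is given by its function
   field F, with structure map iota : k -> F, as in Hartshorne I.6: the closed
   points of X are the discrete valuations of F over k, the proper closed
   subsets are the finite ones, and O_X(U) is the intersection of the local
   rings at the points of U.  As every nonempty open set contains the generic
   point, the latter may be left out without changing the category of sheaves;
   as a sheaf vanishes on the empty set, only nonempty open sets are used. *)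

Section FunctionField.
Variables (k : finFieldType) (F : fieldType) (iota : {rmorphism k -> F}).

(* F is finitely generated of transcendence degree 1 over k, i.e. finite over
   k(t) for some t transcendental over k. *)
Definition function_field : Prop :=
  exists t : F,
    (forall p : {poly k}, (map_poly iota p).[t] = 0 -> p = 0) /\
    exists (n : nat) (e : 'I_n -> F), forall f : F,
      exists a b : 'I_n -> {poly k},
        (forall i, b i != 0) /\
        f = \sum_i (map_poly iota (a i)).[t] / (map_poly iota (b i)).[t] * e i.

(* The finite extensions of k are the k' = k[T]/(p) with p irreducible, and
   F (x) k' = F[T]/(p).  As k is perfect, X x k' is irreducible if and only if
   this k'-algebra is a field. *)
Definition geometrically_irreducible : Prop :=
  forall p : {poly k}, irreducible_poly p -> irreducible_poly (map_poly iota p).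

(* The discrete valuations are normalized, and the junk value at 0 is fixed, so
   that places correspond one to one to discrete valuation rings of F/k. *)
Record place := Place {
  ord :> F -> int;
  ord0 : ord 0 = 0;
  ordM : forall f g, f != 0 -> g != 0 -> ord (f * g) = ord f + ord g;
  ordD : forall f g, f != 0 -> g != 0 -> f + g != 0 ->
    Num.min (ord f) (ord g) <= ord (f + g);
  ord_const : forall c : k, c != 0 -> ord (iota c) = 0;
  ord_uniformizer : exists2 t : F, t != 0 & ord t = 1 }.

HB.instance Definition _ := gen_eqMixin place.
HB.instance Definition _ := gen_choiceMixin place.

Definition ord_ge (x : place) (n : int) : {pred F} :=
  [pred f | (f == 0) || (n <= x f)].

Lemma ord1 (x : place) : x 1 = 0.
Proof.
have /eqP := ordM x (oner_neq0 F) (oner_neq0 F).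
by rewrite mulr1 -subr_eq0 opprD addNKr oppr_eq0 => /eqP.
Qed.

Lemma ordN (x : place) f : x (- f) = x f.
Proof.
have [->|f0] := eqVneq f 0; first by rewrite oppr0.
rewrite -mulN1r ordM ?oppr_eq0 ?oner_eq0 //.
have -> : -1 = iota (-1) by rewrite rmorphN1.
by rewrite ord_const ?add0r // oppr_eq0 oner_eq0.
Qed.

Lemma ord_ge0 x n : 0 \in ord_ge x n.
Proof. by rewrite inE eqxx. Qed.

Lemma ord_geB x n : {in ord_ge x n &, forall f g, f - g \in ord_ge x n}.
Proof.
move=> f g; rewrite !inE.
have [->|f0] := eqVneq f 0; first by rewrite sub0r oppr_eq0 ordN.
have [->|g0] := eqVneq g 0; first by rewrite subr0 (negPf f0).
have [//|fg0 /= fn gn] := eqVneq (f - g) 0.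
apply: (le_trans _ (ordD _ f0 _ fg0)); last by rewrite oppr_eq0.
by rewrite le_min fn ordN.
Qed.

Lemma ord_geM x m n f g :
  f \in ord_ge x m -> g \in ord_ge x n -> f * g \in ord_ge x (m + n).
Proof.
rewrite !inE mulf_eq0.
have [->|f0] := eqVneq f 0; first by [].
have [->|g0] := eqVneq g 0; first by [].
by move=> /= fm gn; rewrite ordM // lerD.
Qed.

Lemma ord_ge1 x : 1 \in ord_ge x 0.
Proof. by rewrite inE ord1 lexx orbT. Qed.

Definition regular (S : set place) : {pred F} :=
  [pred f | `[< forall x, S x -> f \in ord_ge x 0 >]].

Fact regular_subring S : subring_closed (regular S).
Proof.
split=> [|f g|f g].
- by apply/asboolP => x _; exact: ord_ge1.
- move=> /asboolP fS /asboolP gS; apply/asboolP => x Sx.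
  by apply: ord_geB; [exact: fS|exact: gS].
- move=> /asboolP fS /asboolP gS; apply/asboolP => x Sx.
  by rewrite -[0]addr0; apply: ord_geM; [exact: fS|exact: gS].
Qed.

HB.instance Definition _ S :=
  GRing.isSubringClosed.Build F (regular S) (regular_subring S).

Record reg (S : set place) := Reg { reg_val : F; reg_valP : reg_val \in regular S }.

HB.instance Definition _ S := [isSub for @reg_val S].
HB.instance Definition _ S := [Choice of reg S by <:].
HB.instance Definition _ S := [SubChoice_isSubComNzRing of reg S by <:].

Fact regular_sub (S T : set place) (h : T `<=` S) (a : reg S) :
  val a \in regular T.
Proof. by apply/asboolP => x /h; have /asboolP h' := valP a; apply: h'. Qed.

Definition reg_res (S T : set place) (h : T `<=` S) (a : reg S) : reg T :=
  Reg (regular_sub h a).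

Definition max_ideal (x : place) : {pred reg [set x]} :=
  [pred a | val a \in ord_ge x 1].
Arguments max_ideal : clear implicits.

Fact max_ideal_closed x : idealr_closed (max_ideal x).
Proof.
split=> [||a u v].
- exact: ord_ge0.
- by rewrite inE /= inE oner_eq0 ord1.
- rewrite !inE /= => ux vx.
  have ax : val a \in ord_ge x 0.
    by have /asboolP h := valP a; apply: h.
  have aux : val a * val u \in ord_ge x 1 by rewrite -[1]add0r; exact: ord_geM.
  rewrite -[val v]opprK; apply: (ord_geB aux).
  by rewrite -sub0r; apply: (ord_geB (ord_ge0 _ _)).
Qed.

HB.instance Definition _ x :=
  isIdealr.Build (reg [set x]) (max_ideal x) (max_ideal_closed x).

Definition residue_field (x : place) := {ideal_quot (max_ideal x)}.
HB.instance Definition _ x := GRing.ComNzRing.on (residue_field x).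

Record zopen := ZOpen {
  zset :> set place;
  zopen_neq0 : zset !=set0;
  zopen_cofinite : finite_set (~` zset) }.

Record omod := OMod {
  sec :> forall U : zopen, lmodType (reg U);
  res : forall U V : zopen, V `<=` U -> sec U -> sec V;
  resD : forall (U V : zopen) (h : V `<=` U) s t, res h (s + t) = res h s + res h t;
  resZ : forall (U V : zopen) (h : V `<=` U) a s,
    res h (a *: s) = reg_res h a *: res h s;
  res_id : forall (U : zopen) (h : U `<=` U) s, res h s = s;
  res_comp : forall (U V W : zopen) (h : V `<=` U) (h' : W `<=` V)
      (h'' : W `<=` U) s,
    res h' (res h s) = res h'' s }.

Definition is_sheaf (M : omod) : Prop :=
  forall (U : zopen) (I : Type) (W : I -> zopen) (h : forall i, W i `<=` U),
    (forall x, zset U x -> exists i, zset (W i) x) ->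
    forall t : forall i, M (W i),
      (forall i j (V : zopen) (hi : V `<=` W i) (hj : V `<=` W j),
        res hi (t i) = res hj (t j)) ->
      exists! s : M U, forall i, res (h i) s = t i.

Record ohom (M N : omod) := OHom {
  hmap :> forall U, {linear M U -> N U};
  hmap_res : forall (U V : zopen) (h : V `<=` U) s,
    hmap V (res h s) = res h (hmap U s) }.

Definition short_exact (L M Q : omod) (j : ohom L M) (p : ohom M Q) : Prop :=
  [/\ forall U, injective (j U),
      forall U s, p U s = 0 <-> exists t, j U t = s
    & forall (U : zopen) (s : Q U) x, zset U x ->
        exists (V : zopen) (h : V `<=` U),
          zset V x /\ exists t : M V, p V t = res h s].

(* frame e : the sections e_i define an isomorphism O_U^n -> M|_U. *)
Definition frame (n : nat) (M : omod) (U : zopen) (e : 'I_n -> M U) : Prop :=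
  forall (V : zopen) (h : V `<=` U) (s : M V),
    exists! a : {ffun 'I_n -> reg V}, s = \sum_i a i *: res h (e i).

Definition vector_bundle (n : nat) (M : omod) : Prop :=
  is_sheaf M /\
  forall x, exists2 U : zopen, zset U x & exists e : 'I_n -> M U, frame e.

Record bihom (M L N : omod) := Bihom {
  bmap :> forall U, M U -> L U -> N U;
  bmapDl : forall U (s s' : M U) (t : L U), bmap (s + s') t = bmap s t + bmap s' t;
  bmapDr : forall U (s : M U) (t t' : L U), bmap s (t + t') = bmap s t + bmap s t';
  bmapZl : forall (U : zopen) (a : reg U) (s : M U) (t : L U),
    bmap (a *: s) t = a *: bmap s t;
  bmapZr : forall (U : zopen) (a : reg U) (s : M U) (t : L U),
    bmap s (a *: t) = a *: bmap s t;
  bmap_res : forall (U V : zopen) (h : V `<=` U) (s : M U) (t : L U),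
    bmap (res h s) (res h t) = res h (bmap s t) }.

(* The universal property of the tensor product of sheaves of O_X-modules. *)
Definition is_tensor (M L N : omod) (b : bihom M L N) : Prop :=
  is_sheaf N /\
  forall (P : omod) (c : bihom M L P), is_sheaf P ->
    exists phi : ohom N P,
      (forall U s t, phi U (b U s t) = c U s t) /\
      forall psi : ohom N P, (forall U s t, psi U (b U s t) = c U s t) ->
        forall U s, psi U s = phi U s.

(* M is isomorphic to M' tensored with some line bundle. *)
Definition twist_equiv (M M' : omod) : Prop :=
  exists2 L, vector_bundle 1 L & exists b : bihom M' L M, is_tensor b.

(* The elements of PBun_2 X are represented by their sets of representatives.
   The type omod is too large for MathComp's [set]. *)
Definition bclass := omod -> Prop.

Definition pclass (M : omod) : bclass :=
  fun M' => vector_bundle 2 M' /\ twist_equiv M' M.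

Definition PBun2 (v : bclass) : Prop :=
  exists2 M, vector_bundle 2 M & v = pclass M.

(* The dimension over k of V/W, where k acts through sc; 0 if infinite. *)
Definition is_kdim (T : zmodType) (sc : k -> T -> T) (V W : set T) (n : nat) :
    Prop :=
  exists2 e : 'I_n -> T, (forall i, V (e i)) &
    forall v, V v ->
      exists! c : {ffun 'I_n -> k}, W (v - \sum_i sc (c i) (e i)).

Definition kdim (T : zmodType) (sc : k -> T -> T) (V W : set T) : nat :=
  xget 0%N (is_kdim sc V W).

Fact iota_regular S (c : k) : iota c \in regular S.
Proof.
apply/asboolP => x _; rewrite inE fmorph_eq0.
by have [//|c0] := eqVneq c 0; rewrite ord_const.
Qed.

Definition reg_const S (c : k) : reg S := Reg (iota_regular S c).

Definition deg_place (x : place) : nat :=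
  kdim (fun (c : k) (u : residue_field x) =>
          \pi_(residue_field x) (reg_const [set x] c) * u)
       setT [set 0].

Definition divisor := {freeg place / int}.

Definition deg_div (D : divisor) : int :=
  \sum_(x <- dom D) coeff x D * (deg_place x)%:Z.

Definition lin_equiv (D E : divisor) : Prop :=
  exists2 f : F, f != 0 & forall x : place, coeff x (D - E) = x f.

(* The genus is the dimension of H^1(X, O_X), computed by the flasque
   resolution O_X -> F -> F/O_X: it is the quotient of the space of
   repartitions (families in F that are almost everywhere regular) by the sum
   of the everywhere regular ones and the constant ones. *)
Definition repartition : set (place -> F) :=
  [set r | finite_set [set x | r x \notin ord_ge x 0]].

Definition trivial_repartition : set (place -> F) :=
  [set r | exists f : F, forall x, r x - f \in ord_ge x 0].

Definition genus : nat :=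
  kdim (fun (c : k) (r : place -> F) => (fun x => iota c * r x) : place -> F)
       repartition trivial_repartition.

(* L_D: sections over U are the f with ord_x f + D(x) >= 0 for all x in U. *)
Definition lb_pred (D : divisor) (U : zopen) : {pred F} :=
  [pred f | `[< forall x, zset U x -> f \in ord_ge x (- coeff x D) >]].

Fact lb_zmod D U : zmod_closed (lb_pred D U).
Proof.
split=> [|f g]; first by apply/asboolP => x _; exact: ord_ge0.
move=> /asboolP fU /asboolP gU; apply/asboolP => x Ux.
by apply: ord_geB; [exact: fU|exact: gU].
Qed.

HB.instance Definition _ D U :=
  GRing.isZmodClosed.Build F (lb_pred D U) (lb_zmod D U).

Record lb_sec (D : divisor) (U : zopen) :=
  LbSec { lb_val : F; lb_valP : lb_val \in lb_pred D U }.

HB.instance Definition _ D U := [isSub for @lb_val D U].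
HB.instance Definition _ D U := [Choice of lb_sec D U by <:].
HB.instance Definition _ D U := [SubChoice_isSubZmodule of lb_sec D U by <:].

Fact lb_scale_subproof D (U : zopen) (a : reg U) (s : lb_sec D U) :
  val a * val s \in lb_pred D U.
Proof.
apply/asboolP => x Ux; rewrite -[- _]add0r; apply: ord_geM.
  by have /asboolP h := valP a; apply: h.
by have /asboolP h := valP s; apply: h.
Qed.

Definition lb_scale D (U : zopen) (a : reg U) (s : lb_sec D U) : lb_sec D U :=
  LbSec (lb_scale_subproof a s).

Fact lb_scaleA D U (a b : reg (zset U)) (s : lb_sec D U) :
  lb_scale a (lb_scale b s) = lb_scale (a * b) s.
Proof. by apply: val_inj; rewrite /= mulrA. Qed.
Fact lb_scale1 D U : left_id (1 : reg (zset U)) (@lb_scale D U).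
Proof. by move=> s; apply: val_inj; rewrite /= mul1r. Qed.
Fact lb_scaleDr D U : right_distributive (@lb_scale D U) +%R.
Proof. by move=> a s t; apply: val_inj; rewrite /= mulrDr. Qed.
Fact lb_scaleDl D U (s : lb_sec D U) : {morph (@lb_scale D U)^~ s : a b / a + b}.
Proof. by move=> a b; apply: val_inj; rewrite /= mulrDl. Qed.

HB.instance Definition _ D (U : zopen) :=
  GRing.Zmodule_isLmodule.Build (reg U) (lb_sec D U)
    (@lb_scaleA D U) (@lb_scale1 D U) (@lb_scaleDr D U) (@lb_scaleDl D U).

Fact lb_res_subproof D (U V : zopen) (h : V `<=` U) (s : lb_sec D U) :
  val s \in lb_pred D V.
Proof. by apply/asboolP => x /h; have /asboolP h' := valP s; apply: h'. Qed.

Definition lb_res D (U V : zopen) (h : V `<=` U) (s : lb_sec D U) : lb_sec D V :=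
  LbSec (lb_res_subproof h s).

Definition line_bundle (D : divisor) : omod.
Proof.
refine (@OMod (fun U => lb_sec D U) (@lb_res D) _ _ _ _).
- by move=> *; apply: val_inj.
- by move=> *; apply: val_inj.
- by move=> *; apply: val_inj.
- by move=> *; apply: val_inj.
Defined.

Definition structure_sheaf : omod.
Proof.
refine (@OMod (fun U => (reg U)^o) (fun U V h => reg_res h) _ _ _ _).
- by move=> *; apply: val_inj.
- by move=> *; apply: val_inj.
- by move=> *; apply: val_inj.
- by move=> *; apply: val_inj.
Defined.

Definition direct_sum (M N : omod) : omod.
Proof.
refine (@OMod (fun U => (M U * N U)%type)
  (fun U V h s => (res h s.1, res h s.2)) _ _ _ _).
- by move=> * /=; rewrite !resD.
- by move=> * /=; rewrite !resZ.
- by move=> U h [s t] /=; rewrite !res_id.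
- by move=> U V W h h' h'' [s t] /=; rewrite !(res_comp h h' h'').
Defined.

(* The skyscraper sheaf K_x: residue_field x on the U containing x, and 0 on
   the others.  Scalars act through their value at x. *)
Definition sky_pred (x : place) (U : zopen) : {pred residue_field x} :=
  [pred c | (c == 0) || `[< zset U x >]].
Arguments sky_pred : clear implicits.

Fact sky_zmod x U : zmod_closed (sky_pred x U).
Proof.
split=> [|c d]; first by rewrite inE eqxx.
rewrite !inE; case: (`[< _ >]); rewrite ?orbT // !orbF.
by move=> /eqP -> /eqP ->; rewrite subr0.
Qed.

HB.instance Definition _ x U :=
  GRing.isZmodClosed.Build (residue_field x) (sky_pred x U) (sky_zmod x U).

Record sky_sec (x : place) (U : zopen) :=
  SkySec { sky_val : residue_field x; sky_valP : sky_val \in sky_pred x U }.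

HB.instance Definition _ x U := [isSub for @sky_val x U].
HB.instance Definition _ x U := [Choice of sky_sec x U by <:].
HB.instance Definition _ x U := [SubChoice_isSubZmodule of sky_sec x U by <:].

Fact sub_set1 (U : set place) x : U x -> [set x] `<=` U.
Proof. by move=> Ux y ->. Qed.

Definition eval_at (x : place) (U : zopen) (a : reg U) : residue_field x :=
  match pselect (zset U x) with
  | left h => \pi_(residue_field x) (reg_res (sub_set1 h) a)
  | right _ => 0
  end.

Fact eval_atD x U : {morph @eval_at x U : a b / a + b}.
Proof.
move=> a b; rewrite /eval_at; case: pselect => h; last by rewrite addr0.
by rewrite -rmorphD; congr (\pi _); apply: val_inj.
Qed.

Fact eval_atM x U : {morph @eval_at x U : a b / a * b}.
Proof.
move=> a b; rewrite /eval_at; case: pselect => h; last by rewrite mulr0.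
by rewrite -rmorphM; congr (\pi _); apply: val_inj.
Qed.

Fact sky_scale_subproof x (U : zopen) (a : reg U) (c : sky_sec x U) :
  eval_at x a * val c \in sky_pred x U.
Proof.
have := valP c; rewrite !inE.
by case: (`[< _ >]); rewrite ?orbT // !orbF => /eqP ->; rewrite mulr0.
Qed.

Definition sky_scale x (U : zopen) (a : reg U) (c : sky_sec x U) : sky_sec x U :=
  SkySec (sky_scale_subproof a c).

Fact sky_scaleA x U (a b : reg (zset U)) (c : sky_sec x U) :
  sky_scale a (sky_scale b c) = sky_scale (a * b) c.
Proof. by apply: val_inj; rewrite /= eval_atM mulrA. Qed.
Fact sky_scale1 x U : left_id (1 : reg (zset U)) (@sky_scale x U).
Proof.
move=> c; apply: val_inj; rewrite /= /eval_at.
case: pselect => h.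
  suff -> : reg_res (sub_set1 h) 1 = 1 by rewrite rmorph1 mul1r.
  exact: val_inj.
by have := valP c; rewrite inE asboolF // orbF => /eqP ->; rewrite mulr0.
Qed.
Fact sky_scaleDr x U : right_distributive (@sky_scale x U) +%R.
Proof. by move=> a c d; apply: val_inj; rewrite /= mulrDr. Qed.
Fact sky_scaleDl x U (c : sky_sec x U) :
  {morph (@sky_scale x U)^~ c : a b / a + b}.
Proof. by move=> a b; apply: val_inj; rewrite /= eval_atD mulrDl. Qed.

HB.instance Definition _ x (U : zopen) :=
  GRing.Zmodule_isLmodule.Build (reg U) (sky_sec x U)
    (@sky_scaleA x U) (@sky_scale1 x U) (@sky_scaleDr x U) (@sky_scaleDl x U).

Fact sky_res_subproof x (U V : zopen) (c : sky_sec x U) :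
  (if `[< zset V x >] then val c else 0) \in sky_pred x V.
Proof. by rewrite inE; case: (`[< _ >]); rewrite ?orbT ?eqxx. Qed.

Definition sky_res x (U V : zopen) (h : V `<=` U) (c : sky_sec x U) :
  sky_sec x V := SkySec (sky_res_subproof V c).

Definition skyscraper (x : place) : omod.
Proof.
refine (@OMod (fun U => sky_sec x U) (@sky_res x) _ _ _ _).
- by move=> *; apply: val_inj => /=; case: asboolP; rewrite ?addr0.
- move=> U V h a s; apply: val_inj => /=; case: asboolP; rewrite ?mulr0 // => Vx.
  congr (_ * _); rewrite /eval_at; case: pselect => // Ux;
    last by case: (Ux (h _ Vx)).
  by case: pselect => // Vx'; congr (\pi _); apply: val_inj.
- move=> U h s; apply: val_inj => /=; case: asboolP => // Ux.
  by have := valP s; rewrite inE asboolF // orbF => /eqP ->.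
- move=> U V W h h' h'' s; apply: val_inj => /=.
  by case: asboolP => // Wx; rewrite asboolT //; exact: h'.
Defined.

(* The order at x of s_1 /\ ... /\ s_n, as a rational section of det M: the
   order of the determinant of the base change from a frame near x to s. *)
Definition det_order (n : nat) (M : omod) (U : zopen) (s : 'I_n -> M U)
    (x : place) (m : int) : Prop :=
  exists (V W : zopen) (e : 'I_n -> M V) (hU : W `<=` U) (hV : W `<=` V)
    (A : 'M[reg W]_n),
    [/\ zset V x, frame e,
        forall i, res hU (s i) = \sum_j A i j *: res hV (e j),
        \det A != 0 & m = x (val (\det A))].

(* deg M = deg (det M): the degree of the divisor of a nonzero rational
   section of det M. *)
Definition deg_bundle (n : nat) (M : omod) : int :=
  xget 0 [set d | exists (U : zopen) (s : 'I_n -> M U) (E : divisor),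
    (forall x, det_order s x (coeff x E)) /\ d = deg_div E].

Definition line_subbundle (L M : omod) (j : ohom L M) : Prop :=
  vector_bundle 1 L /\
  exists (n : nat) (Q : omod) (p : ohom M Q), vector_bundle n Q /\ short_exact j p.

Definition delta_bundle (M : omod) : int :=
  supremum 0 [set d | exists (L : omod) (j : ohom L M),
    line_subbundle j /\ d = 2 * deg_bundle 1 L - deg_bundle 2 M].

Definition representative (v : bclass) : omod :=
  match pselect (exists M, v M) with
  | left h => sval (cid h)
  | right _ => structure_sheaf
  end.

Definition delta (v : bclass) : int := delta_bundle (representative v).

(* A subsheaf is recorded by its sets of sections.  N is a subsheaf of M with
   M/N = K_x, and the class of N is v. *)
Definition hecke_subsheaf (x : place) (M : omod) (v : bclass)
    (N : forall U, set (M U)) : Prop :=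
  exists (B : omod) (j : ohom B M) (p : ohom M (skyscraper x)),
    [/\ v B, short_exact j p & forall U, N U = range (j U)].

Definition mult_bundle (x : place) (M : omod) (v : bclass) : nat :=
  xget 0%N [set n | hecke_subsheaf x (M := M) v #= `I_n]%card.

Definition mult (x : place) (v v' : bclass) : nat :=
  mult_bundle x (representative v) v'.

(* The set U_x(v) of triples (v, v', m). *)
Definition hecke_edges (x : place) (v : bclass) :
    bclass * bclass * nat -> Prop :=
  fun t => [/\ t.1.1 = v, PBun2 t.1.2, t.2 = mult x v t.1.2 & t.2 <> 0%N].

Definition cc (D : divisor) : bclass :=
  pclass (direct_sum (line_bundle D) structure_sheaf).

Definition pt (x : place) : divisor := << x >>.

Definition top_edges (x : place) (D : divisor) :
    bclass * bclass * nat -> Prop :=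
  fun t =>
    [\/ lin_equiv D 0 /\ t = (cc 0, cc (pt x), #|k|.+1),
        [/\ deg_div D = 0, lin_equiv (D *+ 2) 0, ~ lin_equiv D 0
          & t = (cc D, cc (D + pt x), 2%N)],
        [/\ deg_div D = 0, ~ lin_equiv (D *+ 2) 0
          & t = (cc D, cc (D + pt x), 1%N) \/ t = (cc D, cc (- D + pt x), 1%N)]
      | 0 < deg_div D /\ t = (cc D, cc (D + pt x), 1%N)].

End FunctionField.

(* Main.v *)
(** A rank 2 bundle is a family of lattices in F^2, so the subsheaves of L_D + O with quotient
    K_x correspond to the points of the projective line over the residue field at x. A line
    subsheaf of such a subsheaf is a divisor A with a vector v of F^2, and degrees of principal
    divisors vanish: deg A <= deg D if v lies in L_D, and deg A <= 0 otherwise. Hence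
    delta = deg D + d_x holds only at points whose line contains the fibre of a subbundle of
    degree deg D. If deg D > 0, this is the summand L_D alone; if deg D = 0 and [D] <> 0,
    it is one of the two summands; if [D] = 0, it is one of the #|k| + 1 lines defined over k.
    All other lines are the fibre of O under a map (h, 1): O -> L_D + O as soon as
    L(D) -> kappa_x is surjective, which holds when deg D > m_X + d_x, because then
    H^1(X, L_(D - x)) = 0; the corresponding subsheaves are then isomorphic to
    L_(D - x) + O. *)
From HB Require Import structures.
From mathcomp Require Import all_boot all_order all_algebra.
From mathcomp Require Import freeg boolp classical_sets functions cardinality.
From mathcomp Require Import zify ring.
Require Import Defs.

Set Implicit Arguments.
Unset Strict Implicit.
Unset Printing Implicit Defensive.

Import Order.TTheory GRing.Theory Num.Theory.
Local Open Scope classical_set_scope.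
Local Open Scope ring_scope.

(** * Relative dimension over the constant field *)

(** The curve is given by its valuations alone. That places exist, that there are infinitely many
    (otherwise a cofinite set could be empty), and that principal divisors have degree 0 all rest on
    one quantity: the largest size of a family in F without a relation over k[z]. It is [F : k(z)]
    for z transcendental over k, and a dimension count bounds it for every z. It forces valuation
    rings to be discrete and residue fields to be finite, and it lies between the degree of the
    zeros of z and that of its poles. Geometric irreducibility enters through a single fact: an
    element of F algebraic over k lies in k. The vanishing of H^1(X, L_A) for deg A > 2g - 2 is
    obtained without Serre duality: a nonzero functional on it would embed the sections of L_A into
    the dual of H^1(X, O_X), which by Riemann's inequality is too small. This is where the constant
    m_X comes from. Upper bounds for delta use only injections of line bundles. Saturation is
    checked only for the subbundle spanned by (1, 0), which attains the supremum wherever an exact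
    value is needed. *)

Section RelativeDimension.
Variables (k : finFieldType) (T : lmodType k).
Implicit Types (V W U : set T).

Definition subspace V := V 0 /\ forall (a : k) u v, V u -> V v -> V (a *: u + v).

Lemma subspace_sum V (I : finType) (x : I -> k) (f : I -> T) :
  subspace V -> (forall i, V (f i)) -> V (\sum_i x i *: f i).
Proof.
move=> [V0 Vl] Vf; elim/big_rec: _ => // i y _ Vy; exact: Vl.
Qed.

Lemma subspaceD V u v : subspace V -> V u -> V v -> V (u + v).
Proof. by move=> [_ Vl] Vu Vv; rewrite -[u]scale1r; apply: Vl. Qed.

Lemma subspaceZ V a u : subspace V -> V u -> V (a *: u).
Proof. by move=> [V0 Vl] Vu; rewrite -[_ *: _]addr0; apply: Vl. Qed.

Lemma subspaceN V u : subspace V -> V u -> V (- u).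
Proof. by move=> sV Vu; rewrite -scaleN1r; apply: subspaceZ. Qed.

Lemma subspaceB V u v : subspace V -> V u -> V v -> V (u - v).
Proof. by move=> sV Vu Vv; apply: subspaceD => //; apply: subspaceN. Qed.

(** The dimension of V modulo its intersection with W. W need not lie in V, as when V consists of
    adeles with bounded poles and W of adeles congruent to a global function. *)
Definition reldim V W n := is_kdim (fun a (v : T) => a *: v) V W n.

Definition freemod W (I : finType) (f : I -> T) :=
  forall x : I -> k, W (\sum_i x i *: f i) -> forall i, x i = 0.

Lemma wide_mx_ker (m n : nat) (A : 'M[k]_(m, n)) : (n < m)%N ->
  exists2 v : 'rV[k]_m, v != 0 & v *m A = 0.
Proof.
move=> nm; have : kermx A != 0.
  rewrite -mxrank_eq0 mxrank_ker subn_eq0 -ltnNge.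
  exact: leq_ltn_trans (rank_leq_col A) nm.
case/rowV0Pn => v vK v0; exists v => //.
by apply/sub_kermxP.
Qed.

(** The coordinates of the f_i along the g_j form a matrix with more rows than columns; a vector in
    its left kernel is a relation modulo W. *)
Lemma span_dependent W (I J : finType) (f : I -> T) (g : J -> T) :
  subspace W -> (#|J| < #|I|)%N ->
  (forall i, exists c : J -> k, W (f i - \sum_j c j *: g j)) ->
  exists2 x : I -> k, (exists i, x i != 0) & W (\sum_i x i *: f i).
Proof.
move=> sW JI /choice[c cP].
pose A := \matrix_(a < #|I|, b < #|J|) c (enum_val a) (enum_val b).
have [v v0 vA] := wide_mx_ker A JI.
pose x i := v 0 (enum_rank i); exists x.
  case/rV0Pn: v0 => a va; exists (enum_val a); rewrite /x enum_valK //.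
suff -> : \sum_i x i *: f i = \sum_i x i *: (f i - \sum_j c i j *: g j).
  exact: subspace_sum.
apply/eqP; rewrite eq_sym; under eq_bigr do rewrite scalerBr.
rewrite sumrB subr_eq addrC -subr_eq subrr eq_sym; apply/eqP.
under eq_bigr => i _ do rewrite scaler_sumr.
rewrite exchange_big /=; apply: big1 => j _.
under eq_bigr => i _ do rewrite scalerA.
rewrite -scaler_suml (_ : \sum_i _ = 0) ?scale0r //.
have /rowP/(_ (enum_rank j)) := vA; rewrite !mxE => h; rewrite -[RHS]h.
rewrite (reindex (fun a : 'I_#|I| => enum_val a)) /=; last first.
  by exists enum_rank => i _; rewrite ?enum_valK ?enum_rankK.
by apply: eq_bigr => a _; rewrite mxE /x enum_valK enum_rankK.
Qed.

Lemma reldim_dependent V W n (I : finType) (f : I -> T) :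
  subspace W -> reldim V W n -> (n < #|I|)%N -> (forall i, V (f i)) ->
  exists2 x : I -> k, (exists i, x i != 0) & W (\sum_i x i *: f i).
Proof.
move=> sW [e _ eP] nI Vf; apply: (@span_dependent W I 'I_n f e) => //.
  by rewrite card_ord.
by move=> i; have [c [cP _]] := eP _ (Vf i); exists c.
Qed.

Lemma reldim_free V W n : V 0 -> W 0 -> reldim V W n ->
  exists2 e : 'I_n -> T, (forall i, V (e i)) & freemod W e /\
  forall v, V v -> exists c : 'I_n -> k, W (v - \sum_i c i *: e i).
Proof.
move=> V0 W0 [e Ve eP]; exists e => //; split.
  move=> x Wx i; have [c [_ cu]] := eP _ V0.
  have h1 : c = 0.
    apply: cu; rewrite big1 ?subr0 // => j _; rewrite ffunE scale0r //.
  have : c = [ffun i => - x i].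
    apply: cu; rewrite sub0r -sumrN.
    by under eq_bigr do rewrite ffunE scaleNr opprK.
  by rewrite h1 => /ffunP/(_ i); rewrite !ffunE => /eqP; rewrite eq_sym oppr_eq0 => /eqP.
by move=> v /eP[c [cP _]]; exists c.
Qed.

Lemma free_reldim V W n (e : 'I_n -> T) : subspace W -> (forall i, V (e i)) ->
  freemod W e ->
  (forall v, V v -> exists c : 'I_n -> k, W (v - \sum_i c i *: e i)) ->
  reldim V W n.
Proof.
move=> sW Ve fe span; exists e => // v /span[c cP]; exists [ffun i => c i]; split.
  by under eq_bigr do rewrite ffunE.
move=> d dP; apply/ffunP => i; rewrite ffunE; apply/eqP; rewrite -subr_eq0; apply/eqP.
move: i; apply: fe.
rewrite (_ : \sum_i _ = v - \sum_i d i *: e i - (v - \sum_i c i *: e i)).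
  exact: subspaceB.
under eq_bigr do rewrite scalerBl.
by rewrite sumrB opprB [RHS]addrC addrA subrK.
Qed.

Lemma reldim_free_le V W n (I : finType) (f : I -> T) : subspace W ->
  reldim V W n -> (forall i, V (f i)) -> freemod W f -> (#|I| <= n)%N.
Proof.
move=> sW dn Vf fW; rewrite leqNgt; apply/negP => nI.
by have [x [i xi] /fW/(_ i)xi0] := reldim_dependent sW dn nI Vf; rewrite xi0 eqxx in xi.
Qed.

Lemma reldim_le V W V' n m : subspace V -> subspace W -> V `<=` V' ->
  reldim V W n -> reldim V' W m -> (n <= m)%N.
Proof.
move=> [V0 _] sW VV' dn dm; have [e Ve [fe _]] := reldim_free V0 (proj1 sW) dn.
by have := reldim_free_le sW dm (fun i => VV' _ (Ve i)) fe; rewrite card_ord.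
Qed.

Lemma reldim_uniq V W n m : subspace V -> subspace W ->
  reldim V W n -> reldim V W m -> n = m.
Proof.
move=> sV sW dn dm; apply/eqP; rewrite eqn_leq.
by rewrite (reldim_le sV sW _ dn dm) // (reldim_le sV sW _ dm dn).
Qed.

(** A mere bound on independent families gives a finite dimension: a maximal one spans, because
    adjoining v creates a relation in which v has a nonzero coefficient. *)
Lemma reldim_exists V W N : subspace V -> subspace W ->
  (forall f : 'I_N.+1 -> T, (forall i, V (f i)) -> ~ freemod W f) ->
  exists2 n, (n <= N)%N & reldim V W n.
Proof.
move=> sV sW noF.
pose P n := `[< exists2 f : 'I_n -> T, (forall i, V (f i)) & freemod W f >].
have P0 : exists n, P n.
  exists 0%N; apply/asboolP; exists (fun => 0) => [[] //|x _ []//].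
have Pdown n : P n.+1 -> P n.
  move=> /asboolP[f Vf fW]; apply/asboolP; exists (fun i => f (widen_ord (leqnSn n) i)) => // x Wx i.
  pose y (j : 'I_n.+1) := if insub (val j) is Some i then x i else 0.
  have yi (j : 'I_n) : y (widen_ord (leqnSn n) j) = x j.
    by rewrite /y insubT //= => h; congr x; apply: val_inj.
  have := fW y; rewrite big_ord_recr /= {2}/y insubN /= ?ltnn // scale0r addr0.
  under eq_bigr do rewrite yi.
  by move=> /(_ Wx (widen_ord (leqnSn n) i)); rewrite yi.
have Pb n : P n -> (n <= N)%N.
  rewrite leqNgt => Pn; apply/negP => Nn.
  suff : P N.+1 by move=> /asboolP[f Vf fW]; exact: (noF f).
  by elim: n Nn Pn => // n IH; rewrite ltnS leq_eqVlt => /orP[/eqP->//|/IH h /Pdown].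
case: (ex_maxnP P0 Pb) => n /asboolP[e Ve eW] nmax.
exists n; first by apply: Pb; apply/asboolP; exists e.
apply: (free_reldim sW Ve eW) => v Vv.
pose f (o : option 'I_n) := if o is Some i then e i else v.
have : ~ freemod W f.
  move=> fW; suff /nmax : P n.+1 by rewrite ltnn.
  have cO : #|{: option 'I_n}| = n.+1 by rewrite card_option card_ord.
  apply/asboolP; exists (fun i => f (enum_val (cast_ord (esym cO) i))).
    by move=> i; rewrite /f; case: (enum_val _).
  move=> x Wx i.
  have := fW (fun o => x (cast_ord cO (enum_rank o))).
  rewrite (reindex (fun i => enum_val (cast_ord (esym cO) i))) /=; last first.
    exists (fun o => cast_ord cO (enum_rank o)) => j _.
      by rewrite enum_valK cast_ordKV.
    by rewrite cast_ordK enum_rankK.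
  under eq_bigr do rewrite enum_valK cast_ordKV.
  by move=> /(_ Wx (enum_val (cast_ord (esym cO) i))); rewrite enum_valK cast_ordKV.
move=> /existsNP[x] /not_implyP[].
rewrite (bigD1 None) //= (reindex_omap Some id) /=; last by case.
under eq_bigl do rewrite eqxx.
move=> Wx /existsNP[o xo].
have x0 : x None != 0.
  apply: contra_notN xo => /eqP x0; case: o => // i.
  by apply: (eW (x \o Some)); move: Wx; rewrite x0 scale0r add0r.
exists (fun i => - ((x None)^-1 * x (Some i))).
move: Wx => /(subspaceZ (x None)^-1 sW).
rewrite scalerDr scalerA mulVf // scale1r scaler_sumr.
rewrite -sumrN.
by under [X in _ -> W (_ + X)]eq_bigr do rewrite scaleNr opprK -scalerA.
Qed.

Lemma reldim_sub V W U n : subspace U -> subspace V -> subspace W ->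
  V `<=` U -> reldim U W n -> exists2 m, (m <= n)%N & reldim V W m.
Proof.
move=> sU sV sW VU dn; apply: reldim_exists => // f Vf fW.
have := reldim_free_le sW dn (fun i => VU _ (Vf i)) fW.
by rewrite card_ord ltnn.
Qed.

Lemma reldim_quo V W U n : subspace U -> subspace V -> subspace W ->
  W `<=` V -> reldim U W n -> exists2 m, (m <= n)%N & reldim U V m.
Proof.
move=> sU sV sW WV dn; apply: reldim_exists => // f Uf fV.
have fW : freemod W f by move=> x /WV; exact: fV.
have := reldim_free_le sW dn Uf fW.
by rewrite card_ord ltnn.
Qed.

Lemma reldim_add V W U n m : subspace U -> subspace V -> subspace W ->
  V `<=` U -> W `<=` V -> reldim U V n -> reldim V W m -> reldim U W (n + m).
Proof.
move=> sU sV sW VU WV /(reldim_free (proj1 sU) (proj1 sV)) [e Ue [fe se]].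
move=> /(reldim_free (proj1 sV) (proj1 sW)) [f Vf [ff sf]].
have spl (a : 'I_n) : fintype.split (lshift m a) = inl a := unsplitK (inl a : 'I_n + 'I_m).
have spr (b : 'I_m) : fintype.split (rshift n b) = inr b := unsplitK (inr b : 'I_n + 'I_m).
pose g (i : 'I_(n + m)) := match fintype.split i with inl a => e a | inr b => f b end.
have gE (x : 'I_(n + m) -> k) : \sum_i x i *: g i =
    \sum_i x (lshift m i) *: e i + \sum_i x (rshift n i) *: f i.
  by rewrite big_split_ord /g; congr (_ + _); apply: eq_bigr => i _; rewrite ?spl ?spr.
apply: (@free_reldim _ _ _ g) => //.
- by move=> i; rewrite /g; case: fintype.split => j; [exact: Ue|exact/VU/Vf].
- move=> x; rewrite gE => Wx.
  have xe i : x (lshift m i) = 0.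
    apply: (fe (fun j => x (lshift m j))) => /=; move: (Wx) => /WV.
    move=> /(subspaceB sV)/(_ (subspace_sum (fun j => x (rshift n j)) sV Vf)).
    by rewrite addrK.
  have xf i : x (rshift n i) = 0.
    apply: (ff (fun j => x (rshift n j))) => /=; move: Wx; rewrite big1 ?add0r // => j _.
    by rewrite xe scale0r.
  by move=> i; rewrite -(@fintype.splitK n m i); case: (fintype.split i) => j /=; [exact: xe|exact: xf].
- move=> v /se [c /sf [d dP]].
  exists (fun i => match fintype.split i with inl a => c a | inr b => d b end).
  rewrite gE opprD addrA; under eq_bigr do rewrite spl.
  by under [X in _ - X]eq_bigr do rewrite spr.
Qed.

Lemma reldim0P V W : subspace W -> reldim V W 0 <-> V `<=` W.
Proof.
move=> sW; split=> [[e _ eP] v /eP[c [+ _]]|VW].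
  by rewrite big_ord0 subr0.
apply: (@free_reldim _ _ _ (fun=> 0)) => //.
- by case.
- by move=> x _ [].
- by move=> v /VW Wv; exists (fun=> 0); rewrite big_ord0 subr0.
Qed.

Lemma reldim_flag V W U n : subspace U -> subspace V -> subspace W ->
  V `<=` U -> W `<=` V -> reldim U W n ->
  exists m m', [/\ reldim U V m, reldim V W m' & n = (m + m')%N].
Proof.
move=> sU sV sW VU WV dn.
have [m _ dm] := reldim_quo sU sV sW WV dn.
have [m' _ dm'] := reldim_sub sU sV sW VU dn.
exists m, m'; split=> //.
exact: reldim_uniq dn (reldim_add sU sV sW VU WV dm dm').
Qed.

Lemma reldim_eq_sub V V' W n : subspace V -> subspace V' -> subspace W ->
  W `<=` V -> V `<=` V' -> reldim V W n -> reldim V' W n -> V' `<=` V.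
Proof.
move=> sV sV' sW WV VV' d d'; apply/(reldim0P _ sV).
have [m [m' [dm dm' e]]] := reldim_flag sV' sV sW VV' WV d'.
have := reldim_uniq sV sW d dm' => e'.
by have -> : 0%N = m by lia.
Qed.

End RelativeDimension.

Section RelativeDimensionMap.
Variables (k : finFieldType) (T T' : lmodType k) (phi : {linear T -> T'}).
Variables (V W : set T) (V' W' : set T').
Hypotheses (sV : subspace V) (sW : subspace W) (sV' : subspace V') (sW' : subspace W').
Hypotheses (VV' : forall v, V v -> V' (phi v)).
Hypothesis (WW' : forall v, V v -> W v <-> W' (phi v)).

(** phi induces an isomorphism V/W -> V'/W': [WW'] is its injectivity, the hypothesis here its
    surjectivity. *)
Lemma reldim_map n : (forall v', V' v' -> exists2 v, V v & W' (v' - phi v)) ->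
  reldim V W n <-> reldim V' W' n.
Proof.
move=> surj; split.
  move=> /(reldim_free (proj1 sV) (proj1 sW)) [e Ve [fe se]].
  apply: (@free_reldim _ _ _ _ _ (phi \o e)) => //.
  - by move=> i; apply: VV'.
  - move=> x Wx; apply: fe; apply/WW'; first exact: subspace_sum.
    by rewrite linear_sum; under eq_bigr do rewrite linearZ.
  - move=> v' /surj[v Vv vv']; have [c cP] := se _ Vv; exists c.
    have -> : v' - \sum_i c i *: (phi \o e) i =
              (v' - phi v) + phi (v - \sum_i c i *: e i).
      rewrite linearB addrA subrK; congr (_ - _); rewrite linear_sum.
      by apply: eq_bigr => i _; rewrite linearZ.
    apply: (subspaceD sW') => //; apply/WW' => //.
    apply: (subspaceB sV) => //; exact: subspace_sum.
move=> /(reldim_free (proj1 sV') (proj1 sW')) [e' Ve' [fe' se']].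
have /choice[e eP] : forall i, exists v, V v /\ W' (e' i - phi v).
  by move=> i; have [v] := surj _ (Ve' i); exists v.
have eqe (x : 'I_n -> k) : W' (\sum_i x i *: e' i - phi (\sum_i x i *: e i)).
  rewrite [phi _]linear_sum -sumrB; under eq_bigr do rewrite linearZ -scalerBr.
  apply: (@subspace_sum _ _ _ _ _ (fun i => e' i - phi (e i))) => // i.
  by have [] := eP i.
have Ve i : V (e i) by have [] := eP i.
apply: (@free_reldim _ _ _ _ _ e) => //.
- move=> x; rewrite WW'; last exact: subspace_sum.
  move=> /(subspaceD sW' (eqe x)); rewrite subrK; exact: fe'.
- move=> v Vv; have [c cP] := se' _ (VV' Vv); exists c.
  apply/WW'; first by apply: (subspaceB sV) => //; exact: subspace_sum.
  rewrite linearB -[phi v](subrK (\sum_i c i *: e' i)) -addrA.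
  exact: (subspaceD sW').
Qed.

Lemma reldim_inj n : reldim V' W' n -> exists2 m, (m <= n)%N & reldim V W m.
Proof.
move=> dn; apply: reldim_exists => // f Vf fW.
have : freemod W' (phi \o f).
  move=> x Wx; apply: fW; apply/WW'; first exact: subspace_sum.
  by rewrite linear_sum; under eq_bigr do rewrite linearZ.
move=> /(reldim_free_le sW' dn); rewrite card_ord => h.
by have := h (fun i => VV' (Vf i)); rewrite ltnn.
Qed.

End RelativeDimensionMap.

(** * Linear dependence over a polynomial subring *)

Section FieldDegree.
Variables (k : finFieldType) (F : fieldType) (iota : {rmorphism k -> F}).

(** A copy of F indexed by the structure map, to which the k-module structure through iota can be
    attached. *)
Definition base_vect (i : {rmorphism k -> F}) : Type := F.
HB.instance Definition _ := GRing.Zmodule.on (base_vect iota).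

Definition base_scale (c : k) (f : base_vect iota) : base_vect iota := iota c * (f : F).
Fact base_scaleA a b f : base_scale a (base_scale b f) = base_scale (a * b) f.
Proof. by rewrite /base_scale rmorphM mulrA. Qed.
Fact base_scale1 : left_id 1 base_scale.
Proof. by move=> f; rewrite /base_scale rmorph1 mul1r. Qed.
Fact base_scaleDr : right_distributive base_scale +%R.
Proof. by move=> a f g; rewrite /base_scale mulrDr. Qed.
Fact base_scaleDl f : {morph base_scale^~ f : a b / a + b}.
Proof. by move=> a b; rewrite /base_scale rmorphD mulrDl. Qed.
HB.instance Definition _ := GRing.Zmodule_isLmodule.Build k (base_vect iota)
  base_scaleA base_scale1 base_scaleDr base_scaleDl.

Lemma base_vectZ (c : k) (f : F) : c *: (f : base_vect iota) = iota c * f.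
Proof. by []. Qed.

Definition pev (p : {poly k}) (z : F) : F := (map_poly iota p).[z].

Lemma pevD p q z : pev (p + q) z = pev p z + pev q z.
Proof. by rewrite /pev rmorphD hornerD. Qed.
Lemma pevM p q z : pev (p * q) z = pev p z * pev q z.
Proof. by rewrite /pev rmorphM hornerM. Qed.
Lemma pevC c z : pev c%:P z = iota c.
Proof. by rewrite /pev map_polyC hornerC. Qed.
Lemma pevX z : pev 'X z = z.
Proof. by rewrite /pev map_polyX hornerX. Qed.
Lemma pev0 z : pev 0 z = 0.
Proof. by rewrite /pev rmorph0 horner0. Qed.
Lemma pevB p q z : pev (p - q) z = pev p z - pev q z.
Proof. by rewrite /pev rmorphB !hornerE. Qed.
Lemma pev1 z : pev 1 z = 1.
Proof. by rewrite /pev rmorph1 hornerE. Qed.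
Lemma pev_coef n (p : {poly k}) z : (size p <= n)%N -> pev p z = \sum_(i < n) iota p`_i * z ^+ i.
Proof.
move=> pn; rewrite /pev (@horner_coef_wide _ n); last by rewrite size_map_poly.
by apply: eq_bigr => i _; rewrite coef_map.
Qed.

Lemma poly_split0 (p : {poly k}) : exists q, p = (p`_0)%:P + q * 'X.
Proof.
exists (\poly_(i < size p) p`_i.+1); apply/polyP => -[|i].
  by rewrite coefD coefC eqxx coefMX eqxx addr0.
rewrite coefD coefC add0r coefMX coef_poly /=; case: ltnP => // /leqW h.
by rewrite nth_default.
Qed.

(** Linear dependence over k[z]. For z transcendental over k this is dependence over k(z); for z
    algebraic every nonempty family is dependent. *)
Definition zdep (z : F) (I : finType) (u : I -> F) := exists2 p : I -> {poly k},
  (exists i, p i != 0) & \sum_i pev (p i) z * u i = 0.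

(** A common factor X of the coefficients can be cancelled as long as z is nonzero. A nonzero
    constant term is what survives when a relation is reduced at a zero of z. *)
Lemma zdep_primitive z (I : finType) (u : I -> F) : z != 0 -> zdep z u ->
  exists2 p : I -> {poly k}, (exists i, (p i)`_0 != 0) &
    \sum_i pev (p i) z * u i = 0.
Proof.
move=> z0 [p [i pi] pu]; have [n] := ubnP (\sum_i size (p i))%N.
elim: n p i pi pu => // n IH p i pi pu; rewrite ltnS => pn.
have [h|h] := pselect (exists i, (p i)`_0 != 0); first by exists p.
have p0 j : (p j)`_0 = 0 by apply/eqP/negPn/negP => pj; apply: h; exists j.
have /choice[q qE] : forall j, exists q, p j = q * 'X.
  by move=> j; have [q] := poly_split0 (p j); rewrite p0 add0r; exists q.
have szq j : size (p j) = (size (q j) + (q j != 0%R))%N.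
  by rewrite qE; case: eqVneq => [->|q0]; rewrite ?mul0r ?size_poly0 ?size_mulX ?addn1.
have qi : q i != 0 by apply: contraNneq pi => qi; rewrite qE qi mul0r.
apply: (IH q i qi).
  apply: (mulIf z0); rewrite mul0r mulr_suml -[RHS]pu; apply: eq_bigr => j _.
  by rewrite qE pevM pevX mulrAC.
apply: leq_trans pn; rewrite (bigD1 i) //= [leqRHS](bigD1 i) //= szq qi addn1 addSn ltnS.
by rewrite leq_add2l; apply: leq_sum => j _; rewrite szq leq_addr.
Qed.

Lemma zdep_ord_max z m n (u : 'I_n -> F) :
  (m <= n)%N -> (forall v : 'I_m -> F, zdep z v) -> zdep z u.
Proof.
move=> mn /(_ (fun i => u (widen_ord mn i)))[p [i pi] pu].
pose q (j : 'I_n) := if insub (val j) is Some i then p i else 0.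
have qE (j : 'I_m) : q (widen_ord mn j) = p j.
  by rewrite /q insubT //= => h; congr p; apply: val_inj.
exists q; first by exists (widen_ord mn i); rewrite qE.
rewrite (bigID (fun j : 'I_n => (j < m)%N)) /= [X in _ + X]big1 ?addr0; last first.
  by move=> j jm; rewrite /q insubN // pev0 mul0r.
rewrite (big_ord_narrow mn) -[RHS]pu; apply: eq_bigr => j _; by rewrite qE.
Qed.

Section CommonDenominator.
Variables (t : F) (n : nat) (e : 'I_n -> F).
Hypothesis tr : forall p : {poly k}, pev p t = 0 -> p = 0.

(** Combinations of the generators with coefficients in k[t] of degree less than D: a filtration of
    F by k-spaces of dimension at most n*D. *)
Let V D (f : F) := exists2 a : 'I_n -> {poly k},
  (forall j, size (a j) <= D)%N & f = \sum_j pev (a j) t * e j.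

Let VM D d (b : {poly k}) f : V D f -> (size b <= d.+1)%N -> V (D + d) (pev b t * f).
Proof.
move=> [a aD ->] bd; exists (fun j => b * a j) => [j|].
  by have := size_polyMleq b (a j); have := aD j; lia.
by rewrite mulr_sumr; apply: eq_bigr => j _; rewrite pevM mulrA.
Qed.

Let V_wide D D' f : (D <= D')%N -> V D f -> V D' f.
Proof. by move=> DD [a aD ->]; exists a => // j; exact: leq_trans DD. Qed.

Let V_add D f g : V D f -> V D g -> V D (f + g).
Proof.
move=> [a aD ->] [b bD ->]; exists (fun j => a j + b j) => [j|].
  by apply: leq_trans (size_polyD _ _) _; rewrite geq_max aD bD.
by rewrite -big_split /=; apply: eq_bigr => j _; rewrite pevD mulrDl.
Qed.

Let V0 D : V D 0.
Proof.
exists (fun=> 0) => [j|]; first by rewrite size_poly0.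
by rewrite big1 // => j _; rewrite pev0 mul0r.
Qed.

Hypothesis span : forall f : F, exists a b : 'I_n -> {poly k},
  (forall i, b i != 0) /\ f = \sum_i pev (a i) t / pev (b i) t * e i.

Let pevN0 p : p != 0 -> pev p t != 0.
Proof. by apply: contra_neq; exact: tr. Qed.

Let denom f : exists2 b, b != 0 & exists D, V D (pev b t * f).
Proof.
have [a [b [b0 ->]]] := span f; exists (\prod_i b i).
  by apply/prodf_neq0 => i _.
pose c j := (\prod_(i | i != j) b i) * a j.
exists (\max_j size (c j)); exists c => [j|]; first exact: leq_bigmax.
rewrite mulr_sumr; apply: eq_bigr => j _.
rewrite pevM (bigD1 j) //= pevM -!mulrA; move: (pevN0 (b0 j)).
set x := pev (b j) t; set y := pev (a j) t; set w := pev _ t => x0.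
by rewrite mulrCA; congr (_ * _); rewrite mulrCA; congr (_ * _); rewrite mulrA mulfV ?mul1r.
Qed.

Let denoms (I : finType) (u : I -> F) :
  exists2 b, b != 0 & exists D, forall i, V D (pev b t * u i).
Proof.
have /choice[b bP] : forall i, exists b, b != 0 /\ exists D, V D (pev b t * u i).
  by move=> i; have [b] := denom (u i); exists b.
have /choice[D DP] : forall i, exists D, V D (pev (b i) t * u i).
  by move=> i; have [_] := bP i.
exists (\prod_i b i); first by apply/prodf_neq0 => i _; have [] := bP i.
pose c i := \prod_(j | j != i) b j.
exists (\max_i (D i + size (c i)))%N => i.
apply: (@V_wide (D i + size (c i))); first exact: (leq_bigmax (F := fun i => D i + size (c i))%N).
rewrite (bigD1 i) //= -/(c i) mulrC pevM mulrA mulrC [u i * _]mulrC.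
by apply: VM.
Qed.

(** A dimension count. Multiplication by b(t) or by b(t)z raises the filtration [V] by at most d, so
    the products b^m c z^i u_l with i <= m all lie in level D1 + m*d. For n*d+1 elements u_l there
    are more products than dimensions once m is large, and a k-relation between the products is a
    k[z]-relation between the u_l. The size n*d+1 depends on z but not on u. *)
Lemma zdep_span z : exists N, forall u : 'I_N -> F, zdep z u.
Proof.
have [b b0 [D0 bz]] := denoms (fun i => z * e i).
pose d := maxn D0 (size b).
have Vz D f : V D f -> V (D + d) (pev b t * z * f).
  move=> [a aD ->]; rewrite mulr_sumr; elim/big_rec: _ => [|j y _]; first exact: V0.
  apply: V_add; rewrite mulrCA -mulrA.
  have := VM (d := D) (bz j) (leqW (aD j)); apply: V_wide.
  by rewrite addnC leq_add2l leq_maxl.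
have Vb D f : V D f -> V (D + d) (pev b t * f).
  by move=> h; apply: VM => //; rewrite /d; lia.
exists (n * d).+1 => u.
have [c c0 [D1 cu]] := denoms u.
(* With this m the number of products, n*d+1 times m+1, exceeds the dimension bound n*M. *)
pose m := (n * D1)%N; pose M := (D1 + m * d)%N.
have Vpow (i : 'I_m.+1) l : V M (pev b t ^+ m * pev c t * (z ^+ i * u l)).
  have : (i <= m)%N by rewrite -ltnS.
  rewrite /M; move: (nat_of_ord i); elim: (m) => [|r IH] s.
    by rewrite leqn0 => /eqP->; rewrite !expr0 !mul1r addn0.
  rewrite mulSn addnCA addnC leq_eqVlt => /orP[/eqP->|].
    have := Vz _ _ (IH r (leqnn r)); congr V; rewrite !exprS; ring.
  by rewrite ltnS => /IH/Vb; congr V; rewrite exprS; ring.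
pose w (il : 'I_(n * d).+1 * 'I_m.+1) : base_vect iota := z ^+ il.2 * u il.1.
pose B : F := pev b t ^+ m * pev c t.
have B0 : B != 0 by rewrite mulf_neq0 ?expf_neq0 ?pevN0.
pose g (js : 'I_n * 'I_M) : base_vect iota := t ^+ js.2 * e js.1.
have [|||x [[l i] xi]] := @span_dependent k (base_vect iota) [set 0] _ _
    (fun il => B * w il) g _ _ _.
- by split=> // a v1 v2 -> ->; rewrite scaler0 addr0.
- rewrite !card_prod !card_ord /M /m; nia.
- move=> [l i]; have [a aM ->] := Vpow i l.
  exists (fun js : 'I_n * 'I_M => (a js.1)`_js.2); apply/eqP; rewrite subr_eq0; apply/eqP.
  rewrite (eq_bigr (fun js : 'I_n * 'I_M => iota (a js.1)`_js.2 * (t ^+ js.2 * e js.1))) //.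
  rewrite -(pair_big xpredT xpredT (fun (j : 'I_n) (s : 'I_M) => iota (a j)`_s * (t ^+ s * e j))) /=.
  apply: eq_bigr => j _; rewrite (pev_coef _ (aM j)) mulr_suml.
  by apply: eq_bigr => s _; rewrite mulrA.
move=> /= xw; exists (fun l => \poly_(i < m.+1) x (l, inord i)).
  exists l; apply/eqP => /polyP/(_ i); rewrite coef_poly ltn_ord coef0 inord_val.
  exact/eqP.
apply: (mulfI B0); rewrite mulr0 -[RHS]xw.
rewrite (eq_bigr (fun il : 'I_(n * d).+1 * 'I_m.+1 => iota (x (il.1, il.2)) * (B * (z ^+ il.2 * u il.1)))); last by case.
rewrite -(pair_big xpredT xpredT (fun l (i : 'I_m.+1) => iota (x (l, i)) * (B * (z ^+ i * u l)))) /=.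
rewrite mulr_sumr; apply: eq_bigr => l' _.
rewrite (pev_coef _ (size_poly _ _)) mulr_suml mulr_sumr; apply: eq_bigr => i' _.
by rewrite coef_poly ltn_ord inord_val; ring.
Qed.

End CommonDenominator.

Lemma zdep_bound : function_field iota ->
  forall z, exists N, forall u : 'I_N -> F, zdep z u.
Proof.
by move=> [t [tr [n [e span]]]] z; exact: (zdep_span tr span).
Qed.

End FieldDegree.

(** * Existence of places *)

Section ValuationRing.
Variables (k : finFieldType) (F : fieldType) (iota : {rmorphism k -> F}).

Definition subalgebra (A : set F) := [/\ forall c : k, A (iota c),
  forall a b, A a -> A b -> A (a - b) & forall a b, A a -> A b -> A (a * b)].

Section Closure.
Variable A : set F.
Hypothesis sA : subalgebra A.

Let Ac c : A (iota c). Proof. by case: sA. Qed.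
Let AB a b : A a -> A b -> A (a - b). Proof. by case: sA => _ h _; exact: h. Qed.
Lemma subalgebraM a b : A a -> A b -> A (a * b).
Proof. by case: sA => _ _ h; exact: h. Qed.
Lemma subalgebra0 : A 0. Proof. by rewrite -(rmorph0 iota). Qed.
Lemma subalgebra1 : A 1. Proof. by rewrite -(rmorph1 iota). Qed.
Lemma subalgebraN a : A a -> A (- a).
Proof. by move=> Aa; rewrite -sub0r; apply: AB => //; exact: subalgebra0. Qed.
Lemma subalgebraD a b : A a -> A b -> A (a + b).
Proof. by move=> Aa Ab; rewrite -[b]opprK; apply: AB => //; exact: subalgebraN. Qed.
Lemma subalgebra_sum (I : Type) (r : seq I) (P : pred I) (f : I -> F) :
  (forall i, P i -> A (f i)) -> A (\sum_(i <- r | P i) f i).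
Proof.
by move=> Af; elim/big_rec: _ => [|i y Pi]; [exact: subalgebra0|exact/subalgebraD/Af].
Qed.
Lemma subalgebraX a n : A a -> A (a ^+ n).
Proof.
by move=> Aa; elim: n => [|n IH]; rewrite ?exprS; [exact: subalgebra1|exact: subalgebraM].
Qed.
Lemma subalgebra_pev p z : A z -> A (pev iota p z).
Proof.
move=> Az; rewrite (pev_coef _ _ (leqnn _)); apply: subalgebra_sum => i _.
by apply: subalgebraM => //; exact: subalgebraX.
Qed.

Definition poly_in (p : {poly F}) := forall i, A p`_i.
Lemma poly_inD p q : poly_in p -> poly_in q -> poly_in (p + q).
Proof. by move=> hp hq i; rewrite coefD; exact: subalgebraD. Qed.
Lemma poly_inN p : poly_in p -> poly_in (- p).
Proof. by move=> hp i; rewrite coefN; exact: subalgebraN. Qed.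
Lemma poly_inM p q : poly_in p -> poly_in q -> poly_in (p * q).
Proof.
by move=> hp hq i; rewrite coefM; apply: subalgebra_sum => j _; exact: subalgebraM.
Qed.
Lemma poly_inC c : A c -> poly_in c%:P.
Proof. by move=> Ac' i; rewrite coefC; case: eqP => // _; exact: subalgebra0. Qed.
Lemma poly_inX : poly_in 'X.
Proof. by move=> i; rewrite coefX; case: eqP => _; [exact: subalgebra1|exact: subalgebra0]. Qed.
Lemma poly_inXn n : poly_in 'X^n.
Proof. by move=> i; rewrite coefXn; case: eqP => _; [exact: subalgebra1|exact: subalgebra0]. Qed.

End Closure.

Section Maximal.
Variables (z : F).
Hypothesis ztr : forall p : {poly k}, pev iota p z = 0 -> p = 0.

Let good (A : set F) := [/\ subalgebra A, A z & ~ A z^-1].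

Let z0 : z != 0.
Proof.
apply/eqP => z0; have /ztr/eqP : pev iota 'X z = 0 by rewrite pevX.
by rewrite polyX_eq0.
Qed.

Let base : good [set pev iota p z | p in setT].
Proof.
split; first split.
- by move=> c; exists c%:P => //; rewrite pevC.
- by move=> _ _ [p _ <-] [q _ <-]; exists (p - q) => //; rewrite pevB.
- by move=> _ _ [p _ <-] [q _ <-]; exists (p * q) => //; rewrite pevM.
- by exists 'X => //; rewrite pevX.
- move=> [p _ pz]; have /ztr/polyP/(_ 0%N)/eqP : pev iota (p * 'X - 1) z = 0.
    by rewrite pevB pevM pevX pev1 pz mulVf // subrr.
  by rewrite coefB coefMX coef1 coef0 sub0r oppr_eq0 oner_eq0.
Qed.

(* Chevalley: a subalgebra maximal for this property is a valuation ring. *)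
Lemma exists_maximal_subalgebra : exists A, good A /\ forall B, A `<=` B -> good B -> B `<=` A.
Proof.
pose P A := A = set0 \/ good A.
have [|A [PA Amax]] := @Zorn_bigcup F P.
  move=> G GP Gtot.
  have [[X GX /eqP/set0P[a Xa]]|h] := pselect (exists2 X, G X & X <> set0); last first.
    left; apply/seteqP; split=> // a [X GX Xa]; apply: h; exists X => // X0.
    by rewrite X0 in Xa.
  have goodX Y : G Y -> Y !=set0 -> good Y.
    by move=> /GP[->|//] [].
  have gX : good X by apply: goodX => //; exists a.
  right; split; first split.
  - by move=> c; exists X => //; case: gX => -[].
  - move=> b c [Y GY Yb] [Z GZ Zc]; case: (Gtot _ _ GY GZ) => YZ.
      exists Z => //; have [[_ h _] _ _] : good Z by apply: goodX => //; exists c.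
      by apply: h => //; exact: YZ.
    exists Y => //; have [[_ h _] _ _] : good Y by apply: goodX => //; exists b.
    by apply: h => //; exact: YZ.
  - move=> b c [Y GY Yb] [Z GZ Zc]; case: (Gtot _ _ GY GZ) => YZ.
      exists Z => //; have [[_ _ h] _ _] : good Z by apply: goodX => //; exists c.
      by apply: h => //; exact: YZ.
    exists Y => //; have [[_ _ h] _ _] : good Y by apply: goodX => //; exists b.
    by apply: h => //; exact: YZ.
  - by exists X => //; case: gX.
  - move=> [Y GY Yz]; have [_ _] : good Y by apply: goodX => //; exists z^-1.
    exact.
exists A; split.
  case: PA => // A0; exfalso; apply: (Amax _ _ (or_intror base)).
  rewrite A0; split=> // h; apply: (h z); exists 'X => //; exact: pevX.
move=> B AB gB; apply: contrapT => BA; apply: (Amax B); last by right.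
by split.
Qed.

Variable A : set F.
Hypotheses (gA : good A) (Amax : forall B, A `<=` B -> good B -> B `<=` A).

Let sA : subalgebra A. Proof. by case: gA. Qed.
Let Az : A z. Proof. by case: gA. Qed.
Let Azi : ~ A z^-1. Proof. by case: gA. Qed.

(** This says that z^-1 is the value at w of a polynomial over A of degree at most n, so that z^-1
    lies in A[w]. By maximality of A this happens for every w outside A. *)
Let rel w n := exists P : {poly F}, [/\ poly_in A P, (size P <= n.+1)%N & 1 = z * P.[w]].

Let rel0 w : ~ rel w 0.
Proof.
move=> [P [PA /size1_polyC -> e]]; apply: Azi.
move/(congr1 ( *%R z^-1)): e; rewrite mulr1 mulKf // hornerC => ->; exact: PA.
Qed.

Let rel_outside w : ~ A w -> exists n, rel w n.
Proof.
move=> Aw; pose B := [set f | exists2 P, poly_in A P & f = P.[w]].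
suff [P PA e] : B z^-1.
  by exists (size P), P; split; rewrite ?leqnSn // -e mulfV.
apply: contrapT => Bz; apply: Aw.
have AB : A `<=` B by move=> f Af; exists f%:P; [exact: poly_inC|rewrite hornerC].
apply: (Amax AB); last by exists 'X; [exact: poly_inX|rewrite hornerX].
split=> //; last exact: AB; split.
- by move=> c; apply: AB; case: sA.
- move=> _ _ [P hP ->] [Q hQ ->]; exists (P - Q); last by rewrite !hornerE.
  by apply: poly_inD => //; exact: poly_inN.
- by move=> _ _ [P hP ->] [Q hQ ->]; exists (P * Q); [exact: poly_inM|rewrite hornerM].
Qed.

Let rel_step w n m : w != 0 -> (m <= n.+1)%N -> rel w n.+1 -> rel w^-1 m -> rel w n.
Proof.
move=> w0 mn [P [PA szP eP]] [Q [QA szQ eQ]].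
pose a := 1 - z * Q`_0.
have Aa : A a.
  by apply: (subalgebraD sA); [exact: subalgebra1|apply: (subalgebraN sA); apply: subalgebraM].
pose R : {poly F} := \sum_(j < m) Q`_j.+1 *: 'X^(n - j).
pose P' : {poly F} := \poly_(i < n.+1) P`_i.
have RA : poly_in A R.
  move=> i; rewrite coef_sum; apply: subalgebra_sum => // j _.
  by rewrite coefZ; apply: subalgebraM => //; exact: poly_inXn.
have P'A : poly_in A P'.
  by move=> i; rewrite coef_poly; case: ifP => // _; exact: subalgebra0.
have szR : (size R <= n.+1)%N.
  apply: leq_trans (size_sum _ _ _) _; apply/bigmax_leqP => j _; apply: leq_trans (size_scale_leq _ _) _.
  by rewrite size_polyXn; lia.
have eR : w ^+ n.+1 * a = z * R.[w].
  have e0 : w ^+ n.+1 = w ^+ n.+1 * (z * Q.[w^-1]) by rewrite -eQ mulr1.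
  rewrite /a mulrBr mulr1 {1}e0.
  rewrite (horner_coef_wide _ szQ) big_ord_recl expr0 mulr1.
  set S := \sum_(i < m) _.
  rewrite (_ : _ - _ = z * (w ^+ n.+1 * S)); last by ring.
  congr (_ * _); rewrite /S horner_sum mulr_sumr; apply: eq_bigr => j _.
  rewrite hornerZ hornerXn mulrCA; congr (_ * _).
  rewrite lift0 exprVn -[in LHS](subnK (_ : j.+1 <= n.+1)%N).
    by rewrite exprD subSS mulfK // expf_neq0.
  by apply: leq_trans mn.
have eP' : P.[w] = P`_n.+1 * w ^+ n.+1 + P'.[w].
  rewrite (horner_coef_wide _ szP) big_ord_recr addrC /=; congr (_ + _).
  rewrite (horner_coef_wide _ (size_poly _ _)); apply: eq_bigr => i _.
  by rewrite coef_poly ltn_ord.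
exists ((Q`_0)%:P + (P`_n.+1 * z)%:P * R + a%:P * P'); split.
- apply: (poly_inD sA); last by apply: poly_inM => //; exact: poly_inC.
  apply: (poly_inD sA); first exact: poly_inC.
  by apply: poly_inM => //; apply: poly_inC => //; exact: subalgebraM.
- apply: leq_trans (size_polyD _ _) _; rewrite geq_max; apply/andP; split.
    apply: leq_trans (size_polyD _ _) _; rewrite geq_max; apply/andP; split.
      by apply: leq_trans (size_polyC_leq1 _) _.
    by rewrite mul_polyC; apply: leq_trans (size_scale_leq _ _) _.
  by rewrite mul_polyC; apply: leq_trans (size_scale_leq _ _) (size_poly _ _).
- rewrite !hornerE /=.
  have e1 : a = z * P`_n.+1 * (w ^+ n.+1 * a) + a * z * P'.[w].
    by rewrite -{1}[a]mulr1 eP eP'; ring.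
  rewrite eR in e1; have -> : 1 = a + z * Q`_0 by rewrite /a subrK.
  by rewrite {1}e1; ring.
Qed.

(** Descent on n + m: the larger of the two degrees can always be lowered, and degree 0 would put
    z^-1 into A. *)
Let rel_false w n m : w != 0 -> rel w n -> rel w^-1 m -> False.
Proof.
have [s] := ubnP (n + m); elim: s w n m => // s IH w n m; rewrite ltnS => nms w0 rn rm.
have w0' : w^-1 != 0 by rewrite invr_eq0.
case: (leqP m n) => [mn|nm].
  case: n => [|n] in nms rn mn *; first exact: rel0 rn.
  by apply: (IH w n m) => //; exact: (rel_step w0 mn).
case: m => [|m] in nms rm nm * => //.
have nms' : (m + n < s)%N by move: nms; rewrite addnS addnC.
have rn' : rel w^-1^-1 n by rewrite invrK.
by apply: (IH w^-1 m n nms' w0' _ rn'); exact: (rel_step w0' (ltnW nm) rm rn').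
Qed.

Lemma maximal_valuation w : A w \/ A w^-1.
Proof.
apply: contrapT => /not_orP[/[dup] Aw /rel_outside[n rn] /[dup] Awi /rel_outside[m rm]].
by apply: (rel_false _ rn rm); apply: contra_notN Aw => /eqP->; exact: subalgebra0.
Qed.

End Maximal.

(** * Discreteness of valuation rings of F over k *)

Section Discrete.
Variable A : set F.
Hypotheses (sA : subalgebra A) (vA : forall w, A w \/ A w^-1).

Let U f := [/\ f != 0, A f & A f^-1].
(** The maximal ideal of A. The guard is there because 0^-1 = 0, which lies in A. *)
Let P f := A f /\ (f != 0 -> ~ A f^-1).

Let A0 : A 0. Proof. exact: subalgebra0. Qed.
Let A1 : A 1. Proof. exact: subalgebra1. Qed.
Let AM a b : A a -> A b -> A (a * b). Proof. exact: subalgebraM. Qed.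
Let AD a b : A a -> A b -> A (a + b). Proof. exact: subalgebraD. Qed.
Let P0 : P 0. Proof. by split=> //; rewrite eqxx. Qed.

Let PM a b : A a -> P b -> P (a * b).
Proof.
move=> Aa [Ab Pb]; split; first exact: AM.
rewrite mulf_eq0 => /norP[a0 b0] h; apply: Pb => //.
have -> : b^-1 = a * (a * b)^-1 by rewrite invfM mulrA divff // mul1r.
exact: AM.
Qed.

Let PD a b : P a -> P b -> P (a + b).
Proof.
have [->|a0] := eqVneq a 0; first by rewrite add0r.
have [->|b0] := eqVneq b 0; first by rewrite addr0.
wlog: a b a0 b0 / A (a / b).
  move=> hw Pa Pb; case: (vA (a / b)) => h; first exact: hw.
  by rewrite addrC; apply: hw => //; move: h; rewrite invf_div.
move=> ab _ Pb; have -> : a + b = (a / b + 1) * b by rewrite mulrDl mul1r divfK.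
by apply: PM => //; apply: AD.
Qed.

Let PN a : P a -> P (- a).
Proof.
by move=> Pa; rewrite -mulN1r; apply: PM => //; apply: subalgebraN.
Qed.

Let P_sum (I : finType) (p : pred I) (f : I -> F) :
  (forall i, p i -> P (f i)) -> P (\sum_(i | p i) f i).
Proof. by move=> Pf; elim/big_rec: _ => [|i y pi]; [exact: P0|apply/PD/Pf]. Qed.

Let PU f : A f -> f != 0 -> U f \/ P f.
Proof.
move=> Af f0; have [h|h] := pselect (A f^-1); first by left.
by right.
Qed.

Let PUF f : U f -> ~ P f.
Proof. by move=> [f0 _ Afi] [_ /(_ f0)]. Qed.

(* The elements of a divisor chain starting at c_0 are independent over k[c_0]:
   in a relation, divide by the last c_j whose coefficient has a nonzero constant
   term. *)
Let chain_false N (c : nat -> F) : (forall u : 'I_N -> F, zdep iota (c 0%N) u) ->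
  (forall i, (i < N)%N -> c i != 0 /\ P (c i)) ->
  (forall i, (i.+1 < N)%N -> P (c i / c i.+1)) -> False.
Proof.
move=> dN cP cc.
have N0 : (0 < N)%N by case: N dN {cP cc} => // /(_ (fun=> 0))[p [[]]].
have [z0 Pz] := cP _ N0.
have ltP i j : (i < j < N)%N -> P (c i / c j).
  move=> /andP[]; elim: j => // j IH; rewrite ltnS leq_eqVlt => /orP[/eqP->|ij] jN.
    exact: cc.
  have jN' := ltnW jN.
  have [cj _] := cP _ jN'.
  have -> : c i / c j.+1 = (c i / c j) * (c j / c j.+1).
    by rewrite mulrA divfK.
  by apply: PM; [case: (IH ij jN')|exact: cc].
have [p [i0 pi0] rel] := zdep_primitive z0 (dN (fun i => c i)).
have [j pj jmax] := @arg_maxnP _ i0 (fun i => (p i)`_0 != 0) (fun i => val i) pi0.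
have [cj0 Pcj] := cP j (ltn_ord j).
have : P (pev iota (p j) (c 0%N)).
  have -> : pev iota (p j) (c 0%N) =
      - \sum_(i < N | i != j) pev iota (p i) (c 0%N) * (c i / c j).
    move/(congr1 ( *%R^~ (c j)^-1)): rel; rewrite mul0r (bigD1 j) //= mulrDl mulfK //.
    move=> /eqP; rewrite addr_eq0 => /eqP ->; congr (- _); rewrite mulr_suml.
    by apply: eq_bigr => i _; rewrite mulrA.
  apply/PN/P_sum => i ij; case: (ltnP i j) => [lij|].
    apply: PM; first by apply: subalgebra_pev => //; case: Pz.
    by apply: ltP; rewrite lij ltn_ord.
  rewrite leq_eqVlt eq_sym [_ == _](negPf ij) /= => ji.
  have [q ->] := poly_split0 (p i).
  have -> : (p i)`_0 = 0.
    by apply/eqP; apply: contraTT ji => /jmax; rewrite -leqNgt.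
  rewrite pevD pevM pevX pevC rmorph0 add0r.
  have [_ Pci] := cP i (ltn_ord i).
  have -> : pev iota q (c 0%N) * c 0%N * (c i / c j) =
     pev iota q (c 0%N) * (c 0%N / c j) * c i by rewrite !mulrA [in RHS]mulrAC.
  apply: PM => //; apply: AM; first by apply: subalgebra_pev => //; case: Pz.
  have [->|j0] := posnP j; first by rewrite divff.
  by case: (@ltP 0%N j) => //; rewrite j0 ltn_ord.
have [q ->] := poly_split0 (p j); rewrite pevD pevC pevM pevX => h.
have : P (iota (p j)`_0).
  rewrite -[iota _](addrK (pev iota q (c 0%N) * c 0%N)); apply: PD => //; apply: PN.
  by apply: PM => //; apply: subalgebra_pev => //; case: Pz.
apply: PUF; split; first by rewrite fmorph_eq0.
  by case: sA.
by rewrite -fmorphV; case: sA.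
Qed.

Hypothesis bound : forall z, exists N, forall u : 'I_N -> F, zdep iota z u.
Variable z : F.
Hypotheses (z0 : z != 0) (Pz : P z).

(** Otherwise every nonzero element of the maximal ideal is a proper multiple of another one;
    iterating this from z yields divisor chains of any length, against [chain_false]. *)
Let uniformizer : exists pi, [/\ pi != 0, P pi & forall y, P y -> A (y / pi)].
Proof.
apply: contrapT => nopi.
have /choice[s sP] : forall f, exists g, f != 0 -> P f -> [/\ g != 0, P g & P (f / g)].
  move=> f; have [f0|] := eqVneq f 0; first by exists 0.
  have [Pf f0|] := pselect (P f); last by exists 0.
  apply: contrapT => nog; apply: nopi; exists f; split=> // y Py.
  have [->|y0] := eqVneq y 0; first by rewrite mul0r.
  apply: contrapT => yf; apply: nog; exists y => _ _; split=> //.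
  have yfi : A (f / y) by case: (vA (y / f)) => //; rewrite invf_div.
  by split=> // _; rewrite invf_div.
have [N dN] := bound z.
have cP i : iter i s z != 0 /\ P (iter i s z).
  by elim: i => //= i [h1 h2]; have [] := sP _ h1 h2.
apply: (@chain_false N (fun i => iter i s z)) => // i _ /=.
by have [h1 h2] := cP i; have [] := sP _ h1 h2.
Qed.

Let pi := projT1 (cid uniformizer).
Let pi0 : pi != 0. Proof. by rewrite /pi; case: cid => ? []. Qed.
Let Ppi : P pi. Proof. by rewrite /pi; case: cid => ? []. Qed.
Let piP y : P y -> A (y / pi).
Proof. by rewrite /pi; case: cid => p [? ? h] /=; exact: h. Qed.

Let pi_nat f : f != 0 -> A f -> exists m : nat, U (f * pi ^- m).
Proof.
move=> f0 Af; have piX m : pi ^+ m != 0 by rewrite expf_neq0.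
suff [m [h1 h2]] : exists m, A (f / pi ^+ m) /\ ~ A (f / pi ^+ m.+1).
  exists m; have [//|/piP] := PU h1 (mulf_neq0 f0 (invr_neq0 (piX m))).
  by rewrite -mulrA -invfM -exprSr.
apply: contrapT => h; have Am m : A (f / pi ^+ m).
  elim: m => [|m IH]; first by rewrite expr0 divr1.
  by apply: contrapT => h'; apply: h; exists m.
have Pfm m : P (f / pi ^+ m).
  have -> : f / pi ^+ m = (f / pi ^+ m.+1) * pi by rewrite exprSr invfM -!mulrA mulVf ?mulr1.
  exact: PM.
have [N dN] := bound f.
(* If all powers of pi divide f, then f, pi^N, ..., pi^2 is a divisor chain of length N starting at
   f. *)
pose c i := if i == 0%N then f else pi ^+ (N.+1 - i).
have PX m : P (pi ^+ m.+1) by rewrite exprSr; apply: PM => //; apply: subalgebraX => //; case: Ppi.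
apply: (@chain_false N c) => //.
  move=> [|i] iN; rewrite /c /=; first by split=> //; have := Pfm 0%N; rewrite divr1.
  by split=> //; rewrite subSn //; lia.
move=> [|i] iN; rewrite /c /=; first exact: Pfm.
have -> : (N.+1 - i.+1 = (N.+1 - i.+2).+1)%N by lia.
by rewrite exprS mulfK.
Qed.

Let pi_int f : f != 0 -> exists m : int, U (f * pi ^ (- m)).
Proof.
move=> f0; case: (vA f) => Af.
  by have [m] := pi_nat f0 Af; exists m%:Z; rewrite -exprnN.
have [m [h1 h2 h3]] := pi_nat (invr_neq0 f0) Af; exists (- m%:Z).
rewrite opprK; have -> : f * pi ^ m%:Z = (f^-1 * pi ^- m)^-1 by rewrite invfM !invrK -exprnP.
by split; rewrite ?invr_eq0 ?invrK.
Qed.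

Let UM a b : U a -> U b -> U (a * b).
Proof.
by move=> [a0 a1 a2] [b0 b1 b2]; split; [rewrite mulf_neq0|exact: AM|rewrite invfM; exact: AM].
Qed.
Let UV a : U a -> U a^-1.
Proof. by move=> [a0 a1 a2]; split; rewrite ?invr_eq0 ?invrK. Qed.

Let pi_pos m : 0 < m -> P (pi ^ m).
Proof.
case: m => // -[|m] // _; rewrite -exprnP exprSr; apply: PM => //.
by apply: subalgebraX => //; case: Ppi.
Qed.

Let U_pi m : U (pi ^ m) -> m = 0.
Proof.
case: (ltrgt0P m) => // m0 Um; exfalso; first exact: (PUF Um (pi_pos m0)).
by apply: (PUF (UV Um)); rewrite invr_expz; apply: pi_pos; lia.
Qed.

Let ordf f : int := if f == 0 then 0 else xget 0 [set m | U (f * pi ^ (- m))].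

Let ordf_spec f : f != 0 -> U (f * pi ^ (- ordf f)).
Proof.
by move=> f0; rewrite /ordf (negPf f0); apply: (xgetPex 0 (pi_int f0)).
Qed.

Let ordf_eq f m : f != 0 -> U (f * pi ^ (- m)) -> ordf f = m.
Proof.
move=> f0 Um; have := UM (ordf_spec f0) (UV Um).
rewrite invfM mulrACA divff // mul1r invr_expz -expfzDr // => /U_pi.
by lia.
Qed.

Let ordf_ge f m : f != 0 -> m <= ordf f <-> A (f * pi ^ (- m)).
Proof.
move=> f0; have [h1 h2 h3] := ordf_spec f0.
have e : f * pi ^ (- m) = f * pi ^ (- ordf f) * pi ^ (ordf f - m).
  by rewrite -mulrA -expfzDr //; congr (_ * pi ^ _); lia.
split=> [|Am].
  rewrite le_eqVlt => /orP[/eqP->//|lt]; rewrite e; apply: AM => //.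
  by case: (@pi_pos (ordf f - m)) => //; lia.
rewrite leNgt; apply/negP => lt.
have : A (pi ^ (ordf f - m)).
  rewrite -[pi ^ _](mulKf h1) -e; exact: AM.
case: (@pi_pos (m - ordf f)); first by lia.
move=> _ /(_ (expfz_neq0 _ pi0)); rewrite invr_expz opprB; exact.
Qed.

Lemma discrete_valuation_ring : exists y : place iota, 0 < y z.
Proof.
have ordf0 : ordf 0 = 0 by rewrite /ordf eqxx.
have ordfM f g : f != 0 -> g != 0 -> ordf (f * g) = ordf f + ordf g.
  move=> f0 g0; apply: ordf_eq; first by rewrite mulf_neq0.
  rewrite opprD expfzDr // mulrACA; exact: UM (ordf_spec f0) (ordf_spec g0).
have ordfD f g : f != 0 -> g != 0 -> f + g != 0 -> Num.min (ordf f) (ordf g) <= ordf (f + g).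
  move=> f0 g0 fg0; apply/ordf_ge => //; rewrite mulrDl.
  by apply: AD; [apply: (proj1 (ordf_ge _ f0))|apply: (proj1 (ordf_ge _ g0))];
    rewrite ge_min lexx ?orbT.
have ordf_const c : c != 0 -> ordf (iota c) = 0.
  move=> c0; apply: ordf_eq; first by rewrite fmorph_eq0.
  rewrite oppr0 expr0z mulr1; split; first by rewrite fmorph_eq0.
    by case: sA.
  by rewrite -fmorphV; case: sA.
have ordf_unif : exists2 t : F, t != 0 & ordf t = 1.
  exists pi => //; apply: ordf_eq => //; rewrite exprN1 divff //.
  by split; rewrite ?oner_eq0 ?invr1.
exists (Place ordf0 ordfM ordfD ordf_const ordf_unif) => /=.
have : 1 <= ordf z by apply/(ordf_ge 1 z0); exact: piP.
by rewrite -gtz0_ge1.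
Qed.

End Discrete.

Lemma exists_zero : function_field iota ->
  forall z, (forall p : {poly k}, pev iota p z = 0 -> p = 0) ->
  exists y : place iota, 0 < y z.
Proof.
move=> hF z ztr; have [A [gA Amax]] := exists_maximal_subalgebra ztr.
have vA := maximal_valuation ztr gA Amax; have [sA Az Azi] := gA.
apply: (discrete_valuation_ring sA vA (zdep_bound hF)); last by split.
apply/eqP => z0; have /ztr/eqP : pev iota 'X z = 0 by rewrite pevX.
by rewrite polyX_eq0.
Qed.

End ValuationRing.

(** * Valuations and weak approximation *)

Section Places.
Variables (k : finFieldType) (F : fieldType) (iota : {rmorphism k -> F}).
Implicit Types (x y : place iota) (f g : F).

Lemma place_eq x y : (forall f, x f = y f) -> x = y.
Proof.
case: x => a a0 a1 a2 a3 a4; case: y => b b0 b1 b2 b3 b4 /= /funext ab.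
move: a0 a1 a2 a3 a4; rewrite ab => a0 a1 a2 a3 a4.
by congr Place; exact: Prop_irrelevance.
Qed.

Lemma ord_geE y n f : f != 0 -> (f \in ord_ge y n) = (n <= y f).
Proof. by rewrite inE => /negPf->. Qed.

Lemma ord_geN y n f : f \in ord_ge y n -> - f \in ord_ge y n.
Proof. by move=> h; rewrite -sub0r; apply: ord_geB => //; exact: ord_ge0. Qed.

Lemma ord_geNE y n f : (- f \in ord_ge y n) = (f \in ord_ge y n).
Proof. by apply/idP/idP => /ord_geN; rewrite ?opprK. Qed.

Lemma ord_geD y n f g : f \in ord_ge y n -> g \in ord_ge y n -> f + g \in ord_ge y n.
Proof. by move=> hf hg; rewrite -[g]opprK; apply: ord_geB => //; exact: ord_geN. Qed.

Lemma ord_ge_sum y n (I : Type) (r : seq I) (P : pred I) (f : I -> F) :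
  (forall i, P i -> f i \in ord_ge y n) -> \sum_(i <- r | P i) f i \in ord_ge y n.
Proof.
by move=> h; elim/big_rec: _ => [|i z Pi]; [exact: ord_ge0|exact/ord_geD/h].
Qed.

Lemma ord_ge_le y m n f : m <= n -> f \in ord_ge y n -> f \in ord_ge y m.
Proof. by move=> mn; rewrite !inE => /orP[->//|/(le_trans mn)->]; rewrite orbT. Qed.

Lemma ord_ge_self y f : f \in ord_ge y (y f).
Proof. by rewrite inE lexx orbT. Qed.

Lemma ord_ge_const y (c : k) : iota c \in ord_ge y 0.
Proof.
by have [->|c0] := eqVneq c 0; rewrite ?rmorph0 ?ord_ge0 // inE ord_const ?lexx ?orbT.
Qed.

Lemma ord_geM0 y n f g : f \in ord_ge y 0 -> g \in ord_ge y n -> f * g \in ord_ge y n.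
Proof. by move=> hf hg; rewrite -[n]add0r; exact: ord_geM. Qed.

Lemma ordV y f : y f^-1 = - y f.
Proof.
have [->|f0] := eqVneq f 0; first by rewrite invr0 ord0.
apply/eqP; rewrite -addr_eq0 addrC -ordM ?invr_eq0 // divff //.
by rewrite ord1.
Qed.

Lemma ordX y f n : f != 0 -> y (f ^+ n) = y f *+ n.
Proof.
move=> f0; elim: n => [|n IH]; first by rewrite expr0 ord1.
by rewrite exprS ordM ?expf_neq0 // IH mulrS.
Qed.

Lemma ordXz y f (n : int) : f != 0 -> y (f ^ n) = n * y f.
Proof.
move=> f0; case: n => n; first by rewrite -exprnP ordX // -mulr_natl natz.
by rewrite NegzE -exprnN ordV ordX // -mulr_natl natz mulNr.
Qed.

Lemma ordD_lt y f g : f != 0 -> g \in ord_ge y (y f + 1) ->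
  f + g != 0 /\ y (f + g) = y f.
Proof.
move=> f0; have [->|g0] := eqVneq g 0; first by rewrite addr0.
rewrite ord_geE // => fg.
have s0 : f + g != 0.
  apply: contraTneq fg => /eqP; rewrite addr_eq0 => /eqP->.
  by rewrite ordN; lia.
split=> //; have h1 := ordD y f0 g0 s0.
have h2 : Num.min (y (f + g)) (y g) <= y f.
  by have := @ordD _ _ _ y (f + g) (- g) s0; rewrite addrK ordN oppr_eq0; exact.
by move: fg h1 h2; rewrite !minEle; move: (y f) (y g) (y (f+g)) => a b c; do 2 case: ifP; lia.
Qed.

Lemma ord_unit1 y f : f \in ord_ge y 1 -> 1 + f != 0 /\ y (1 + f) = 0.
Proof.
by move=> h; have := @ordD_lt y 1 f (oner_neq0 _); rewrite ord1 add0r; exact.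
Qed.

Definition unif y : F := projT1 (cid2 (ord_uniformizer y)).
Lemma unif_neq0 y : unif y != 0. Proof. by rewrite /unif; case: cid2. Qed.
Lemma ord_unif y : y (unif y) = 1. Proof. by rewrite /unif; case: cid2. Qed.
Hint Resolve unif_neq0 : core.

Lemma ord_unifX y n : y (unif y ^ n) = n.
Proof. by rewrite ordXz // ord_unif mulr1. Qed.

Lemma ord_ge_unif y n f : (f \in ord_ge y n) = (f * unif y ^ (- n) \in ord_ge y 0).
Proof.
have [->|f0] := eqVneq f 0; first by rewrite mul0r !ord_ge0.
rewrite !ord_geE ?mulf_neq0 ?expfz_neq0 // ordM ?expfz_neq0 // ord_unifX.
by lia.
Qed.

(** Units for x are units for y, so y is a multiple of x. The factor y(unif x) is nonnegative and
    divides 1, by normalization of y. *)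
Lemma place_sub_eq x y : (forall f, 0 <= x f -> 0 <= y f) -> x = y.
Proof.
move=> xy; have y0 f : x f = 0 -> y f = 0.
  move=> xf; have := xy f; have := xy f^-1; rewrite !ordV xf.
  by move=> /(_ isT) + /(_ isT); lia.
have yE f : f != 0 -> y f = x f * y (unif x).
  move=> f0; have := y0 (f * unif x ^ (- x f)).
  rewrite !ordM ?expfz_neq0 // ord_unifX addrN ordXz // => /(_ erefl); lia.
have [t t0 yt] := ord_uniformizer y.
have u1 : y (unif x) = 1.
  have := yE t t0; rewrite yt; have := xy (unif x); rewrite ord_unif => /(_ isT).
  move: (y (unif x)) (x t) => a b a0 /(congr1 absz)/esym/eqP.
  by rewrite abszM muln_eq1 => /andP[_ /eqP]; lia.
apply: place_eq => f; have [->|f0] := eqVneq f 0; first by rewrite !ord0.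
by rewrite yE // u1 mulr1.
Qed.

Lemma place_separate x y : x != y -> exists f, [/\ f != 0, 0 < x f & y f < 0].
Proof.
have half (a b : place iota) : a != b -> exists f, [/\ f != 0, 0 <= a f & b f < 0].
  move=> ab; apply: contrapT => h; move/eqP: ab; apply; apply: place_sub_eq => f af.
  have [->|f0] := eqVneq f 0; first by rewrite ord0.
  by rewrite leNgt; apply/negP => bf; apply: h; exists f.
move=> xy; have [f [f0 xf yf]] := half _ _ xy.
have [g [g0 yg xg]] : exists f, [/\ f != 0, 0 <= y f & x f < 0].
  by apply: half; rewrite eq_sym.
exists (f / g); rewrite mulf_neq0 ?invr_eq0 // !ordM ?invr_eq0 // !ordV; split=> //; lia.
Qed.

Lemma place_separate_seq x (ys : seq (place iota)) : x \notin ys ->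
  exists f, [/\ f != 0, 0 < x f & forall y, y \in ys -> y f < 0].
Proof.
elim: ys => [_|y ys IH].
  by exists (unif x); rewrite ord_unif; split.
rewrite inE negb_or => /andP[xy /IH[f [f0 xf ysf]]].
have [g [g0 xg yg]] := place_separate xy.
(* The exponent exceeds every |w f|, so g^r dominates f wherever g has a pole, in particular at y.
   At the other places of ys the pole of f dominates. *)
pose r := (\max_(w <- y :: ys) `|w f|%N).+1.
have rP (w : place iota) : w \in y :: ys -> - r%:Z < w f.
  by move=> wys; have := @leq_bigmax_seq _ (y :: ys) xpredT (fun w : place iota => `|w f|%N) w wys isT;
    rewrite /r /=; move: (w f) (bigop.body _ _ _) => a b; lia.
have gr0 : g ^+ r != 0 by rewrite expf_neq0.
have ordgr (w : place iota) : w (g ^+ r) = r%:Z * w g by rewrite ordX // -mulr_natl natz.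
have neg (w : place iota) : w \in y :: ys -> w g < 0 -> f + g ^+ r != 0 /\ w (f + g ^+ r) < 0.
  move=> wys wg; have wr := rP _ wys; rewrite addrC.
  have [|h1 ->] := @ordD_lt w (g ^+ r) f gr0.
    by rewrite ord_geE // ordgr; nia.
  by split=> //; rewrite ordgr; nia.
have [s0 ys0] := neg y (mem_head _ _) yg.
exists (f + g ^+ r); split=> //.
  have := ordD x f0 gr0 s0; rewrite ordgr minEle; case: ifP => // _; first exact: lt_le_trans.
  by apply: lt_le_trans; rewrite mulr_gt0.
move=> w; rewrite inE => /orP[/eqP->//|wys].
have [wg|wg] := ltP (w g) 0; first by case: (neg w) => //; rewrite inE wys orbT.
have [|_ ->] := @ordD_lt w f (g ^+ r) f0; last exact: ysf.
by rewrite ord_geE // ordgr; have := ysf _ wys; nia.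
Qed.

(** For f with a zero at x and poles at all of ys, the function 1/(1 + f^(n+1)) is close to 1 at x
    and close to 0 on ys. *)
Lemma approx_idempotent x (ys : seq (place iota)) (n : nat) : x \notin ys ->
  exists h, h - 1 \in ord_ge x n /\ forall y, y \in ys -> h \in ord_ge y n.
Proof.
case: n => [|n] xys.
  by exists 1; split=> [|y _]; rewrite ?subrr ?ord_ge0 ?ord_ge1.
have [f [f0 xf ysf]] := place_separate_seq xys.
pose g := f ^+ n.+1; have g0 : g != 0 by rewrite expf_neq0.
have ordg (w : place iota) : w g = n.+1%:Z * w f by rewrite ordX // -mulr_natl natz.
have [|s0 xs] := @ord_unit1 x g.
  by rewrite ord_geE // ordg; nia.
exists (1 + g)^-1; split.
  have -> : (1 + g)^-1 - 1 = - (g * (1 + g)^-1).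
    by apply: (mulIf s0); rewrite mulrBl mulVf // mulNr mulfVK // mul1r opprD addrA subrr sub0r.
  rewrite ord_geNE ord_geE ?mulf_neq0 ?invr_eq0 // ordM ?invr_eq0 // ordV xs subr0 ordg; nia.
move=> y /ysf yf; rewrite ord_geE ?invr_eq0 // ordV addrC.
have [|_ ->] := @ordD_lt y g 1 g0; last by rewrite ordg; nia.
by rewrite ord_geE ?oner_neq0 // ord1 ordg; nia.
Qed.

Lemma weak_approximation (ys : seq (place iota)) (u : place iota -> F) (n : int) :
  uniq ys -> exists f, forall y, y \in ys -> f - u y \in ord_ge y n.
Proof.
move=> uys.
(* The precision M makes up for the poles of all the u w at all places of the list. *)
pose M := (`|n| + \max_(y <- ys) \max_(w <- ys) `|y (u w)|)%N.
have MP (y w : place iota) : y \in ys -> w \in ys -> n <= y (u w) + M%:Z.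
  move=> yys wys.
  have h1 := @leq_bigmax_seq _ ys xpredT (fun y : place iota => \max_(w <- ys) `|y (u w)|)%N y yys isT.
  have h2 := @leq_bigmax_seq _ ys xpredT (fun w : place iota => `|y (u w)|)%N w wys isT.
  move: h1 h2; rewrite /M /=.
  move: (y (u w)) (bigop.body _ _ (fun w => BigBody w _ _ _)) (bigop.body _ _ _) => a b c; lia.
have /choice[h hP] : forall y : place iota, exists h, y \in ys -> h - 1 \in ord_ge y M /\
    forall w, w \in rem y ys -> h \in ord_ge w M.
  move=> y; have [yys|] := boolP (y \in ys); last by exists 0.
  have [|h h2] := @approx_idempotent y (rem y ys) M; last by exists h.
  by rewrite mem_rem_uniq // inE eqxx.
exists (\sum_(w <- ys) u w * h w) => y yys.
rewrite (perm_big _ (perm_to_rem yys)) big_cons /=.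
have -> : u y * h y + \sum_(w <- rem y ys) u w * h w - u y =
  u y * (h y - 1) + \sum_(w <- rem y ys) u w * h w by ring.
have [hy _] := hP _ yys.
apply: ord_geD.
  apply: (ord_ge_le (MP _ _ yys yys)); apply: ord_geM => //; exact: ord_ge_self.
rewrite big_seq; apply: ord_ge_sum => w wy.
have wys := mem_rem wy; have [_ hw] := hP _ wys.
apply: (ord_ge_le (MP y w yys wys)); apply: ord_geM; first exact: ord_ge_self.
apply: hw; move: wy; rewrite !mem_rem_uniq // !inE => /andP[wy _].
by rewrite eq_sym wy.
Qed.

Definition integral_at y (n : int) : set (base_vect iota) := [set f | f \in ord_ge y n].

Lemma integral_subspace y n : subspace (integral_at y n).
Proof.
split=> [|c u v]; first exact: ord_ge0.
move=> hu hv; apply: ord_geD => //; apply: ord_geM0 => //; exact: ord_ge_const.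
Qed.
Hint Resolve integral_subspace : core.

Definition residue_reg y : Type := reg [set y].
HB.instance Definition _ y := GRing.Zmodule.on (residue_reg y).
Definition residue_reg_scale y (c : k) (f : residue_reg y) : residue_reg y :=
  reg_const [set y] c * f.
Lemma reg_constD (S : set (place iota)) a b : reg_const S (a + b) = reg_const S a + reg_const S b.
Proof. by apply: val_inj; rewrite /= rmorphD. Qed.
Lemma reg_constM (S : set (place iota)) a b : reg_const S (a * b) = reg_const S a * reg_const S b.
Proof. by apply: val_inj; rewrite /= rmorphM. Qed.
Lemma reg_const1 (S : set (place iota)) : reg_const S 1 = 1.
Proof. by apply: val_inj; rewrite /= rmorph1. Qed.
Fact residue_reg_scaleA y a b (f : residue_reg y) :
  residue_reg_scale a (residue_reg_scale b f) = residue_reg_scale (a * b) f.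
Proof. by rewrite /residue_reg_scale reg_constM mulrA. Qed.
Fact residue_reg_scale1 y : left_id 1 (@residue_reg_scale y).
Proof. by move=> f; rewrite /residue_reg_scale reg_const1 mul1r. Qed.
Fact residue_reg_scaleDr y : right_distributive (@residue_reg_scale y) +%R.
Proof. by move=> a f g; rewrite /residue_reg_scale mulrDr. Qed.
Fact residue_reg_scaleDl y (f : residue_reg y) : {morph (@residue_reg_scale y)^~ f : a b / a + b}.
Proof. by move=> a b; rewrite /residue_reg_scale reg_constD mulrDl. Qed.
HB.instance Definition _ y := GRing.Zmodule_isLmodule.Build k (residue_reg y)
  (@residue_reg_scaleA y) (@residue_reg_scale1 y) (@residue_reg_scaleDr y)
  (@residue_reg_scaleDl y).

Definition residue_vect y : Type := residue_field y.
HB.instance Definition _ y := GRing.Zmodule.on (residue_vect y).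
Definition residue_scale y (c : k) (u : residue_vect y) : residue_vect y :=
  \pi_(residue_field y)%qT (reg_const [set y] c) * u.
Fact residue_scaleA y a b (f : residue_vect y) :
  residue_scale a (residue_scale b f) = residue_scale (a * b) f.
Proof. by rewrite /residue_scale reg_constM rmorphM mulrA. Qed.
Fact residue_scale1 y : left_id 1 (@residue_scale y).
Proof. by move=> f; rewrite /residue_scale reg_const1 rmorph1 mul1r. Qed.
Fact residue_scaleDr y : right_distributive (@residue_scale y) +%R.
Proof. by move=> a f g; rewrite /residue_scale mulrDr. Qed.
Fact residue_scaleDl y (f : residue_vect y) : {morph (@residue_scale y)^~ f : a b / a + b}.
Proof. by move=> a b; rewrite /residue_scale reg_constD rmorphD mulrDl. Qed.
HB.instance Definition _ y := GRing.Zmodule_isLmodule.Build k (residue_vect y)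
  (@residue_scaleA y) (@residue_scale1 y) (@residue_scaleDr y)
  (@residue_scaleDl y).

Definition to_field y (f : residue_reg y) : base_vect iota := val f.
Fact to_field_linear y : linear (@to_field y). Proof. by []. Qed.
HB.instance Definition _ y := GRing.isLinear.Build k (residue_reg y) (base_vect iota)
  _ (@to_field y) (@to_field_linear y).

Definition to_residue y (f : residue_reg y) : residue_vect y := \pi_(residue_field y)%qT f.
Fact to_residue_linear y : linear (@to_residue y).
Proof. by move=> c u v; rewrite /to_residue rmorphD rmorphM. Qed.
HB.instance Definition _ y := GRing.isLinear.Build k (residue_reg y) (residue_vect y)
  _ (@to_residue y) (@to_residue_linear y).

Lemma residue_eq0 y (f : reg [set y]) :
  (\pi_(residue_field y)%qT f == 0) = (val f \in ord_ge y 1).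
Proof. by rewrite -(rmorph0 (\pi_(residue_field y)%qT)) eqquotE /= /Quotient.equiv subr0. Qed.

(** The local ring maps into F and onto the residue field, and its quotient by the maximal ideal
    computes both dimensions. This ties [deg_place] to orders of elements of F. *)
Lemma residue_reldim y n :
  reldim (integral_at y 0) (integral_at y 1) n <->
  reldim [set: residue_vect y] [set 0] n.
Proof.
pose W := [set f : residue_reg y | val f \in ord_ge y 1].
have sT : subspace [set: residue_reg y] by [].
have sT' : subspace [set: residue_vect y] by [].
have s0 : subspace [set 0 : residue_vect y].
  by split=> // a u v -> ->; rewrite scaler0 addr0.
have sW : subspace W.
  split=> [|a u v hu hv]; first exact: ord_ge0.
  by apply: ord_geD => //; apply: ord_geM0 => //; exact: ord_ge_const.
have h1 : reldim [set: residue_reg y] W n <-> reldim (integral_at y 0) (integral_at y 1) n.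
  apply: (@reldim_map _ _ _ (@to_field y)) => //.
    by move=> v _; have /asboolP := valP (v : reg _); exact.
  move=> f hf; have fr : f \in regular [set y] by apply/asboolP => z ->.
  by exists (Reg fr) => //; rewrite /integral_at /= subrr; exact: ord_ge0.
have h2 : reldim [set: residue_reg y] W n <-> reldim [set: residue_vect y] [set 0] n.
  apply: (@reldim_map _ _ _ (@to_residue y)) => //.
    by move=> v _; rewrite /W /=; split; rewrite -residue_eq0 => /eqP.
  move=> u _; exists (repr (u : residue_field y)) => //=.
  by rewrite /to_residue reprK subrr.
by rewrite -h1 h2.
Qed.

End Places.
#[export] Hint Resolve unif_neq0 integral_subspace : core.

(** * Residue degrees and divisors *)

Section Degrees.
Variables (k : finFieldType) (F : fieldType) (iota : {rmorphism k -> F}).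
Hypothesis hF : function_field iota.
Implicit Types (x y : place iota) (f g : F) (A B E : divisor iota).

Definition mul_by (c : F) (f : base_vect iota) : base_vect iota := c * (f : F).
Fact mul_by_linear c : linear (mul_by c).
Proof. by move=> a u v; rewrite /mul_by mulrDr !base_vectZ mulrCA. Qed.
HB.instance Definition _ c := GRing.isLinear.Build k (base_vect iota) (base_vect iota)
  _ (mul_by c) (mul_by_linear c).

(** As each z * u_i already has order at least n, a relation over k[z] reduces, modulo order n, to
    its constant terms. *)
Lemma primitive_const_term y (z : F) (I : finType) (u : I -> F) (n : int) (p : I -> {poly k}) :
  0 <= y z -> (forall i, z * u i \in ord_ge y n) ->
  \sum_i pev iota (p i) z * u i = 0 -> \sum_i iota (p i)`_0 * u i \in ord_ge y n.
Proof.
move=> yz zu rel; have /choice[q qE] := fun i => poly_split0 (p i).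
have -> : \sum_i iota (p i)`_0 * u i = - \sum_i pev iota (q i) z * (z * u i).
  apply/eqP; rewrite -addr_eq0 -[X in _ == X]rel -big_split /=; apply/eqP.
  by apply: eq_bigr => i _; rewrite [in RHS]qE pevD pevC pevM pevX; ring.
apply/ord_geN/ord_ge_sum => i _; apply: ord_geM0 => //.
rewrite (pev_coef _ _ (leqnn _)); apply: ord_ge_sum => j _.
apply: ord_geM0; first exact: ord_ge_const.
have [->|z0] := eqVneq z 0; first by rewrite expr0n; case: (_ == _); [exact: ord_ge1|exact: ord_ge0].
by rewrite ord_geE ?expf_neq0 // ordX // mulrn_wge0.
Qed.

(** Elements independent in the residue field are independent over k[unif y], and such families have
    bounded size. *)
Lemma residue_finite y : exists d, reldim (integral_at y 0) (integral_at y 1) d.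
Proof.
have [N dN] := zdep_bound hF (unif y).
have [|||d _ h] := @reldim_exists k _ (integral_at y 0) (integral_at y 1) N; last by exists d.
- exact: integral_subspace.
- exact: integral_subspace.
move=> f fO ff.
have [p [i pi] rel] := zdep_primitive (unif_neq0 y) (zdep_ord_max f (leqnSn N) dN).
move/eqP: pi; apply; apply: (ff (fun i => (p i)`_0)).
apply: (primitive_const_term (z := unif y)) rel => [|j]; first by rewrite ord_unif.
rewrite -[1]addr0; apply: ord_geM; last exact: fO.
by rewrite ord_geE ?unif_neq0 // ord_unif.
Qed.

Lemma deg_place_residue y : reldim [set: residue_vect y] [set 0] (deg_place y).
Proof.
by have [d /residue_reldim h] := residue_finite y; apply: (xgetPex 0%N); exists d.
Qed.

Lemma deg_placeP y : reldim (integral_at y 0) (integral_at y 1) (deg_place y).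
Proof. by apply/residue_reldim; exact: deg_place_residue. Qed.

Lemma deg_place_gt0 y : (0 < deg_place y)%N.
Proof.
rewrite lt0n; apply/negP => /eqP d0.
have h : integral_at y 0 `<=` integral_at y 1.
  apply: (proj1 (reldim0P _ _)); last by rewrite -d0; exact: deg_placeP.
  exact: integral_subspace.
have := h 1 (ord_ge1 y); rewrite /integral_at /= ord_geE ?oner_neq0 // ord1.
by [].
Qed.

Lemma integral_reldim_shift y (n m : int) (d : nat) :
  reldim (integral_at y 0) (integral_at y m) d ->
  reldim (integral_at y n) (integral_at y (n + m)) d.
Proof.
have memE l f : (unif y ^ n * f \in ord_ge y (n + l)) = (f \in ord_ge y l).
  rewrite (ord_ge_unif y (n + l)) (ord_ge_unif y l) opprD expfzDr ?unif_neq0 // mulrACA.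
  by rewrite -expfzDr ?unif_neq0 // addrN expr0z mul1r.
move=> h; apply/(@reldim_map _ _ _ (mul_by (unif y ^ n)) (integral_at y 0) (integral_at y m)).
- exact: integral_subspace.
- exact: integral_subspace.
- exact: integral_subspace.
- exact: integral_subspace.
- by move=> v; rewrite /integral_at /= /mul_by -{2}[n]addr0 memE.
- by move=> v _; rewrite /integral_at /= /mul_by memE.
- move=> v; rewrite /integral_at /= => hv; exists (unif y ^ (- n) * v).
    by rewrite -memE addr0 mulrA -expfzDr ?unif_neq0 // addrN expr0z mul1r.
  by rewrite /mul_by mulrA -expfzDr ?unif_neq0 // addrN expr0z mul1r subrr; exact: ord_ge0.
- exact: h.
Qed.

Lemma integral_sub y (m n : int) : m <= n -> integral_at y n `<=` integral_at y m.
Proof. by move=> mn f; exact: ord_ge_le. Qed.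

Lemma integral_reldim y (n : int) (m : nat) :
  reldim (integral_at y n) (integral_at y (n + m%:Z)) (m * deg_place y).
Proof.
elim: m n => [|m IH] n; first by rewrite addr0 mul0n; apply/reldim0P.
rewrite mulSn; apply: (@reldim_add _ _ (integral_at y (n + 1))).
- exact: integral_subspace.
- exact: integral_subspace.
- exact: integral_subspace.
- by apply: integral_sub; lia.
- by apply: integral_sub; lia.
- exact/integral_reldim_shift/deg_placeP.
- by rewrite (_ : n + m.+1%:Z = n + 1 + m%:Z); last by lia.
Qed.

Definition integral_on (ys : seq (place iota)) (e : place iota -> int) : set (base_vect iota) :=
  [set f | forall y, y \in ys -> f \in ord_ge y (e y)].

Lemma integral_on_subspace ys e : subspace (integral_on ys e).
Proof.
split=> [y _|c u v hu hv y yys]; first exact: ord_ge0.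
by case: (integral_subspace y (e y)) => _; apply; [exact: hu|exact: hv].
Qed.

(** The Chinese remainder theorem, one place at a time. The intermediate space M imposes the
    condition at x only; weak approximation identifies the two successive quotients with a local
    quotient at x and a quotient on ys. *)
Lemma integral_on_reldim (ys : seq (place iota)) (e : place iota -> nat) : uniq ys ->
  reldim (integral_on ys (fun=> 0)) (integral_on ys (fun y => (e y)%:Z))
    (\sum_(y <- ys) e y * deg_place y).
Proof.
have sub := integral_on_subspace.
elim: ys => [_|x ys IH /= /andP[xys uys]]; first by rewrite big_nil; apply/reldim0P.
have uxys : uniq (x :: ys) by rewrite /= xys.
rewrite big_cons; pose M : set (base_vect iota) := [set f | f \in ord_ge x (e x) /\
  forall y, y \in ys -> f \in ord_ge y 0].
have sM : subspace M.
  split=> [|c u v [ux uy] [vx vy]]; first by split=> [|y _]; exact: ord_ge0.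
  split; first by case: (integral_subspace x (e x)) => _; exact.
  by move=> y yys; case: (integral_subspace y 0) => _; apply; [exact: uy|exact: vy].
have lift0 (v : F) (n : int) : exists f, forall y, y \in x :: ys ->
    f - (if y == x then v else 0) \in ord_ge y n.
  exact: (weak_approximation (fun y => if y == x then v else 0) n uxys).
have neqx y : y \in ys -> (y == x) = false.
  by move=> yys; apply: contraNF xys => /eqP<-.
apply: (@reldim_add _ _ M) => //.
- move=> f [fx fy] y; rewrite inE => /orP[/eqP->|]; last exact: fy.
  by apply: (integral_sub _ fx).
- move=> f fy; split=> [|y yys]; first exact/fy/mem_head.
  by apply: (@integral_sub y 0 (e y)) => //; apply: fy; rewrite inE yys orbT.
- apply/(@reldim_map _ _ _ idfun _ _ (integral_at x 0) (integral_at x (e x))) => //.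
  + by move=> v hv; exact/hv/mem_head.
  + move=> v hv; split=> [[]//|vx]; split=> // y yys.
    by apply: hv; rewrite inE yys orbT.
  + move=> v hv; have [f fP] := lift0 v (e x); exists f.
      move=> y yys; have := fP _ yys; have := yys.
      rewrite inE => /orP[/eqP->|/neqx->].
        rewrite eqxx => h; rewrite -[f](subrK v); apply: ord_geD => //.
        exact: ord_ge_le h.
      by rewrite subr0; apply: ord_ge_le.
    by have := fP _ (mem_head _ _); rewrite eqxx => /ord_geN; rewrite opprB.
  + by have := @integral_reldim x 0 (e x); rewrite add0r.
- apply/(@reldim_map _ _ _ idfun _ _ (integral_on ys (fun=> 0))
      (integral_on ys (fun y => (e y)%:Z))) => //.
  + by move=> v [].
  + move=> v [vx vy]; split=> h y yys; first by apply: h; rewrite inE yys orbT.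
    by move: yys; rewrite inE => /orP[/eqP->//|]; exact: h.
  + move=> v hv.
    have [f fP] := @weak_approximation _ _ _ (x :: ys) (fun y => if y == x then 0 else v)
       (\sum_(y <- x :: ys) (e y))%N uxys.
    have le_e y : y \in x :: ys -> (e y <= \sum_(y <- x :: ys) (e y))%N.
      by move=> yys; rewrite (perm_big _ (perm_to_rem yys)) big_cons leq_addr.
    have fx : f \in ord_ge x (e x).
      have := fP _ (mem_head _ _); rewrite eqxx subr0; apply: ord_ge_le.
      by rewrite lez_nat le_e ?mem_head.
    have fy y : y \in ys -> f - v \in ord_ge y (e y).
      move=> yys; have yxys : y \in x :: ys by rewrite inE yys orbT.
      by have := fP _ yxys; rewrite neqx //; apply: ord_ge_le; rewrite lez_nat le_e.
    exists f; last by move=> y yys; rewrite -ord_geNE opprB fy.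
    split=> // y yys; rewrite -[f](subrK v); apply: ord_geD; last exact: hv.
    by apply: ord_ge_le (fy _ yys).
  + exact: IH.
Qed.

(** A basis of the semilocal ring at the zeros of z, modulo the functions vanishing there as much as
    z, is independent over k[z]. Hence the degree of the zeros of z is at most [F : k(z)]. *)
Lemma zeros_independent (z : F) (ys : seq (place iota)) : z != 0 -> uniq ys ->
  (forall y, y \in ys -> 0 < y z) ->
  exists u : 'I_(\sum_(y <- ys) `|y z| * deg_place y) -> F, ~ zdep iota z u.
Proof.
move=> z0 uys ysz; have sub := integral_on_subspace.
have h := integral_on_reldim (fun y => `|y z|%N) uys.
have [u uV [uf _]] := reldim_free (proj1 (sub _ _)) (proj1 (sub _ _)) h.
exists u => /(zdep_primitive z0) [p [i pi] rel].
move/eqP: pi; apply; apply: (uf (fun i => (p i)`_0)) => y yys.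
have yz := ysz _ yys.
apply: (primitive_const_term (z := z)) rel => [|j]; first exact: ltW.
rewrite gtz0_abs // -[y z]addr0; apply: ord_geM; first exact: ord_ge_self.
exact: uV.
Qed.

(** For z transcendental over k, n is [F : k(z)]; for z algebraic it is 0, only the empty family
    being independent. *)
Definition zdegree (z : F) (n : nat) := (exists u : 'I_n -> F, ~ zdep iota z u) /\
  forall m (u : 'I_m -> F), (n < m)%N -> zdep iota z u.

Lemma zdegree_exists z : exists n, zdegree z n.
Proof.
have [N dN] := zdep_bound hF z.
pose P n := `[< exists u : 'I_n -> F, ~ zdep iota z u >].
have P0 : exists n, P n.
  by exists 0%N; apply/asboolP; exists (fun=> 0) => -[p [[]]].
have Pb n : P n -> (n <= N)%N.
  move=> /asboolP[u]; apply: contra_notT; rewrite -ltnNge => /ltnW Nn.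
  exact: zdep_ord_max Nn dN.
case: (ex_maxnP P0 Pb) => n /asboolP nP nmax; exists n; split=> // m u nm.
apply: contrapT => h; have /nmax : P m by apply/asboolP; exists u.
by rewrite leqNgt nm.
Qed.

Lemma zeros_le_zdegree (z : F) n (ys : seq (place iota)) : z != 0 -> uniq ys ->
  (forall y, y \in ys -> 0 < y z) -> zdegree z n ->
  (\sum_(y <- ys) `|y z| * deg_place y <= n)%N.
Proof.
move=> z0 uys ysz [_ nP]; have [u] := zeros_independent z0 uys ysz.
by apply: contra_notT; rewrite -ltnNge; exact: nP.
Qed.

(** Each zero contributes at least 1 to a sum bounded by [zdegree]. *)
Lemma finite_zeros z : finite_set [set y : place iota | 0 < y z].
Proof.
have [->|z0] := eqVneq z 0.
  by rewrite (_ : [set _ | _] = set0) //; apply/seteqP; split=> // y; rewrite /= ord0.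
have [n nP] := zdegree_exists z.
apply: contrapT => inf; have [S Sz nS] := infinite_set_fset n.+1 inf.
have := zeros_le_zdegree z0 (finmap.fset_uniq S) (fun y yS => Sz y yS) nP.
rewrite leqNgt; apply/negP/negPn; apply: leq_trans nS _.
rewrite -sum1_size big_seq [leqRHS]big_seq; apply: leq_sum => y yS.
by rewrite muln_gt0 deg_place_gt0 andbT absz_gt0 gt_eqF //; exact: Sz.
Qed.

Lemma finite_support f : finite_set [set y : place iota | y f != 0].
Proof.
apply: (@sub_finite_set _ _ ([set y : place iota | 0 < y f] `|` [set y : place iota | 0 < y f^-1])).
  move=> y /=; rewrite ordV oppr_gt0 neq_lt => /orP[]; [by right|by left].
by rewrite finite_setU; split; exact: finite_zeros.
Qed.

Lemma divisor_exists (h : place iota -> int) : finite_set [set y | h y != 0] ->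
  exists E : divisor iota, forall y, coeff y E = h y.
Proof.
move=> /finite_seqP[s sP]; exists (\sum_(y <- undup s) << h y *g y >>) => y.
rewrite raddf_sum /=; under eq_bigr do rewrite coeffU.
have [ys|ys] := boolP (y \in s).
  rewrite (perm_big _ (perm_to_rem (_ : y \in undup s))) ?mem_undup //.
  rewrite big_cons /= eqxx mulr1 big_seq big1 ?addr0 // => w.
  by rewrite mem_rem_uniq ?undup_uniq // !inE => /andP[/negPf-> _]; rewrite mulr0.
rewrite big_seq big1 => [|w]; last first.
  by rewrite mem_undup => ws; rewrite (_ : w == y = false) ?mulr0 //; apply: contraNF ys => /eqP<-.
apply/esym/eqP; apply: contraNT ys => hy.
by have : [set y | h y != 0] y by []; rewrite sP.
Qed.

Lemma principal_exists f : exists E : divisor iota, forall y, coeff y E = y f.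
Proof. exact/divisor_exists/finite_support. Qed.

Definition principal f : divisor iota := projT1 (cid (principal_exists f)).
Lemma coeff_principal y f : coeff y (principal f) = y f.
Proof. by rewrite /principal; case: cid. Qed.

Lemma zero_divisor_exists f : exists E : divisor iota, forall y, coeff y E = Num.max (y f) 0.
Proof.
apply: divisor_exists; apply: sub_finite_set (finite_support f) => y /=.
by apply: contra_neq => ->; rewrite maxxx.
Qed.

Definition zero_divisor f : divisor iota := projT1 (cid (zero_divisor_exists f)).
Lemma coeff_zero_divisor y f : coeff y (zero_divisor f) = Num.max (y f) 0.
Proof. by rewrite /zero_divisor; case: cid. Qed.

Lemma divisor_eq A B : (forall y, coeff y A = coeff y B) -> A = B.
Proof. by move=> h; apply/eqP/freeg_eqP. Qed.

Lemma deg_div_seq A (s : seq (place iota)) : uniq s -> {subset dom A <= s} ->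
  deg_div A = \sum_(y <- s) coeff y A * (deg_place y)%:Z.
Proof.
move=> us As; rewrite /deg_div [RHS](bigID (fun y => y \in dom A)) /= addrC [X in _ = X + _]big1 ?add0r.
  rewrite -[RHS]big_filter; apply: perm_big; apply: uniq_perm; rewrite ?filter_uniq ?uniq_dom //.
  by move=> y; rewrite mem_filter; apply/idP/andP => [h|[]//]; split=> //; exact: As.
by move=> y /coeff_outdom->; rewrite mul0r.
Qed.

Lemma deg_divD A B : deg_div (A + B) = deg_div A + deg_div B.
Proof.
pose s := undup (dom A ++ dom B ++ dom (A + B)).
have us : uniq s by rewrite undup_uniq.
have sub (E : divisor iota) : {subset dom E <= dom A ++ dom B ++ dom (A + B)} -> {subset dom E <= s}.
  by move=> h y /h; rewrite mem_undup.
rewrite !(@deg_div_seq _ s) //; try by apply: sub => y; rewrite !mem_cat => ->; rewrite ?orbT.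
by rewrite -big_split; apply: eq_bigr => y _; rewrite coeffD mulrDl.
Qed.

Lemma deg_div0 : deg_div (0 : divisor iota) = 0.
Proof. by rewrite /deg_div big1 // => y _; rewrite coeff0 mul0r. Qed.

Lemma deg_divN A : deg_div (- A) = - deg_div A.
Proof. by apply/eqP; rewrite -addr_eq0 -deg_divD addNr deg_div0. Qed.

Lemma deg_divB A B : deg_div (A - B) = deg_div A - deg_div B.
Proof. by rewrite deg_divD deg_divN. Qed.

Lemma deg_divMn A n : deg_div (A *+ n) = deg_div A *+ n.
Proof. by elim: n => [|n IH]; rewrite ?deg_div0 // !mulrS deg_divD IH. Qed.

Lemma deg_pt y : deg_div (pt y) = (deg_place y)%:Z.
Proof.
rewrite (@deg_div_seq _ [:: y]) // ?big_seq1 /pt ?coeffU ?eqxx ?mulr1 ?mul1r //.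
by rewrite domU1.
Qed.

Lemma coeff_pt x y : coeff y (pt x) = (x == y)%:R.
Proof. by rewrite /pt coeffU mul1r. Qed.

Lemma deg_div_ge0 A : (forall y, 0 <= coeff y A) -> 0 <= deg_div A.
Proof. by move=> h; apply: sumr_ge0 => y _; rewrite mulr_ge0. Qed.

Lemma deg_div_le A B : (forall y, coeff y A <= coeff y B) -> deg_div A <= deg_div B.
Proof.
by move=> h; rewrite -subr_ge0 -deg_divB deg_div_ge0 // => y; rewrite coeffB subr_ge0.
Qed.

Lemma deg_div_eq A B : (forall y, coeff y A <= coeff y B) -> deg_div B <= deg_div A -> A = B.
Proof.
move=> h AB; apply/esym/eqP; rewrite -subr_eq0 -dom_eq0; apply/eqP.
have : deg_div (B - A) <= 0 by rewrite deg_divB subr_le0.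
have nn (y : place iota) : 0 <= coeff y (B - A) by rewrite coeffB subr_ge0.
rewrite /deg_div; case E : (dom _) => [//|y s]; rewrite big_cons leNgt => /negP[].
have : y \in dom (B - A) by rewrite E mem_head.
rewrite mem_dom => cy; apply: ltr_wpDr.
  by apply: sumr_ge0 => w _; rewrite mulr_ge0.
by rewrite mulr_gt0 ?ltz_nat ?deg_place_gt0 // lt0r cy nn.
Qed.

Lemma deg_zeros_le z n : z != 0 -> zdegree z n -> deg_div (zero_divisor z) <= n%:Z.
Proof.
move=> z0 nP; rewrite /deg_div.
have zp y : y \in dom (zero_divisor z) -> 0 < y z.
  by rewrite mem_dom coeff_zero_divisor; case: ltP; rewrite // maxxx eqxx.
have := zeros_le_zdegree z0 (uniq_dom _) zp nP; rewrite -lez_nat; apply: le_trans.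
rewrite -[leRHS]natz natr_sum big_seq [leRHS]big_seq; apply: ler_sum => y /zp yz.
rewrite coeff_zero_divisor natz PoszM gtz0_abs //.
by rewrite ler_pM2r ?ltz_nat ?deg_place_gt0 // ge_max lexx ltW.
Qed.

End Degrees.

(** * Principal divisors and Riemann spaces *)

Section ProductFormula.
Variables (k : finFieldType) (F : fieldType) (iota : {rmorphism k -> F}).
Hypotheses (hF : function_field iota) (hgeom : geometrically_irreducible iota).
Implicit Types (x y : place iota) (f g : F) (A B E : divisor iota).

(** A polynomial of least degree killing z is irreducible over k, hence over F by geometric
    irreducibility; having the root z in F, it is linear. *)
Lemma algebraic_const (p : {poly k}) z : p != 0 -> pev iota p z = 0 -> exists c, z = iota c.
Proof.
have [n] := ubnP (size p); elim: n p => // n IH p; rewrite ltnS => pn p0 pz.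
have [[q [q0 qz qp]]|noq] := pselect (exists q, [/\ q != 0, pev iota q z = 0 & (size q < size p)%N]).
  by apply: (IH q) => //; exact: leq_trans pn.
have sp : (1 < size p)%N.
  rewrite ltnNge; apply/negP => /size1_polyC pE; move: pz p0.
  by rewrite pE pevC polyC_eq0 => /eqP; rewrite fmorph_eq0 => ->.
have irr : irreducible_poly p.
  split=> // q sq1 qp; have [r pE] := dvdpP _ _ qp.
  have /andP[q0 r0] : (q != 0) && (r != 0).
    by move: p0; rewrite pE mulf_eq0 negb_or andbC.
  have : pev iota (r * q) z = 0 by rewrite -pE.
  move=> /eqP; rewrite pevM mulf_eq0 => /orP[]/eqP h.
    exfalso; apply: noq; exists r; split=> //.
    rewrite pE size_mul //; move: sq1; rewrite -(size_poly_eq0 q) in q0.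
    by move: (size q) (size r) q0 => [|[|a]] b //= _ _; rewrite addnS /=; lia.
  rewrite -(dvdp_size_eqp qp) eqn_leq dvdp_leq //= leqNgt; apply/negP => qp'.
  by apply: noq; exists q.
have [_ irrF] := hgeom irr.
have /irrF : size ('X - z%:P) != 1%N by rewrite size_XsubC.
move=> /(_ _)/eqp_size; rewrite size_XsubC size_map_poly => s2.
have {}s2 : 2 = size p by apply: s2; rewrite dvdp_XsubCl; apply/rootP.
exists (- p`_0 / p`_1); move: pz; rewrite (pev_coef _ _ (eq_leq (esym s2))).
rewrite !big_ord_recl big_ord0 addr0 /= expr0 mulr1 expr1 => /eqP.
have p1 : iota p`_1 != 0.
  by rewrite fmorph_eq0; have := p0; rewrite -lead_coef_eq0 lead_coefE -s2.
rewrite addrC addr_eq0 => /eqP h; apply: (mulfI p1); rewrite h.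
by rewrite fmorph_div rmorphN mulrC divfK.
Qed.

Lemma nonconst_zero z : (forall c, z <> iota c) -> exists y : place iota, 0 < y z.
Proof.
move=> zc; apply: (exists_zero hF) => p pz; apply/eqP; apply: contrapT => /negP p0.
by have [c] := algebraic_const p0 pz; exact: zc.
Qed.

Lemma nonconst_pole z : (forall c, z <> iota c) -> exists y : place iota, y z < 0.
Proof.
move=> zc; have [c zi|y] := @nonconst_zero z^-1.
  by apply: (zc c^-1); rewrite fmorphV -zi invrK.
by rewrite ordV oppr_gt0; exists y.
Qed.

Lemma regular_const f : (forall y : place iota, f \in ord_ge y 0) -> exists c, f = iota c.
Proof.
move=> freg; apply: contrapT => fc; have [c fE|y] := @nonconst_pole f.
  by apply: fc; exists c.
rewrite ltNge -ord_geE ?freg //; apply/eqP => f0.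
by apply: fc; exists 0; rewrite rmorph0.
Qed.

(** With finitely many places, weak approximation would give a function of order 1 at all of them.
    Having no pole it would be constant, and constants have order 0. *)
Lemma infinite_places : infinite_set [set: place iota].
Proof.
move=> /finite_seqP[s sP].
have sT (y : place iota) : y \in undup s.
  by rewrite mem_undup; have : [set: place iota] y by []; rewrite sP.
have [t [ttr _]] := hF.
have [y _] := exists_zero hF ttr.
have [g gP] := weak_approximation (fun y => unif y) 2 (undup_uniq s).
have yg (w : place iota) : w g = 1.
  have [|_] := @ordD_lt _ _ _ w (unif w) (g - unif w) (unif_neq0 w).
    by rewrite ord_unif; exact: gP.
  by rewrite addrC subrK ord_unif.
have [c gc|w] := @nonconst_pole g; last by rewrite yg.
by have := yg y; rewrite gc; have [->|c0] := eqVneq c 0; rewrite ?rmorph0 ?ord0 ?ord_const.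
Qed.

Definition divle A B := forall y, coeff y A <= coeff y B.

Lemma divle_ind A (P : divisor iota -> Prop) : P A ->
  (forall B y, divle A B -> P B -> P (B + pt y)) -> forall B, divle A B -> P B.
Proof.
move=> PA Pstep B AB.
have key (s : seq (place iota)) : P (A + \sum_(y <- s) pt y).
  elim: s => [|y s IH]; first by rewrite big_nil addr0.
  rewrite big_cons [pt y + _]addrC addrA; apply: Pstep => // w.
  rewrite coeffD lerDl raddf_sum sumr_ge0 // => v _.
  by rewrite /= coeff_pt.
suff -> : B = A + \sum_(y <- flatten [seq nseq `|coeff y (B - A)| y | y <- dom (B - A)]) pt y.
  exact: key.
rewrite addrC; apply/eqP; rewrite -subr_eq; apply/eqP.
rewrite -{1}[B - A]freeg_sumE big_flatten big_map; apply: eq_bigr => y _.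
rewrite big_nseq iter_addr_0 /pt freegU_muln; congr Freeg; congr (_ :: _); congr (_, _).
by rewrite natz gez0_abs // coeffB subr_ge0.
Qed.

Definition riemann_space A : set (base_vect iota) :=
  [set f | forall y, f \in ord_ge y (- coeff y A)].

Lemma riemann_subspace A : subspace (riemann_space A).
Proof.
split=> [y|c u v hu hv y]; first exact: ord_ge0.
by case: (integral_subspace y (- coeff y A)) => _; apply; [exact: hu|exact: hv].
Qed.
Hint Resolve riemann_subspace : core.

Lemma subspace0 (T : lmodType k) : subspace [set 0 : T].
Proof. by split=> // a u v -> ->; rewrite scaler0 addr0. Qed.
Hint Resolve subspace0 : core.

Lemma riemann_space_sub A B : divle A B -> riemann_space A `<=` riemann_space B.
Proof. by move=> AB f hf y; apply: ord_ge_le (hf y); rewrite lerN2. Qed.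

Lemma riemann_space0 : reldim (riemann_space 0) [set 0] 1.
Proof.
apply: (@free_reldim _ _ _ _ _ (fun=> (1 : F) : base_vect iota)) => //.
- by move=> _ y; rewrite coeff0 oppr0 ord_ge1.
- move=> x; rewrite big_ord1 base_vectZ /= mulr1 => /eqP; rewrite fmorph_eq0 => /eqP x0 i.
  by rewrite [i]zmodp.ord1.
- move=> f fL; have [|c fc] := @regular_const f.
    by move=> y; have := fL y; rewrite coeff0 oppr0.
  by exists (fun=> c); rewrite big_ord1 base_vectZ /= mulr1 fc subrr.
Qed.

Lemma riemann_space_step A y : exists2 m, (m <= deg_place y)%N &
  reldim (riemann_space (A + pt y)) (riemann_space A) m.
Proof.
apply: (@reldim_inj _ _ _ idfun _ _ (integral_at y (- coeff y A - 1))
   (integral_at y (- coeff y A))) => //.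
- by move=> f /(_ y); rewrite coeffD coeff_pt eqxx opprD.
- move=> f fA; split=> [fA'|fy w]; first exact: fA'.
  have [<-//|yw] := eqVneq y w; have := fA w.
  by rewrite coeffD coeff_pt (negPf yw) addr0.
- have := @integral_reldim _ _ _ hF y (- coeff y A - 1) 1.
  by rewrite mul1n subrK.
Qed.

Lemma riemann_space_rel A B : divle A B -> exists2 m, m%:Z <= deg_div B - deg_div A &
  reldim (riemann_space B) (riemann_space A) m.
Proof.
move: B; apply: divle_ind => [|B y AB [m mB dm]].
  by exists 0%N; rewrite ?subrr //; apply/reldim0P.
have [n ny dn] := riemann_space_step B y.
exists (n + m)%N.
  by rewrite deg_divD deg_pt // PoszD; move: mB ny; rewrite -lez_nat; lia.
apply: (@reldim_add _ _ (riemann_space B)) => //; apply: riemann_space_sub => // w.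
by rewrite coeffD lerDl coeff_pt.
Qed.

Lemma finite_coeff A : finite_set [set y : place iota | coeff y A != 0].
Proof.
by apply/finite_seqP; exists (dom A); apply/seteqP; split=> y /=; rewrite mem_dom.
Qed.

Lemma divle_sup A B : exists E, forall y, coeff y E = Num.max (coeff y A) (coeff y B).
Proof.
apply: divisor_exists.
apply: (@sub_finite_set _ _ ([set y : place iota | coeff y A != 0] `|`
   [set y : place iota | coeff y B != 0])); last first.
  by rewrite finite_setU; split; exact: finite_coeff.
move=> y /=; apply: contra_neqP => /not_orP[/negP/negPn/eqP-> /negP/negPn/eqP->].
exact: maxxx.
Qed.

Lemma riemann_space_dim A : exists l, reldim (riemann_space A) [set 0] l.
Proof.
have [B hB] := divle_sup A 0.
have B0 : divle 0 B by move=> y; rewrite hB coeff0 le_max lexx orbT.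
have AB : divle A B by move=> y; rewrite hB le_max lexx.
have [m _ dm] := riemann_space_rel B0.
have dB : reldim (riemann_space B) [set 0] (m + 1).
  apply: (@reldim_add _ _ (riemann_space 0)) => //; first exact: riemann_space_sub.
    by move=> _ ->; case: (riemann_subspace 0).
  exact: riemann_space0.
have [l _ dl] := reldim_sub (riemann_subspace B) (riemann_subspace A) (subspace0 _)
  (riemann_space_sub AB) dB.
by exists l.
Qed.

Definition ell A : nat := projT1 (cid (riemann_space_dim A)).
Lemma ellP A : reldim (riemann_space A) [set 0] (ell A).
Proof. by rewrite /ell; case: cid. Qed.

Lemma sub0_riemann_space A : [set 0] `<=` riemann_space A.
Proof. by move=> _ ->; case: (riemann_subspace A). Qed.
Hint Resolve sub0_riemann_space : core.

Lemma ell_rel A B : divle A B -> exists2 m, ell B = (m + ell A)%N &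
  m%:Z <= deg_div B - deg_div A /\ reldim (riemann_space B) (riemann_space A) m.
Proof.
move=> AB; have [m hm dm] := riemann_space_rel AB; exists m => //.
apply: (reldim_uniq (riemann_subspace B) (subspace0 _) (ellP B)).
apply: (@reldim_add _ _ (riemann_space A)) => //; [exact: riemann_space_sub|exact: ellP].
Qed.

Lemma ell0 : ell 0 = 1%N.
Proof. exact: reldim_uniq (riemann_subspace 0) (subspace0 _) (ellP 0) riemann_space0. Qed.

Lemma ell_effective A : divle 0 A -> (ell A)%:Z <= deg_div A + 1.
Proof. by move=> /ell_rel[m -> [+ _]]; rewrite ell0 deg_div0; lia. Qed.

(** C is the sum of the pole divisors of an independent family u. The functions z^i * u_j with i <=
    l are independent over k and have poles bounded by l times the poles of z, plus C. *)
Lemma pole_family (z : F) n : z != 0 -> zdegree iota z n ->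
  exists2 C, divle 0 C & forall l, (l.+1 * n <= ell (zero_divisor hF z^-1 *+ l + C)%R)%N.
Proof.
move=> z0 [[u nu] _]; exists (\sum_i zero_divisor hF (u i)^-1).
  by move=> y; rewrite coeff0 raddf_sum sumr_ge0 // => i _; rewrite /= coeff_zero_divisor le_max lexx orbT.
move=> l; set E := _ + _.
pose f (ij : 'I_l.+1 * 'I_n) : base_vect iota := z ^+ ij.1 * u ij.2.
have <- : #|{: 'I_l.+1 * 'I_n}| = (l.+1 * n)%N by rewrite card_prod !card_ord.
apply: (reldim_free_le (f := f) (subspace0 _) (ellP E)).
  move=> [i j] y; rewrite /f /=.
  have [->|uj0] := eqVneq (u j) 0; first by rewrite mulr0 ord_ge0.
  rewrite ord_geE ?mulf_neq0 ?expf_neq0 // ordM ?expf_neq0 // ordX //.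
  rewrite /E coeffD coeffMn opprD coeff_zero_divisor ordV raddf_sum /=; apply: lerD.
    have := ltn_ord i; rewrite ltnS; move: (y z) (nat_of_ord i) => a b bl.
    case: (leP (- a) 0) => ha; first by rewrite mul0rn oppr0 mulrn_wge0 // -oppr_le0.
    rewrite mulNrn opprK -(mulr_natr a l) -(mulr_natr a b); apply: ler_wnM2l; first by rewrite -oppr_ge0 ltW.
    by rewrite ler_nat.
  rewrite (bigD1 j) //= coeff_zero_divisor ordV opprD.
  have h : 0 <= \sum_(i | i != j) coeff y (zero_divisor hF (u i)^-1).
    by rewrite sumr_ge0 // => i' _; rewrite coeff_zero_divisor le_max lexx orbT.
  by move: h; move: (y (u j)) (\sum_(i | _) _) => a b; case: leP; lia.
move=> x xf; pose p (j : 'I_n) := \poly_(i < l.+1) x (inord i, j).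
have p0 j : p j = 0.
  apply: contrapT => pj; apply: nu; exists p; first by exists j; apply/eqP.
  rewrite -[RHS]xf (eq_bigr (fun ij : 'I_l.+1 * 'I_n =>
    iota (x (ij.1, ij.2)) * (z ^+ ij.1 * u ij.2))); last by case.
  rewrite -(pair_big xpredT xpredT (fun (i : 'I_l.+1) (j : 'I_n) =>
    iota (x (i, j)) * (z ^+ i * u j))) /= exchange_big /=; apply: eq_bigr => j' _.
  rewrite (pev_coef _ _ (size_poly _ _)) mulr_suml; apply: eq_bigr => i _.
  by rewrite coef_poly ltn_ord inord_val mulrA.
by move=> [i j]; have /polyP/(_ i) := p0 j; rewrite coef_poly ltn_ord coef0 inord_val.
Qed.

Lemma zdegree_le_poles (z : F) n : z != 0 -> zdegree iota z n ->
  n%:Z <= deg_div (zero_divisor hF z^-1).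
Proof.
move=> z0 zn; have [C C0 hl] := pole_family z0 zn.
set B := zero_divisor hF z^-1 in hl *.
have B0 y : 0 <= coeff y B by rewrite coeff_zero_divisor le_max lexx orbT.
have dB := deg_div_ge0 B0.
have dC : 0 <= deg_div C by rewrite -(deg_div0 iota); exact: deg_div_le.
rewrite leNgt; apply/negP => Bn.
(* If deg B < n, then n * (l+1) <= l * deg B + deg C + 1 fails as soon as l reaches deg C + 1. *)
pose l := absz (deg_div C + 1).
have lC : l%:Z = deg_div C + 1 by rewrite gez0_abs // addr_ge0.
have lBC : divle 0 (B *+ l + C).
  move=> y; rewrite coeff0 coeffD coeffMn addr_ge0 ?mulrn_wge0 //.
  by have := C0 y; rewrite coeff0.
have := ell_effective lBC; rewrite deg_divD deg_divMn -mulr_natr natz => h.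
have : (l.+1 * n)%:Z <= deg_div B * l%:Z + deg_div C + 1.
  by apply: le_trans h; rewrite lez_nat hl.
move: Bn dB dC lC; move: (deg_div B) (deg_div C) => b c Bn dB dC lC.
nia.
Qed.

(** The degree of the zeros is at most [zdegree], which is at most the degree of the poles. Applied
    to f and to its inverse, this gives both inequalities. *)
Lemma deg_principal f : f != 0 -> deg_div (principal hF f) = 0.
Proof.
move=> f0; have -> : principal hF f = zero_divisor hF f - zero_divisor hF f^-1.
  apply: divisor_eq => y; rewrite coeffB !coeff_zero_divisor coeff_principal ordV.
  by move: (y f) => a; do 2 case: leP; lia.
have fi0 : f^-1 != 0 by rewrite invr_eq0.
rewrite deg_divB; apply/eqP; rewrite subr_eq0 eq_le.
have [n fn] := zdegree_exists hF f; have [m fm] := zdegree_exists hF f^-1.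
have h1 := zdegree_le_poles f0 fn; have h2 := zdegree_le_poles fi0 fm.
rewrite invrK in h2.
have h3 := deg_zeros_le hF f0 fn; have h4 := deg_zeros_le hF fi0 fm.
by rewrite (le_trans h3 h1) (le_trans h4 h2).
Qed.

End ProductFormula.

(** * Adeles and the vanishing of cohomology in large degree *)

Section Adeles.
Variables (k : finFieldType) (F : fieldType) (iota : {rmorphism k -> F}).

Definition adele (i : {rmorphism k -> F}) : Type := place i -> F.
HB.instance Definition _ := GRing.Zmodule.on (adele iota).
Definition adele_scale (c : k) (r : adele iota) : adele iota := fun y => iota c * r y.
Fact adele_scaleA a b r : adele_scale a (adele_scale b r) = adele_scale (a * b) r.
Proof. by apply/funext => y; rewrite /adele_scale rmorphM mulrA. Qed.
Fact adele_scale1 : left_id 1 adele_scale.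
Proof. by move=> r; apply/funext => y; rewrite /adele_scale rmorph1 mul1r. Qed.
Fact adele_scaleDr : right_distributive adele_scale +%R.
Proof. by move=> a r s; apply/funext => y; rewrite /adele_scale -mulrDr. Qed.
Fact adele_scaleDl r : {morph adele_scale^~ r : a b / a + b}.
Proof. by move=> a b; apply/funext => y; rewrite /adele_scale rmorphD mulrDl. Qed.
HB.instance Definition _ := GRing.Zmodule_isLmodule.Build k (adele iota)
  adele_scaleA adele_scale1 adele_scaleDr adele_scaleDl.

Lemma adeleZ (c : k) (r : adele iota) y : (c *: r) y = iota c * r y. Proof. by []. Qed.
Lemma adeleD (r s : adele iota) y : (r + s) y = r y + s y. Proof. by []. Qed.
Definition adele_at y (r : adele iota) : base_vect iota := r y.
Fact adele_at_linear y : linear (adele_at y). Proof. by []. Qed.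
HB.instance Definition _ y := GRing.isLinear.Build k (adele iota) (base_vect iota)
  _ (adele_at y) (adele_at_linear y).

Definition diagonal (f : base_vect iota) : adele iota := fun=> f.
Fact diagonal_linear : linear diagonal. Proof. by []. Qed.
HB.instance Definition _ := GRing.isLinear.Build k (base_vect iota) (adele iota)
  _ diagonal diagonal_linear.

Definition adele_mul (f : F) (r : adele iota) : adele iota := fun y => f * r y.
Fact adele_mul_linear f : linear (adele_mul f).
Proof. by move=> a r s; apply/funext => y; rewrite /adele_mul !adeleD !adeleZ mulrDr mulrCA. Qed.
HB.instance Definition _ f := GRing.isLinear.Build k (adele iota) (adele iota)
  _ (adele_mul f) (adele_mul_linear f).

Implicit Types (x y : place iota) (f g : F) (A B E : divisor iota) (r s : adele iota).

Definition adele_space A : set (adele iota) :=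
  [set r | forall y, r y \in ord_ge y (- coeff y A)].

(** The sum of F and [adele_space A]: repartitions in it are those with trivial class in H^1(X,
    L_A). *)
Definition adele_global A : set (adele iota) :=
  [set r | exists f : F, forall y, r y - f \in ord_ge y (- coeff y A)].

Lemma adele_subspace A : subspace (adele_space A).
Proof.
split=> [y|c u v hu hv y]; first exact: ord_ge0.
by case: (integral_subspace y (- coeff y A)) => _; apply; [exact: hu|exact: hv].
Qed.

Lemma adele_global_subspace A : subspace (adele_global A).
Proof.
split=> [|c u v [f hf] [g hg]]; first by exists 0 => y; rewrite subr0; exact: ord_ge0.
exists (iota c * f + g) => y; rewrite adeleD adeleZ.
rewrite (_ : _ - _ = iota c * (u y - f) + (v y - g)); last by ring.
by apply: ord_geD => //; apply: ord_geM0 => //; exact: ord_ge_const.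
Qed.

Lemma adele_space_global A : adele_space A `<=` adele_global A.
Proof. by move=> r rA; exists 0 => y; rewrite subr0. Qed.

Lemma repartition_subspace : subspace (@repartition k F iota : set (adele iota)).
Proof.
split=> [|c u v hu hv].
  rewrite /repartition /= (_ : [set _ | _] = set0) //; apply/seteqP; split=> // y /=.
  by rewrite ord_ge0.
apply: (@sub_finite_set _ _ ([set y | u y \notin ord_ge y 0] `|` [set y | v y \notin ord_ge y 0])).
  move=> y /=; apply: contraNP => /not_orP[/negP/negPn hu' /negP/negPn hv'].
  by apply: ord_geD => //; apply: ord_geM0 => //; exact: ord_ge_const.
by rewrite finite_setU.
Qed.
Hint Resolve adele_subspace adele_global_subspace repartition_subspace : core.

Hypotheses (hF : function_field iota) (hgeom : geometrically_irreducible iota).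
Notation ell := (ell hF hgeom).

Lemma repartition_mul f r : repartition r -> repartition (adele_mul f r).
Proof.
move=> hr; apply: (@sub_finite_set _ _ ([set y | r y \notin ord_ge y 0] `|`
   [set y : place iota | y f != 0])).
  move=> y /=; apply: contraNP => /not_orP[/negP/negPn hr' /negP/negPn/eqP yf].
  by apply: ord_geM0 => //; rewrite -yf; exact: ord_ge_self.
by rewrite finite_setU; split=> //; exact: finite_support.
Qed.

Lemma repartition_adele_space E r : repartition r -> exists2 B, divle E B & adele_space B r.
Proof.
move=> hr.
have [|C hC] := @divisor_exists k F iota (fun y => Num.max 0 (- y (r y))).
  apply: sub_finite_set hr => y /=; apply: contra_neqN.
  by rewrite inE => /orP[/eqP->|h]; [rewrite ord0 oppr0 maxxx|apply/max_idPl; rewrite oppr_le0].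
have [B hB] := divle_sup E C; exists B => y; first by rewrite hB le_max lexx.
apply: (ord_ge_le _ (ord_ge_self y (r y))).
rewrite hB hC; move: (coeff y E) (y (r y)) => a b; do 2 case: leP; lia.
Qed.

Lemma adele_space_repartition A : adele_space A `<=` (@repartition k F iota : set (adele iota)).
Proof.
move=> r hr; apply: sub_finite_set (finite_coeff A) => y /=; apply: contraNneq => cA.
by have := hr y; rewrite cA oppr0 => ->.
Qed.

Lemma adele_space_sub A B : divle A B -> adele_space A `<=` adele_space B.
Proof. by move=> AB r hr y; apply: ord_ge_le (hr y); rewrite lerN2. Qed.

Lemma adele_space_rel A B : divle A B -> exists2 m, m%:Z = deg_div B - deg_div A &
  reldim (adele_space B) (adele_space A) m.
Proof.
move: B; apply: divle_ind => [|B y AB [m mB dm]].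
  by exists 0%N; rewrite ?subrr //; apply/reldim0P.
have le1 : divle B (B + pt y) by move=> w; rewrite coeffD lerDl coeff_pt.
exists (deg_place y + m)%N.
  by rewrite deg_divD deg_pt // PoszD mB; lia.
apply: (@reldim_add _ _ (adele_space B)) => //; [exact: adele_space_sub|exact: adele_space_sub|].
apply/(@reldim_map _ _ _ (adele_at y) _ _ (integral_at y (- coeff y B - 1))
   (integral_at y (- coeff y B))) => //.
- by move=> r /(_ y); rewrite coeffD coeff_pt eqxx opprD.
- move=> r hr; split=> [hr'|ry w]; first exact: hr'.
  have [<-//|yw] := eqVneq y w; have := hr w.
  by rewrite coeffD coeff_pt (negPf yw) addr0.
- move=> v hv; exists (fun w => if w == y then v else 0).
    move=> w; case: eqP => [->|_]; last exact: ord_ge0.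
    by rewrite coeffD coeff_pt eqxx opprD.
  by rewrite /= /adele_at eqxx subrr; case: (integral_subspace y (- coeff y B)).
- have := @integral_reldim _ _ _ hF y (- coeff y B - 1) 1.
  by rewrite mul1n subrK.
Qed.

(** In the notation of Riemann-Roch this is g - 1 - h^1(L_A). It increases with A and is maximal
    exactly where H^1 vanishes. *)
Definition index A : int := deg_div A - (ell A)%:Z.

Lemma index_le A B : divle A B -> index A <= index B.
Proof. by move=> /(ell_rel hF hgeom)[m e [h _]]; rewrite /index e PoszD; lia. Qed.

Lemma ell_principal A f : f != 0 -> ell (A + principal hF f) = ell A.
Proof.
move=> f0; apply: (reldim_uniq (riemann_subspace A) (subspace0 _) _ (ellP hF hgeom A)).
apply: (proj1 (@reldim_map _ _ _ (@mul_by k F iota f)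
  (riemann_space (A + principal hF f)) [set 0] (riemann_space A) [set 0] _ _ _ _ _ _ _ _)).
- exact: riemann_subspace.
- exact: subspace0.
- exact: riemann_subspace.
- exact: subspace0.
- move=> v hv y; have := hv y; rewrite coeffD coeff_principal opprD => hv'.
  by rewrite -[- coeff y A](addrNK (y f)) addrC; apply: ord_geM => //; exact: ord_ge_self.
- move=> v _; rewrite /mul_by /=; split=> [->|h]; first exact: mulr0.
  have : f * (v : F) == 0 by apply/eqP; exact: h.
  by rewrite mulf_eq0 (negPf f0) => /eqP.
- move=> v hv; exists (f^-1 * v); last by apply/eqP; rewrite subr_eq0; apply/eqP/esym; exact: (mulVKf f0 v).
  move=> y; rewrite coeffD coeff_principal opprD addrC -ordV.
  by apply: ord_geM => //; exact: ord_ge_self.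
- exact: ellP.
Qed.

Lemma index_principal A f : f != 0 -> index (A + principal hF f) = index A.
Proof. by move=> f0; rewrite /index ell_principal // deg_divD deg_principal // addr0. Qed.

(** Riemann's inequality. The index of l*B + C, with B the zeros of t, is at most deg C - n for all
    l, by [pole_family]. Any effective A' lies below l*B + C up to linear equivalence once l*B - A'
    has a nonzero section, and the index is monotone and invariant under linear equivalence. *)
Lemma index_bounded : exists b, forall A, index A <= b.
Proof.
have [t [ttr _]] := hF; have [y yt] := exists_zero hF ttr.
have t0 : t^-1 != 0.
  by rewrite invr_eq0; apply/eqP => t0; move: yt; rewrite t0 ord0.
have [n tn] := zdegree_exists hF t^-1.
have [C C0 hC] := pole_family hF hgeom t0 tn.
rewrite invrK in hC; set B := zero_divisor hF t in hC.
have B0 w : 0 <= coeff w B by rewrite coeff_zero_divisor le_max lexx orbT.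
have dB : deg_div B <= n%:Z.
  have := deg_principal hF hgeom t0.
  have -> : principal hF t^-1 = zero_divisor hF t^-1 - zero_divisor hF t.
    apply: divisor_eq => w; rewrite coeffB !coeff_zero_divisor coeff_principal ordV.
    by move: (w t) => a; do 2 case: leP; lia.
  by rewrite deg_divB => /eqP; rewrite subr_eq0 => /eqP <-; exact: deg_zeros_le tn.
have n0 : (0 < n)%N.
  rewrite -ltz_nat; apply: lt_le_trans dB; rewrite lt_def deg_div_ge0 // andbT.
  apply/eqP => dB0; have B00 : 0 = B.
    by apply: (deg_div_eq hF) => [w|]; rewrite ?coeff0 // dB0 deg_div0.
  have := coeff_zero_divisor hF y t; rewrite -/B -B00 coeff0 => /esym/max_idPr.
  by rewrite leNgt yt.
exists (deg_div C - n%:Z) => A.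
have [A' hA'] := divle_sup A 0.
have AA' : divle A A' by move=> w; rewrite hA' le_max lexx.
have A'0 : divle 0 A' by move=> w; rewrite hA' coeff0 le_max lexx orbT.
apply: le_trans (index_le AA') _.
have dA' : 0 <= deg_div A' by rewrite -(deg_div0 iota); exact: deg_div_le.
have dC : 0 <= deg_div C by rewrite -(deg_div0 iota); exact: deg_div_le.
(* Passing from l*B - A' to l*B + C raises the degree by exactly l, whereas the latter has at least
   n*(l+1) > l independent sections; so the former has a nonzero one. *)
pose l := absz (deg_div C + deg_div A').
have lCA : l%:Z = deg_div C + deg_div A' by rewrite gez0_abs // addr_ge0.
have h1 : divle (B *+ l - A') (B *+ l + C).
  move=> w; rewrite coeffD [leRHS]coeffD lerD2l coeffN.
  by have := A'0 w; have := C0 w; rewrite coeff0; lia.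
have [m e1 [e2 _]] := ell_rel hF hgeom h1.
have hl := hC l.
have lpos : (0 < ell (B *+ l - A')%R)%N.
  move: e1 e2 hl; rewrite deg_divD deg_divB => -> + hl.
  move: lCA hl n0; move: (ell (B *+ l - A')) (deg_div (B *+ l)) (deg_div C) (deg_div A') => a b c d.
  nia.
have [f fL f0] : exists2 f : F, riemann_space (B *+ l - A') f & f != 0.
  apply: contrapT => nof; have : riemann_space (B *+ l - A') `<=` [set 0].
    by move=> f fL; apply: contrapT => /eqP f0; apply: nof; exists f.
  move=> /(reldim0P _ (subspace0 _))/(reldim_uniq (riemann_subspace _) (subspace0 _) (ellP hF hgeom _)).
  by move=> h; rewrite h in lpos.
have h2 : divle A' (B *+ l + C + principal hF f).
  move=> w; have := fL w; rewrite ord_geE // coeffB !coeffD coeff_principal.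
  by have := C0 w; rewrite coeff0; lia.
apply: le_trans (index_le h2) _; rewrite index_principal //.
rewrite /index deg_divD deg_divMn -mulr_natr natz.
move: dB hl; move: (ell _) (deg_div B) (deg_div C) => a b c.
by nia.
Qed.

Lemma max_index : exists A0, forall A, index A <= index A0.
Proof.
have [b hb] := index_bounded.
pose P n := `[< exists A, index A = b - n%:Z >].
have P0 : exists n, P n.
  exists (absz (b - index 0)%R); apply/asboolP; exists 0.
  by rewrite gez0_abs ?subr_ge0 //; lia.
case: (ex_minnP P0) => n /asboolP[A0 hA0] nmin; exists A0 => A.
have hA : index A = b - (absz (b - index A)%R)%:Z by rewrite gez0_abs ?subr_ge0 //; lia.
have := nmin (absz (b - index A)%R); rewrite hA0 => h.
have : (n <= absz (b - index A)%R)%N by apply: h; apply/asboolP; exists A.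
by rewrite {2}hA; lia.
Qed.

(** An adele bounded by B and congruent to f modulo A forces f to be a section of L_B, so the
    diagonal map identifies the two quotients. *)
Lemma diagonal_reldim A B m : divle A B ->
  reldim (riemann_space B) (riemann_space A) m ->
  reldim (adele_space B `&` adele_global A) (adele_space A) m.
Proof.
move=> AB h.
have sV : subspace (adele_space B `&` adele_global A).
  have [b1 b2] := adele_subspace B; have [a1 a2] := adele_global_subspace A.
  by split=> // c u v [hu1 hu2] [hv1 hv2]; split; [exact: b2|exact: a2].
apply/(@reldim_map _ _ _ diagonal (riemann_space B) (riemann_space A)) => //.
- exact: riemann_subspace.
- exact: riemann_subspace.
- move=> f hf; split=> //; exists f => y; rewrite subrr; exact: ord_ge0.
- move=> r [rB [f hf]]; exists f; last by [].
  move=> y; rewrite -[f](subKr (r y)); apply: ord_geB; first exact: rB.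
  by apply: ord_ge_le (hf y); rewrite lerN2.
Qed.

(** Enlarging E to B raises ell by as much as the degree, since the index is already maximal. By
    [diagonal_reldim], global functions then account for all of [adele_space B] modulo
    [adele_space E]. *)
Lemma max_index_global E r : (forall A, index A <= index E) -> repartition r ->
  adele_global E r.
Proof.
move=> Emax rr; have [B EB rB] := repartition_adele_space E rr.
have [m e [_ dm]] := ell_rel hF hgeom EB.
have [m' e' dm'] := adele_space_rel EB.
have mm' : m' = m.
  have /eqP := le_anti (introT andP (conj (index_le EB) (Emax B))).
  rewrite /index e PoszD => /eqP h; have : m'%:Z = m%:Z; last by case.
  by rewrite e'; move: h; lia.
have [b1 b2] := adele_subspace B; have [a1 a2] := adele_global_subspace E.
have sV : subspace (adele_space B `&` adele_global E).
  by split=> // c u v [hu1 hu2] [hv1 hv2]; split; [exact: b2|exact: a2].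
have VB : adele_space B `&` adele_global E `<=` adele_space B by move=> s [].
have EV : adele_space E `<=` adele_space B `&` adele_global E.
  by move=> s hs; split; [exact: adele_space_sub hs|exact: adele_space_global].
rewrite mm' in dm'.
have := reldim_eq_sub sV (adele_subspace B) (adele_subspace E) EV VB (diagonal_reldim EB dm) dm'.
by move=> /(_ r rB)[].
Qed.

(* H^1(X, L_A) is finite-dimensional, and of dimension max_B (deg B - l(B)) - (deg A - l(A)). *)
Lemma adele_cohomology A : exists2 n,
  reldim (@repartition k F iota : set (adele iota)) (adele_global A) n &
  exists2 B, (forall E, index E <= index B) & n%:Z = index B - index A.
Proof.
have [A0 hA0] := max_index; have [B hB] := divle_sup A A0.
have AB : divle A B by move=> w; rewrite hB le_max lexx.
have Bmax E : index E <= index B.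
  by apply: le_trans (hA0 E) (index_le _) => w; rewrite hB le_max lexx orbT.
have [b1 b2] := adele_subspace B; have [a1 a2] := adele_global_subspace A.
pose V := adele_space B `&` adele_global A.
have sV : subspace V.
  by split=> // c u v [hu1 hu2] [hv1 hv2]; split; [exact: b2|exact: a2].
have [m e [_ /(diagonal_reldim AB) dm]] := ell_rel hF hgeom AB.
have [m' e' dm'] := adele_space_rel AB.
have VB : V `<=` adele_space B by move=> s [].
have AV : adele_space A `<=` V.
  by move=> s hs; split; [exact: adele_space_sub hs|exact: adele_space_global].
have [n [n' [dn dn' en]]] := reldim_flag (adele_subspace B) sV (adele_subspace A) VB AV dm'.
have n'm := reldim_uniq sV (adele_subspace A) dn' dm.
exists n; last first.
  exists B => //; rewrite /index e PoszD.
  by move: e'; rewrite en n'm PoszD; lia.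
have h : reldim (adele_space B) (adele_global A) n.
  apply/(@reldim_map _ _ _ idfun (adele_space B) V) => //.
    by move=> v vB; split=> [[]|].
  by move=> v vB; exists v; rewrite //= subrr.
apply/(@reldim_map _ _ _ idfun (adele_space B) (adele_global A)) => //.
- exact: adele_space_repartition.
- move=> r rr; have [f hf] := max_index_global Bmax rr.
  exists (r - diagonal f) => //.
  by rewrite /= opprB addrC subrK; exists f => y; rewrite subrr; exact: ord_ge0.
Qed.

(** H^1(X, O_X) has dimension the maximal index minus that of 0, and the index of 0 is -1; the
    maximal index is therefore g - 1. *)
Lemma genus_index : reldim (@repartition k F iota : set (adele iota)) (adele_global 0) (genus iota) /\
  forall E, index E <= (genus iota)%:Z - 1.
Proof.
have [n dn [B Bmax e]] := adele_cohomology 0.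
have tr : @trivial_repartition k F iota = adele_global 0.
  by apply/seteqP; split=> r [f hf]; exists f => y; have := hf y; rewrite coeff0 oppr0.
have -> : genus iota = n.
  apply: xget_unique; first by rewrite /= tr.
  move=> m; rewrite /= tr => dm.
  exact: (reldim_uniq repartition_subspace (adele_global_subspace 0) dm dn).
split=> // E; move: e; rewrite /index ell0 deg_div0 => e.
by have := Bmax E; rewrite /index; lia.
Qed.

(** A coordinate of V/W that does not vanish at v0, extended arbitrarily outside V; linearity is
    therefore claimed on V only. *)
Lemma linear_functional (T : lmodType k) (V W : set T) n v0 : subspace V -> subspace W ->
  reldim V W n -> V v0 -> ~ W v0 -> exists w : T -> k,
  [/\ forall a u v, V u -> V v -> w (a *: u + v) = a * w u + w v,
      forall v, V v -> W v -> w v = 0 & w v0 != 0].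
Proof.
move=> sV sW /(reldim_free (proj1 sV) (proj1 sW))[e Ve [fe se]] Vv0 Wv0.
have /choice[c cP] : forall v, exists c : 'I_n -> k, V v -> W (v - \sum_i c i *: e i).
  by move=> v; have [/se[c]|] := pselect (V v); [exists c|exists (fun=> 0)].
have cE v d : V v -> W (v - \sum_i d i *: e i) -> forall i, c v i = d i.
  move=> Vv hd i; apply/eqP; rewrite -subr_eq0; apply/eqP; move: i; apply: fe.
  under eq_bigr do rewrite scalerBl.
  rewrite sumrB (_ : _ - _ = (v - \sum_i d i *: e i) - (v - \sum_i c v i *: e i)).
    by apply: (subspaceB sW) => //; exact: cP.
  by rewrite opprB [RHS]addrC addrA subrK.
have [i ci] : exists i, c v0 i != 0.
  apply: contrapT => h; apply: Wv0; have := cP _ Vv0.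
  rewrite big1 ?subr0 // => i _; apply/eqP; rewrite scaler_eq0; apply/orP; left.
  by apply/negPn/negP => ci; apply: h; exists i.
exists (fun v => c v i); split=> //.
  move=> a u v Vu Vv; apply: (cE _ (fun i => a * c u i + c v i)).
    by case: sV => _; exact.
  under eq_bigr do rewrite scalerDl -scalerA.
  rewrite big_split /= -scaler_sumr opprD addrACA -scalerBr.
  by case: sW => _; apply; exact: cP.
move=> v Vv Wv; apply: (cE _ (fun=> 0)) => //.
by rewrite big1 ?subr0 // => j _; rewrite scale0r.
Qed.

(* A nonzero functional w on H^1(L_E) yields an injection f |-> w(f _) of the space of
   sections of L_E into the dual of H^1(O_X); by Riemann's theorem the former has dimension
   greater than g. *)
Lemma adele_global_deg E : 2 * (genus iota)%:Z - 2 < deg_div E ->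
  forall r, repartition r -> adele_global E r.
Proof.
move=> dE r0 rr0; apply: contrapT => nr0.
have [dg gmax] := genus_index.
have [n dn [B Bmax e]] := adele_cohomology E.
have [w [wl w0 wr0]] := linear_functional repartition_subspace (adele_global_subspace E) dn rr0 nr0.
have n0 : (0 < n)%N.
  rewrite lt0n; apply/eqP => n0; rewrite n0 in dn.
  by apply: nr0; move/(reldim0P _ (adele_global_subspace E)): dn; apply.
(* As H^1(X, L_E) is nonzero, the index of E is at most g - 2; hence ell E >= deg E - g + 2 > g. *)
have lg : (genus iota < ell E)%N.
  by have := gmax B; move: e dE n0; rewrite /index; lia.
have [f fE [ff _]] := reldim_free (proj1 (riemann_subspace E)) (proj1 (subspace0 _)) (ellP hF hgeom E).
have [s sR [_ ss]] := reldim_free (proj1 repartition_subspace) (proj1 (adele_global_subspace 0)) dg.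
have [x x0 xM] := wide_mx_ker (\matrix_(i < ell E, j < genus iota) w (adele_mul (f i) (s j))) lg.
pose h : base_vect iota := \sum_i x 0 i *: f i.
have hE : riemann_space E h by apply: subspace_sum => //; exact: riemann_subspace.
have h0 : (h : F) != 0.
  apply: contraNneq x0 => h0; apply/eqP/rowP => i; rewrite mxE.
  exact: (ff (fun i => x 0 i) h0).
have wsum (I : finType) (c : I -> k) (u : I -> adele iota) :
    (forall i, repartition (u i)) -> w (\sum_i c i *: u i) = \sum_i c i * w (u i).
  move=> ur; have [t0 tl] := repartition_subspace.
  suff [] : repartition (\sum_i c i *: u i) /\
      w (\sum_i c i *: u i) = \sum_i c i * w (u i) by [].
  apply: (big_ind2 (fun a b => repartition a /\ w a = b)).
  - by split=> //; apply: w0 => //; case: (adele_global_subspace E).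
  - move=> a b a' b' [h1 <-] [h2 <-]; have := wl 1 a a' h1 h2.
    by rewrite scale1r mul1r => ->; split=> //; have := tl 1 a a' h1 h2; rewrite scale1r.
  - move=> i _; have := wl (c i) (u i) 0 (ur i) t0; rewrite addr0 (w0 0) ?addr0 //.
      by move=> ->; split=> //; have := tl (c i) (u i) 0 (ur i) t0; rewrite addr0.
    by case: (adele_global_subspace E).
have ws j : w (adele_mul h (s j)) = 0.
  have -> : adele_mul h (s j) = \sum_i x 0 i *: adele_mul (f i) (s j).
    apply/funext => y; rewrite fct_sumE /adele_mul /h mulr_suml.
    by apply: eq_bigr => i _; rewrite base_vectZ -mulrA.
  rewrite wsum => [|i]; last exact: repartition_mul.
  have /rowP/(_ j) := xM; rewrite !mxE => xj; rewrite -[RHS]xj.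
  by apply: eq_bigr => i _; rewrite mxE.
(* The functional w(h _) kills the basis s of H^1(X, O_X) and the trivial classes, hence all
   repartitions. As h is invertible, w itself then vanishes. *)
have wh r : repartition r -> w (adele_mul h r) = 0.
  move=> rr; have [c [g hc]] := ss r rr.
  have -> : adele_mul h r = \sum_j c j *: adele_mul h (s j) +
      adele_mul h (r - \sum_j c j *: s j).
    rewrite linearB addrC linear_sum.
    by under [X in _ - X]eq_bigr do rewrite linearZ; rewrite subrK.
  have -> : \sum_j c j *: adele_mul h (s j) + adele_mul h (r - \sum_j c j *: s j) =
    1 *: (\sum_j c j *: adele_mul h (s j)) + adele_mul h (r - \sum_j c j *: s j).
    by rewrite scale1r.
  rewrite wl.
  - rewrite wsum => [|j]; last exact: repartition_mul.
    rewrite big1 => [|j _]; last by rewrite ws mulr0.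
    rewrite mulr0 add0r; apply: w0.
      apply: repartition_mul; apply: (subspaceB repartition_subspace) => //.
      exact: (subspace_sum _ repartition_subspace).
    exists (h * g) => y; rewrite -mulrBr -[- coeff y E]addr0.
    apply: ord_geM; first exact: hE.
    by have := hc y; rewrite coeff0 oppr0.
  - apply: (subspace_sum _ repartition_subspace) => j; exact: repartition_mul.
  - apply: repartition_mul; apply: (subspaceB repartition_subspace) => //.
    exact: (subspace_sum _ repartition_subspace).
move/eqP: wr0; apply; rewrite -(wh (adele_mul h^-1 r0)); last exact: repartition_mul.
by congr w; apply/funext => y; rewrite /adele_mul mulVKf.
Qed.

(** The adele equal to u at x and 0 elsewhere is congruent to a global function modulo L_(D - x),
    whose degree still exceeds 2g - 2. *)
Lemma section_prescribed x D u :
  Num.max (2 * (genus iota)%:Z - 2) 0 + (deg_place x)%:Z < deg_div D ->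
  u \in ord_ge x (- coeff x D) ->
  exists2 h, (forall y, h \in ord_ge y (- coeff y D)) & h - u \in ord_ge x (1 - coeff x D).
Proof.
move=> dD hu; pose r : adele iota := fun y => if y == x then u else 0.
have rr : repartition r.
  apply: (@adele_space_repartition D) => y; rewrite /r.
  by case: eqP => [->//|_]; exact: ord_ge0.
have [|h hh] := @adele_global_deg (D - pt x) _ r rr.
  by rewrite deg_divB deg_pt //; move: dD; case: leP; lia.
have hx : h - u \in ord_ge x (1 - coeff x D).
  have := hh x; rewrite /r eqxx coeffB coeff_pt eqxx opprB => h'.
  by rewrite -opprB; apply: ord_geN.
exists h => // y; have [->|yx] := eqVneq y x.
  rewrite -[h](subrK u); apply: ord_geD => //; apply: ord_ge_le hx; lia.
have := hh y; rewrite /r (negPf yx) sub0r ord_geNE coeffB coeff_pt eq_sym (negPf yx).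
by rewrite subr0.
Qed.

End Adeles.

(** * Vector bundles as families of lattices *)

Section LinearOf.
Variables (R : pzRingType) (U V : lmodType R) (f : U -> V) (hf : linear f).
Definition linear_fun of linear f : U -> V := f.
HB.instance Definition _ := GRing.isLinear.Build R U V _ (linear_fun hf) hf.
Definition linear_of : {linear U -> V} := linear_fun hf.
End LinearOf.

Section Sheaves.
Variables (k : finFieldType) (F : fieldType) (iota : {rmorphism k -> F}).
Implicit Types (x y : place iota) (f g : F) (U V W : zopen iota) (M N : omod iota).

Definition ohom_of M N (f : forall U, M U -> N U) (hf : forall U, linear (f U))
    (hr : forall U V (h : V `<=` U) s, f V (res h s) = res h (f U s)) : ohom M N :=
  @OHom _ _ _ M N (fun U => linear_of (hf U)) hr.

Definition ohom_id M : ohom M M :=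
  @ohom_of M M (fun U s => s) (fun U a s t => erefl) (fun U V h s => erefl).

Fact ohom_comp_linear M N P (q : ohom N P) (p : ohom M N) U :
  linear (fun s => q U (p U s)).
Proof. by move=> a s t; rewrite !linearP. Qed.
Fact ohom_comp_res M N P (q : ohom N P) (p : ohom M N) U V (h : V `<=` U) s :
  q V (p V (res h s)) = res h (q U (p U s)).
Proof. by rewrite !hmap_res. Qed.
Definition ohom_comp M N P (q : ohom N P) (p : ohom M N) : ohom M P :=
  ohom_of (@ohom_comp_linear M N P q p) (@ohom_comp_res M N P q p).

Definition oiso M N := exists (j : ohom M N) (j' : ohom N M),
  (forall U, cancel (j U) (j' U)) /\ (forall U, cancel (j' U) (j U)).

Lemma oiso_refl M : oiso M M.
Proof. by exists (ohom_id M), (ohom_id M). Qed.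

Lemma oiso_sym M N : oiso M N -> oiso N M.
Proof. by move=> [j [j' [h h']]]; exists j', j. Qed.

Lemma oiso_trans M N P : oiso M N -> oiso N P -> oiso M P.
Proof.
move=> [j [j' [h h']]] [i [i' [g g']]]; exists (ohom_comp i j), (ohom_comp j' i').
by split=> U s /=; rewrite /linear_fun /= ?g ?h ?h' ?g'.
Qed.

Lemma oiso_bij M N (f : forall U, M U -> N U) : (forall U, linear (f U)) ->
  (forall U V (h : V `<=` U) s, f V (res h s) = res h (f U s)) ->
  (forall U, injective (f U)) -> (forall U t, exists s, f U s = t) -> oiso M N.
Proof.
move=> hf hr fi fs.
pose g U t := projT1 (cid (fs U t)).
have gK U t : f U (g U t) = t by rewrite /g; case: cid.
have hg U : linear (g U) by move=> a s t; apply: fi; rewrite hf !gK.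
have hgr U V (h : V `<=` U) s : g V (res h s) = res h (g U s).
  by apply: fi; rewrite hr !gK.
exists (ohom_of hf hr), (ohom_of hg hgr); split=> U s //=.
  by rewrite /linear_fun; apply: fi; rewrite gK.
by rewrite /linear_fun gK.
Qed.

Lemma res0 M U V (h : V `<=` U) : res h (0 : M U) = 0.
Proof. by apply: (addrI (res h (0 : M U))); rewrite -resD !addr0. Qed.

Lemma res_sum M U V (h : V `<=` U) (I : Type) (r : seq I) (P : pred I) (s : I -> M U) :
  res h (\sum_(i <- r | P i) s i) = \sum_(i <- r | P i) res h (s i).
Proof. exact: (big_morph _ (@resD _ _ _ M U V h) (res0 M h)). Qed.

Lemma reg_ge U (a : reg U) y : zset U y -> val a \in ord_ge y 0.
Proof. by move=> Uy; have /asboolP := valP a; apply. Qed.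

Lemma reg_of_regular (S : set (place iota)) f : (forall y, S y -> f \in ord_ge y 0) ->
  exists a : reg S, val a = f.
Proof. by move=> h; exists (Reg (introT (asboolP _) h)). Qed.

Hypotheses (hF : function_field iota) (hgeom : geometrically_irreducible iota).

Fact cofinite_nonempty (S : set (place iota)) : finite_set (~` S) -> S !=set0.
Proof.
move=> fS; apply/set0P/eqP => S0; apply: (infinite_places hF hgeom).
by move: fS; rewrite S0 setC0.
Qed.

Definition zopen_of (S : set (place iota)) (fS : finite_set (~` S)) : zopen iota :=
  ZOpen (cofinite_nonempty fS) fS.

Fact cofiniteI U V : finite_set (~` (zset U `&` zset V)).
Proof. by rewrite setCI finite_setU; split; exact: zopen_cofinite. Qed.

Definition zopenI U V : zopen iota := zopen_of (cofiniteI U V).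

Lemma zopenIl U V : zopenI U V `<=` U. Proof. by move=> y []. Qed.
Lemma zopenIr U V : zopenI U V `<=` V. Proof. by move=> y []. Qed.
Lemma sub_zopenI U V W : W `<=` U -> W `<=` V -> W `<=` zopenI U V.
Proof. by move=> h1 h2 y Wy; split; [exact: h1|exact: h2]. Qed.

Lemma regular_open f : finite_set (~` [set y : place iota | f \in ord_ge y 0]).
Proof.
apply: sub_finite_set (finite_support hF f) => y /=; apply: contra_notN => /eqP yf.
by have := ord_ge_self y f; rewrite yf.
Qed.

Lemma sheaf_separated M U (s t : M U) : is_sheaf M ->
  (forall y, zset U y -> exists (W : zopen iota) (h : W `<=` U), zset W y /\ res h s = res h t) ->
  s = t.
Proof.
move=> sM hst.
pose I := {W : zopen iota | exists h : W `<=` U, res h s = res h t}.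
have hI (i : I) : sval i `<=` U by case: i => W [].
have eI (i : I) : res (hI i) s = res (hI i) t.
  by move: (hI i); case: i => W [h e] h'; rewrite (Prop_irrelevance h' h).
have [||u [_ uu]] := @sM U I (fun i => sval i) hI _ (fun i => res (hI i) s).
- move=> y Uy; have [W [h [Wy e]]] := hst y Uy.
  by exists (exist _ W (ex_intro _ h e)).
- move=> i j V hi hj.
  have hV : V `<=` U by move=> y /hi; exact: hI.
  by rewrite !(res_comp _ _ hV).
by rewrite -(uu s) // -(uu t).
Qed.

End Sheaves.

(** * Lattices in F^n and their sheaves of sections *)

Section IntegralMatrices.
Variables (k : finFieldType) (F : fieldType) (iota : {rmorphism k -> F}).
Implicit Types (y : place iota).

Definition integral_mx m n y (A : 'M[F]_(m, n)) := forall i j, A i j \in ord_ge y 0.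

Lemma integral_mx0 m n y : integral_mx y (0 : 'M[F]_(m, n)).
Proof. by move=> i j; rewrite mxE ord_ge0. Qed.

Lemma integral_mxB m n y (A B : 'M[F]_(m, n)) :
  integral_mx y A -> integral_mx y B -> integral_mx y (A - B).
Proof. by move=> hA hB i j; rewrite !mxE; exact: ord_geB. Qed.

Lemma integral_mxZ m n y f (A : 'M[F]_(m, n)) :
  f \in ord_ge y 0 -> integral_mx y A -> integral_mx y (f *: A).
Proof. by move=> hf hA i j; rewrite !mxE; exact: ord_geM0. Qed.

Lemma integral_mxM m n p y (A : 'M[F]_(m, n)) (B : 'M[F]_(n, p)) :
  integral_mx y A -> integral_mx y B -> integral_mx y (A *m B).
Proof. by move=> hA hB i j; rewrite mxE; apply: ord_ge_sum => l _; exact: ord_geM0. Qed.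

Lemma integral_mx1 n y : integral_mx y (1%:M : 'M[F]_n).
Proof. by move=> i j; rewrite mxE; case: (_ == _); rewrite ?ord_ge1 ?ord_ge0. Qed.

Lemma integral_mx_open (hF : function_field iota) m n (A : 'M[F]_(m, n)) :
  finite_set (~` [set y : place iota | integral_mx y A]).
Proof.
have h : finite_set (\bigcup_(ij in [set: 'I_m * 'I_n]) ~` [set y : place iota | A ij.1 ij.2 \in ord_ge y 0]).
  by apply: bigcup_finite => [|ij _]; [exact: finite_finset|exact: regular_open].
apply: sub_finite_set h => y hy; apply: contrapT => h; apply: hy => i j.
by apply: contrapT => hij; apply: h; exists (i, j).
Qed.

(* The rows of [local_basis y] span the stalk at y, as a lattice in F^n over the local ring. *)
Record bundle_data n := BundleData {
  local_basis :> place iota -> 'M[F]_n;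
  local_basis_unit : forall y, local_basis y \in unitmx;
  local_basis_std : finite_set [set y | local_basis y <> 1%:M] }.

Variables (n : nat) (G : bundle_data n).

Definition in_lattice y (v : 'rV[F]_n) := integral_mx y (v *m invmx (G y)).

Definition lat_pred (U : zopen iota) : {pred 'rV[F]_n} :=
  [pred v | `[< forall y, zset U y -> in_lattice y v >]].

Fact lat_zmod U : zmod_closed (lat_pred U).
Proof.
split=> [|f g].
  by apply/asboolP => y _; rewrite /in_lattice mul0mx; exact: integral_mx0.
move=> /asboolP fU /asboolP gU; apply/asboolP => y Uy; rewrite /in_lattice mulmxBl.
by apply: integral_mxB; [exact: fU|exact: gU].
Qed.

HB.instance Definition _ U := GRing.isZmodClosed.Build 'rV[F]_n (lat_pred U) (lat_zmod U).

Record lat_sec (U : zopen iota) := LatSec { lat_val : 'rV[F]_n; lat_valP : lat_val \in lat_pred U }.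

HB.instance Definition _ U := [isSub for @lat_val U].
HB.instance Definition _ U := [Choice of lat_sec U by <:].
HB.instance Definition _ U := [SubChoice_isSubZmodule of lat_sec U by <:].

Fact lat_scale_subproof (U : zopen iota) (a : reg U) (s : lat_sec U) :
  val a *: val s \in lat_pred U.
Proof.
apply/asboolP => y Uy; rewrite /in_lattice -scalemxAl; apply: integral_mxZ; first exact: reg_ge.
by have /asboolP h := valP s; exact: h.
Qed.

Definition lat_scale (U : zopen iota) (a : reg U) (s : lat_sec U) : lat_sec U :=
  LatSec (lat_scale_subproof a s).

Fact lat_scaleA U (a b : reg (zset U)) (s : lat_sec U) :
  lat_scale a (lat_scale b s) = lat_scale (a * b) s.
Proof. by apply: val_inj; rewrite /= scalerA. Qed.
Fact lat_scale1 U : left_id (1 : reg (zset U)) (@lat_scale U).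
Proof. by move=> s; apply: val_inj; rewrite /= scale1r. Qed.
Fact lat_scaleDr U : right_distributive (@lat_scale U) +%R.
Proof. by move=> a s t; apply: val_inj; rewrite /= scalerDr. Qed.
Fact lat_scaleDl U (s : lat_sec U) : {morph (@lat_scale U)^~ s : a b / a + b}.
Proof. by move=> a b; apply: val_inj; rewrite /= scalerDl. Qed.

HB.instance Definition _ (U : zopen iota) :=
  GRing.Zmodule_isLmodule.Build (reg U) (lat_sec U)
    (@lat_scaleA U) (@lat_scale1 U) (@lat_scaleDr U) (@lat_scaleDl U).

Fact lat_res_subproof (U V : zopen iota) (h : V `<=` U) (s : lat_sec U) :
  val s \in lat_pred V.
Proof. by apply/asboolP => x /h; have /asboolP h' := valP s; apply: h'. Qed.

Definition lat_res (U V : zopen iota) (h : V `<=` U) (s : lat_sec U) : lat_sec V :=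
  LatSec (lat_res_subproof h s).

Definition lat : omod iota.
Proof.
refine (@OMod _ _ _ (fun U => lat_sec U) lat_res _ _ _ _).
- by move=> *; apply: val_inj.
- by move=> *; apply: val_inj.
- by move=> *; apply: val_inj.
- by move=> *; apply: val_inj.
Defined.

End IntegralMatrices.

Section LatticeBundles.
Variables (k : finFieldType) (F : fieldType) (iota : {rmorphism k -> F}).
Hypotheses (hF : function_field iota) (hgeom : geometrically_irreducible iota).
Implicit Types (y : place iota) (U V W : zopen iota) (M N : omod iota).
Notation zopenI := (zopenI hF hgeom).

Section OneLattice.
Variables (n : nat) (G : bundle_data iota n).

Lemma lat_secP U (s : lat G U) y : zset U y -> in_lattice G y (val s).
Proof. by move=> Uy; have /asboolP h := valP s; exact: h. Qed.

Lemma lat_sec_exists U (v : 'rV[F]_n) : (forall y, zset U y -> in_lattice G y v) ->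
  exists s : lat G U, val s = v.
Proof. by move=> h; exists (LatSec (introT (asboolP _) h)). Qed.

Lemma lat_valD U (s t : lat G U) : val (s + t) = val s + val t. Proof. by []. Qed.
Lemma lat_valZ U (a : reg U) (s : lat G U) : val (a *: s) = val a *: val s. Proof. by []. Qed.
Lemma lat_val_sum U (I : Type) (r : seq I) (P : pred I) (s : I -> lat G U) :
  val (\sum_(i <- r | P i) s i) = \sum_(i <- r | P i) val (s i).
Proof. exact: (big_morph _ (@lat_valD U)). Qed.
Lemma lat_val_res U V (h : V `<=` U) (s : lat G U) : val (res h s) = val s.
Proof. by []. Qed.

Lemma lat_sheaf : is_sheaf (lat G).
Proof.
move=> U I W h cover t compat.
have [x Ux] := zopen_neq0 U; have [i0 _] := cover x Ux.
have tE i j : val (t i) = val (t j).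
  by have := congr1 val (compat i j (zopenI (W i) (W j)) (@zopenIl _ _ _ _ _ _ _) (@zopenIr _ _ _ _ _ _ _)).
have [|s sE] := @lat_sec_exists U (val (t i0)).
  move=> y /cover[i Wy]; rewrite (tE i0 i); exact: lat_secP.
exists s; split=> [i|s' hs']; first by apply: val_inj; rewrite /= -(tE i0 i) -sE.
by apply: val_inj; rewrite sE -(hs' i0).
Qed.

Lemma lattice_open : finite_set (~` [set y | G y = 1%:M]).
Proof. exact: local_basis_std. Qed.

Lemma in_lattice_open (v : 'rV[F]_n) : finite_set (~` [set y | in_lattice G y v]).
Proof.
apply: (@sub_finite_set _ _ (~` [set y | G y = 1%:M] `|` ~` [set y | integral_mx y v])).
  move=> y hy; apply: contrapT => /not_orP[/contrapT/= Gy /contrapT/= vy]; apply: hy.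
  by rewrite /in_lattice /= Gy invmx1 mulmx1.
by rewrite finite_setU; split; [exact: lattice_open|exact: integral_mx_open].
Qed.

Lemma lat_vector_bundle : vector_bundle n (lat G).
Proof.
split; first exact: lat_sheaf.
(* The rows of [G x] form a frame on this set: at x by definition, and elsewhere because the lattice
   is standard there and [G x] is invertible over the local ring. *)
move=> x; pose S : set (place iota) := [set x] `|`
  ([set y | G y = 1%:M] `&` ([set y | integral_mx y (G x)] `&` [set y | integral_mx y (invmx (G x))])).
have fS : finite_set (~` S).
  rewrite setCU setIC; apply: finite_setIl; rewrite !setCI !finite_setU.
  by split; [exact: lattice_open|split; exact: integral_mx_open].
pose V := zopen_of hF hgeom fS.
exists V; first by left.
have Gx := local_basis_unit G x.
have /choice[e eE] : forall i : 'I_n, exists s : lat G V, val s = row i (G x).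
  move=> i; apply: lat_sec_exists => y [->|[/= Gy [h _]]].
    by rewrite /in_lattice -row_mul mulmxV // => a b; rewrite mxE; exact: integral_mx1.
  by rewrite /in_lattice Gy invmx1 mulmx1 => a b; rewrite mxE; exact: h.
exists e => W h s.
have sum_e (a : 'I_n -> reg W) : val (\sum_i a i *: res h (e i)) = (\row_i val (a i)) *m G x.
  rewrite lat_val_sum mulmx_sum_row; apply: eq_bigr => i _.
  by rewrite lat_valZ lat_val_res eE mxE.
have /choice[a aE] : forall i : 'I_n, exists a : reg W, val a = (val s *m invmx (G x)) 0 i.
  move=> i; apply: reg_of_regular => y Wy; have := h y Wy => -[yx|[/= Gy [_ hi]]].
    by have e' : y = x := yx; subst y; exact: (lat_secP s Wy).
  have := lat_secP s Wy; rewrite /in_lattice Gy invmx1 mulmx1 => hs.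
  exact: integral_mxM.
have rowa : \row_i val (a i) = val s *m invmx (G x) by apply/rowP => i; rewrite mxE aE.
exists [ffun i => a i]; split.
  apply: val_inj; rewrite (sum_e (fun i => [ffun i => a i] i)).
  have -> : \row_i val ([ffun i => a i] i) = \row_i val (a i) by apply/rowP => i; rewrite !mxE ffunE.
  by rewrite rowa mulmxKV.
move=> b hb; apply/ffunP => i; rewrite ffunE; apply: val_inj.
have := congr1 val hb; rewrite (sum_e b) => /(congr1 (mulmx^~ (invmx (G x)))).
by rewrite mulmxK // -rowa => /rowP/(_ i); rewrite !mxE.
Qed.

End OneLattice.

Section NormalForm.
Variables (n : nat) (M : omod iota).
Hypotheses (sM : is_sheaf M) (U0 : zopen iota) (e : 'I_n -> M U0) (fe : frame e).

Let coord_spec U (s : M U) := fe (@zopenIr _ _ _ hF hgeom U U0) (res (@zopenIl _ _ _ hF hgeom U U0) s).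
(** The value of s at the generic point, in the basis given by the fixed frame e. It is computed
    over the intersection of U with U0 and does not depend on the open set used. *)
Definition coord U (s : M U) : 'rV[F]_n := \row_j val (projT1 (cid (coord_spec s)) j).

Lemma coordP U (s : M U) W (hU : W `<=` U) (h0 : W `<=` U0) (a : 'I_n -> reg W) :
  res hU s = \sum_i a i *: res h0 (e i) -> \row_i val (a i) = coord s.
Proof.
move=> sa; have hW := sub_zopenI hF hgeom hU h0.
rewrite /coord; case: cid => c [/= cE _].
have := congr1 (res hW) cE; rewrite (res_comp _ _ hU) res_sum.
under eq_bigr do rewrite resZ (res_comp _ _ h0).
move=> cE'; have [d [_ du]] := fe h0 (res hU s).
have ad : d = [ffun i => a i].
  by apply: du; rewrite sa; apply: eq_bigr => i _; rewrite ffunE.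
have cd : d = [ffun i => reg_res hW (c i)].
  by apply: du; rewrite cE'; apply: eq_bigr => i _; rewrite ffunE.
apply/rowP => i; rewrite !mxE.
by have /ffunP/(_ i) := etrans (esym ad) cd; rewrite !ffunE => ->.
Qed.

Lemma coord_exists U (s : M U) W (hU : W `<=` U) (h0 : W `<=` U0) :
  exists2 a : 'I_n -> reg W, res hU s = \sum_i a i *: res h0 (e i) & \row_i val (a i) = coord s.
Proof.
have [a [aE _]] := fe h0 (res hU s); exists a => //; exact: coordP aE.
Qed.

Lemma coord_res U V (h : V `<=` U) (s : M U) : coord (res h s) = coord s.
Proof.
have hV := @zopenIl _ _ _ hF hgeom V U0.
have hU : zopenI V U0 `<=` U by move=> y /hV/h.
have [a aE <-] := coord_exists (res h s) hV (@zopenIr _ _ _ hF hgeom V U0).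
apply: (coordP (hU := hU) (h0 := @zopenIr _ _ _ hF hgeom V U0)).
by rewrite -aE (res_comp _ _ hU).
Qed.

Lemma coord_linear U (a : reg U) (s t : M U) :
  coord (a *: s + t) = val a *: coord s + coord t.
Proof.
have hU := @zopenIl _ _ _ hF hgeom U U0; have h0 := @zopenIr _ _ _ hF hgeom U U0.
have [b bE <-] := coord_exists s hU h0; have [c cE <-] := coord_exists t hU h0.
have -> : val a *: \row_i val (b i) + \row_i val (c i) =
    \row_i val (reg_res hU a * b i + c i) by apply/rowP => i; rewrite !mxE.
apply/esym/coordP; rewrite resD resZ bE cE scaler_sumr -big_split /=.
by apply: eq_bigr => i _; rewrite scalerDl scalerA.
Qed.

Lemma coord0 U : coord (0 : M U) = 0.
Proof.
have := coord_linear (1 : reg U) (0 : M U) 0; rewrite scale1r addr0 /= scale1r.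
by move=> /eqP; rewrite -subr_eq subrr eq_sym => /eqP.
Qed.

Lemma coord_sum U (I : finType) (a : I -> reg U) (s : I -> M U) :
  coord (\sum_i a i *: s i) = \sum_i val (a i) *: coord (s i).
Proof.
have cD : {morph @coord U : s1 s2 / s1 + s2}.
  by move=> s1 s2; have := coord_linear 1 s1 s2; rewrite /= !scale1r.
rewrite (big_morph _ cD (coord0 U)); apply: eq_bigr => i _.
by have := coord_linear (a i) (s i) 0; rewrite coord0 !addr0.
Qed.

Lemma coord_basis i : coord (e i) = delta_mx 0 i.
Proof.
have h : U0 `<=` U0 by [].
have -> : delta_mx 0 i = \row_j val ((j == i)%:R : reg U0).
  by apply/rowP => j; rewrite !mxE eqxx /=; case: eqP.
apply/esym/(coordP (hU := h) (h0 := h)).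
rewrite (bigD1 i) //= eqxx scale1r big1 ?addr0 // => j /negPf->.
by rewrite scale0r.
Qed.

Hypothesis loc : forall x, exists2 U : zopen iota, zset U x & exists e : 'I_n -> M U, frame e.

(** Near each point the coefficients in a local frame are elements of F, determined by their
    restriction to any smaller open set, and on U0 the coordinates determine the section. *)
Lemma coord_inj U (s t : M U) : coord s = coord t -> s = t.
Proof.
move=> st; apply: sheaf_separated => // y Uy.
have [V Vy [f ff]] := loc y.
have hU := @zopenIl _ _ _ hF hgeom U V; have hV := @zopenIr _ _ _ hF hgeom U V.
exists (zopenI U V), hU; split=> //.
have [a [aE _]] := ff _ hV (res hU s); have [b [bE _]] := ff _ hV (res hU t).
pose W := zopenI (zopenI U V) U0.
have hW : W `<=` zopenI U V by exact: zopenIl.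
have h0 : W `<=` U0 by exact: zopenIr.
have hWU : W `<=` U by move=> z /hW/hU.
have hWV : W `<=` V by move=> z /hW/hV.
have [c cE cs] := coord_exists s hWU h0; have [d dE dt] := coord_exists t hWU h0.
have cd i : c i = d i.
  apply: val_inj; have := st; rewrite -cs -dt => /rowP/(_ i).
  by rewrite !mxE.
have stW : res hWU s = res hWU t by rewrite cE dE; under eq_bigr do rewrite cd.
have aW : res hWU s = \sum_i [ffun i => reg_res hW (a i)] i *: res hWV (f i).
  rewrite -(res_comp hU hW hWU) aE res_sum; apply: eq_bigr => i _.
  by rewrite resZ (res_comp _ _ hWV) ffunE.
have bW : res hWU s = \sum_i [ffun i => reg_res hW (b i)] i *: res hWV (f i).
  rewrite stW -(res_comp hU hW hWU) bE res_sum; apply: eq_bigr => i _.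
  by rewrite resZ (res_comp _ _ hWV) ffunE.
have [u [_ uu]] := ff _ hWV (res hWU s).
rewrite aE bE; apply: eq_bigr => i _; congr (_ *: _); apply: val_inj.
have /ffunP/(_ i) := etrans (esym (uu _ aW)) (uu _ bW).
by rewrite !ffunE => /(congr1 val).
Qed.

End NormalForm.

(** [coord] embeds M into the constant sheaf F^n, and the lattice at y is spanned by the coordinates
    of a frame near y. Taking the frame e itself at the points of U0 makes almost all lattices
    standard. *)
Lemma vector_bundle_lat n M : vector_bundle n M -> exists G : bundle_data iota n, oiso M (lat G).
Proof.
move=> [sM loc].
have [x0 _] := infinite_setN0 (infinite_places hF hgeom).
have [U0 _ [e fe]] := loc x0.
pose co U (s : M U) := coord fe s.
have rowco U (u : 'I_n -> M U) (a : 'I_n -> F) :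
    \sum_i a i *: co U (u i) = (\row_i a i) *m \matrix_i co U (u i).
  by rewrite mulmx_sum_row; apply: eq_bigr => i _; rewrite mxE rowK.
have locg y : exists (U : zopen iota) (f : 'I_n -> M U),
    [/\ zset U y, frame f & zset U0 y -> \matrix_i co U (f i) = 1%:M].
  have [h|h] := pselect (zset U0 y).
    exists U0, e; split=> // _; apply/row_matrixP => i.
    by rewrite rowK row1 /co coord_basis.
  by have [V Vy [f ff]] := loc y; exists V, f; split.
have /choice[D DP] : forall y, exists P : {U : zopen iota & 'I_n -> M U},
   [/\ zset (projT1 P) y, frame (projT2 P) & zset U0 y -> \matrix_i co _ (projT2 P i) = 1%:M].
  by move=> y; have [U [f h]] := locg y; exists (existT _ U f).
pose g y := \matrix_i co _ (projT2 (D y) i).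
have gu y : g y \in unitmx.
  have [Uy ff _] := DP y; set U := projT1 (D y) in Uy ff.
  have hU := @zopenIl _ _ _ hF hgeom U U0; have h0 := @zopenIr _ _ _ hF hgeom U U0.
  have /choice[B BE] : forall i, exists b : {ffun 'I_n -> reg (zopenI U U0)},
      res h0 (e i) = \sum_j b j *: res hU (projT2 (D y) j).
    by move=> i; have [b [bE _]] := ff _ hU (res h0 (e i)); exists b.
  suff : (\matrix_(i, j) val (B i j)) *m g y = 1%:M by case/mulmx1_unit.
  apply/row_matrixP => i; rewrite row_mul row1.
  have := congr1 (@co _) (BE i); rewrite /co coord_res coord_basis coord_sum => ->.
  under eq_bigr do rewrite coord_res.
  rewrite -/(co _ _) rowco; congr (_ *m _).
  by apply/rowP => j; rewrite !mxE.
have gstd : finite_set [set y | g y <> 1%:M].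
  apply: sub_finite_set (zopen_cofinite U0) => y /= gy Uy; apply: gy.
  by have [_ _] := DP y; exact.
pose G := BundleData gu gstd; exists G.
have coG U (s : M U) : forall y, zset U y -> in_lattice G y (co U s).
  move=> y Uy; have [Vy ff _] := DP y; set V := projT1 (D y) in Vy ff.
  have hU := @zopenIl _ _ _ hF hgeom U V; have hV := @zopenIr _ _ _ hF hgeom U V.
  have [b [bE _]] := ff _ hV (res hU s).
  have := congr1 (@co _) bE; rewrite /co coord_res coord_sum => ->.
  under eq_bigr do rewrite coord_res.
  rewrite -/(co _ _) rowco /in_lattice /= (mulmxK (gu y)) => i j; rewrite mxE.
  exact: (reg_ge (U := zopenI U V)).
pose phi U (s : M U) : lat G U := LatSec (introT (asboolP _) (coG U s)).
apply: (@oiso_bij _ _ _ _ _ phi).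
- by move=> U a s t; apply: val_inj; exact: coord_linear.
- by move=> U V h s; apply: val_inj; exact: coord_res.
- by move=> U s t /(congr1 val) /=; exact: coord_inj.
move=> U v.
have /choice[T TP] : forall y : {y | zset U y}, exists P : {W : zopen iota & M W},
    [/\ zset (projT1 P) (sval y), projT1 P `<=` U & co _ (projT2 P) = val v].
  move=> [y Uy]; have [Vy ff _] := DP y; set V := projT1 (D y) in Vy ff.
  pose S := (zset U `&` zset V) `&` [set z | integral_mx z (val v *m invmx (g y))].
  have fS : finite_set (~` S).
    by rewrite setCI finite_setU; split; [exact: cofiniteI|exact: integral_mx_open].
  pose W := zopen_of hF hgeom fS.
  have hU : W `<=` U by move=> z [[]].
  have hV : W `<=` V by move=> z [[]].
  have /choice[b bE] : forall i, exists b : reg W, val b = (val v *m invmx (g y)) 0 i.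
    by move=> i; apply: reg_of_regular => z [_]; exact.
  exists (existT _ W (\sum_i b i *: res hV (projT2 (D y) i))); split=> //=.
    by split=> //; exact: (lat_secP v Uy).
  rewrite /co coord_sum; under eq_bigr do rewrite coord_res.
  rewrite -/(co _ _) rowco -/(g y) (_ : \row_i _ = val v *m invmx (g y)); first exact: (mulmxKV (gu y)).
  by apply/rowP => i; rewrite mxE bE.
have hT i : projT1 (T i) `<=` U by have [] := TP i.
have [||s [sE _]] := sM U {y | zset U y} (fun i => projT1 (T i)) hT _ (fun i => projT2 (T i)).
- by move=> y Uy; exists (exist _ y Uy); have [] := TP (exist _ y Uy).
- move=> y z W hy hz; apply: (@coord_inj _ _ sM _ _ fe loc); rewrite !coord_res.
  by have [_ _] := TP y; have [_ _] := TP z; rewrite /co => -> ->.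
exists s; apply: val_inj => /=.
have [x Ux] := zopen_neq0 U; have [_ _ <-] := TP (exist _ x Ux).
by rewrite /co -(sE (exist _ x Ux)) coord_res.
Qed.

End LatticeBundles.

(** * Morphisms of lattices and twists *)

Section Transport.
Variables (k : finFieldType) (F : fieldType) (iota : {rmorphism k -> F}).
Implicit Types (x y : place iota) (U V W : zopen iota) (M N L P : omod iota).

Lemma sheaf_oiso M N : oiso M N -> is_sheaf M -> is_sheaf N.
Proof.
move=> [j [j' [jK j'K]]] sM U I W h cover t compat.
have [i1 i2 V hi hj|s [sE su]] := sM U I W h cover (fun i => j' _ (t i)).
  by rewrite -!hmap_res (compat i1 i2 V hi hj).
exists (j U s); split=> [i|s' hs']; first by rewrite -hmap_res sE j'K.
rewrite (su (j' U s')) ?j'K // => i.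
by rewrite -hmap_res hs'.
Qed.

Lemma frame_oiso n M N (j : ohom M N) (j' : ohom N M) U (e : 'I_n -> M U) :
  (forall U, cancel (j U) (j' U)) -> (forall U, cancel (j' U) (j U)) ->
  frame e -> frame (fun i => j U (e i)).
Proof.
move=> jK j'K fe V h s; have [a [aE au]] := fe V h (j' V s).
have sum_j (b : 'I_n -> reg V) : \sum_i b i *: res h (j U (e i)) = j V (\sum_i b i *: res h (e i)).
  by rewrite linear_sum; apply: eq_bigr => i _; rewrite linearZ hmap_res.
exists a; split=> [|b bE]; first by rewrite sum_j -aE j'K.
by apply: au; rewrite bE sum_j jK.
Qed.

Lemma vector_bundle_oiso n M N : oiso M N -> vector_bundle n M -> vector_bundle n N.
Proof.
move=> MN [sM loc]; split; first exact: sheaf_oiso MN sM.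
move=> y; have [U Uy [e fe]] := loc y; exists U => //.
have [j [j' [jK j'K]]] := MN.
by exists (fun i => j U (e i)); exact: (frame_oiso jK j'K).
Qed.

Definition tensor M L N := exists b : bihom M L N, is_tensor b.

Lemma tensor_unique M L N N' : tensor M L N -> tensor M L N' -> oiso N N'.
Proof.
move=> [b [sN bu]] [b' [sN' bu']].
have [p [pb _]] := bu N' b' sN'; have [q [qb _]] := bu' N b sN.
exists p, q; split=> U s.
  have [r [_ ru]] := bu N b sN.
  rewrite -[LHS]/(ohom_comp q p U s) -[RHS]/(ohom_id N U s).
  rewrite (ru (ohom_comp q p)) ?(ru (ohom_id N)) // => V t u.
  by rewrite /= /linear_fun pb qb.
have [r [_ ru]] := bu' N' b' sN'.
rewrite -[LHS]/(ohom_comp p q U s) -[RHS]/(ohom_id N' U s).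
rewrite (ru (ohom_comp p q)) ?(ru (ohom_id N')) // => V t u.
by rewrite /= /linear_fun qb pb.
Qed.

Section Bihom.
Variables (M M' L L' N N' : omod iota) (m : ohom M' M) (l : ohom L' L) (i : ohom N N').
Variable b : bihom M L N.
Let c U (s : M' U) (t : L' U) : N' U := i U (b U (m U s) (l U t)).
Fact bihom_compDl U s s' t : @c U (s + s') t = c s t + c s' t.
Proof. by rewrite /c linearD bmapDl linearD. Qed.
Fact bihom_compDr U s t t' : @c U s (t + t') = c s t + c s t'.
Proof. by rewrite /c linearD bmapDr linearD. Qed.
Fact bihom_compZl U (a : reg U) s t : @c U (a *: s) t = a *: c s t.
Proof. by rewrite /c linearZ bmapZl linearZ. Qed.
Fact bihom_compZr U (a : reg U) s t : @c U s (a *: t) = a *: c s t.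
Proof. by rewrite /c linearZ bmapZr linearZ. Qed.
Fact bihom_comp_res U V (h : V `<=` U) s t : c (res h s) (res h t) = res h (@c U s t).
Proof. by rewrite /c !hmap_res bmap_res hmap_res. Qed.
Definition bihom_comp : bihom M' L' N' :=
  Bihom bihom_compDl bihom_compDr bihom_compZl bihom_compZr bihom_comp_res.
End Bihom.

Lemma tensor_oiso M M' L L' N N' : oiso M M' -> oiso L L' -> oiso N N' ->
  tensor M L N -> tensor M' L' N'.
Proof.
move=> [m [m' [mK m'K]]] [l [l' [lK l'K]]] iN [b [sN bu]].
have [i [i' [iK i'K]]] := iN.
exists (bihom_comp m' l' i b); split; first exact: sheaf_oiso iN sN.
move=> P c sP.
have [p [pb pu]] := bu P (bihom_comp m l (ohom_id P) c) sP.
exists (ohom_comp p i'); split=> [U s t|q qb U s].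
  by rewrite /= /linear_fun /= iK pb /= /linear_fun m'K l'K.
have := pu (ohom_comp q i) _ U (i' U s); rewrite /= /linear_fun i'K => -> // V u v.
by rewrite /= /linear_fun -qb /= mK lK.
Qed.

End Transport.

Section LatticeMorphisms.
Variables (k : finFieldType) (F : fieldType) (iota : {rmorphism k -> F}).
Hypotheses (hF : function_field iota) (hgeom : geometrically_irreducible iota).
Implicit Types (x y : place iota) (U V W : zopen iota) (M N L P : omod iota).
Implicit Types (A B D E : divisor iota).
Notation zopenI := (zopenI hF hgeom).

Lemma bundle_data_eq n (G H : bundle_data iota n) : (forall y, G y = H y) -> G = H.
Proof.
case: G => a a0 a1; case: H => b b0 b1 /= /funext ab; subst b.
by congr BundleData; exact: Prop_irrelevance.
Qed.

(** A morphism is determined at the generic point: the rows of C are the images of the standard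
    basis, which are sections wherever G is standard. *)
Lemma lat_hom m n (G : bundle_data iota m) (H : bundle_data iota n) (j : ohom (lat G) (lat H)) :
  exists C : 'M[F]_(m, n), forall U (s : lat G U), val (j U s) = val s *m C.
Proof.
pose U1 := zopen_of hF hgeom (lattice_open G).
have /choice[e eE] : forall i : 'I_m, exists s : lat G U1, val s = delta_mx 0 i.
  move=> i; apply: lat_sec_exists => y /= Gy; rewrite /in_lattice Gy invmx1 mulmx1.
  by move=> a b; rewrite mxE; case: (_ && _); rewrite ?ord_ge1 ?ord_ge0.
exists (\matrix_i val (j U1 (e i))) => U s.
pose W := zopenI U U1.
have hU : W `<=` U by exact: zopenIl.
have h1 : W `<=` U1 by exact: zopenIr.
have /choice[a aE] : forall i, exists a : reg W, val a = val s 0 i.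
  move=> i; apply: reg_of_regular => y [Uy /= Gy].
  by have := lat_secP s Uy; rewrite /in_lattice Gy invmx1 mulmx1; exact.
have sE : res hU s = \sum_i a i *: res h1 (e i).
  apply: val_inj; rewrite lat_val_sum lat_val_res [LHS]row_sum_delta.
  by apply: eq_bigr => i _; rewrite lat_valZ lat_val_res eE aE.
rewrite -(lat_val_res hU (j U s)) -hmap_res sE linear_sum lat_val_sum mulmx_sum_row.
by apply: eq_bigr => i _; rewrite linearZ lat_valZ hmap_res lat_val_res rowK aE.
Qed.

Lemma lat_hom_local m n (G : bundle_data iota m) (H : bundle_data iota n)
  (j : ohom (lat G) (lat H)) C : (forall U (s : lat G U), val (j U s) = val s *m C) ->
  forall y v, in_lattice G y v -> in_lattice H y (v *m C).
Proof.
move=> jC y v vy.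
pose U := zopen_of hF hgeom (in_lattice_open hF G v).
have [s sE] := @lat_sec_exists _ _ _ _ G U v (fun y h => h).
by rewrite -sE -jC; apply: (lat_secP (U := U)).
Qed.

Lemma lat_hom_of_mx m n (G : bundle_data iota m) (H : bundle_data iota n) (C : 'M[F]_(m, n)) :
  (forall y v, in_lattice G y v -> in_lattice H y (v *m C)) ->
  exists j : ohom (lat G) (lat H), forall U (s : lat G U), val (j U s) = val s *m C.
Proof.
move=> GH.
pose f U (s : lat G U) : lat H U :=
  LatSec (introT (asboolP _) (fun y Uy => GH y _ (lat_secP s Uy))).
have fl U : linear (@f U).
  by move=> a s t; apply: val_inj; rewrite /= mulmxDl -scalemxAl.
have fr U V (h : V `<=` U) s : f V (res h s) = res h (f U s) by apply: val_inj.
by exists (ohom_of fl fr).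
Qed.

Lemma lat_hom_eq m n (G : bundle_data iota m) (C D : 'M[F]_(m, n)) :
  (forall U (s : lat G U), val s *m C = val s *m D) -> C = D.
Proof.
move=> CD; apply/row_matrixP => i; rewrite !rowE.
pose U := zopen_of hF hgeom (in_lattice_open hF G (delta_mx 0 i)).
have [s sE] := @lat_sec_exists _ _ _ _ G U (delta_mx 0 i) (fun y h => h).
by rewrite -sE.
Qed.

Lemma lat_oiso n (G H : bundle_data iota n) (C : 'M[F]_n) : C \in unitmx ->
  (forall y v, in_lattice G y v <-> in_lattice H y (v *m C)) -> oiso (lat G) (lat H).
Proof.
move=> Cu GH.
have [j jE] := @lat_hom_of_mx _ _ G H C (fun y v => proj1 (GH y v)).
have [j' j'E] : exists j' : ohom (lat H) (lat G), forall U s, val (j' U s) = val s *m invmx C.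
  by apply: lat_hom_of_mx => y v; rewrite GH mulmxKV.
exists j, j'; split=> U s; apply: val_inj; first by rewrite j'E jE mulmxK.
by rewrite jE j'E mulmxKV.
Qed.

Lemma oiso_lat n (G H : bundle_data iota n) : oiso (lat G) (lat H) ->
  exists2 C : 'M[F]_n, C \in unitmx &
  forall y v, in_lattice G y v <-> in_lattice H y (v *m C).
Proof.
move=> [j [j' [jK j'K]]].
have [C jC] := lat_hom j; have [D jD] := lat_hom j'.
have CD : C *m D = 1%:M.
  by apply: (@lat_hom_eq _ _ G) => U s; rewrite mulmxA -jC -jD jK mulmx1.
exists C; first by case/mulmx1_unit: CD.
move=> y v; split; first exact: (lat_hom_local jC).
by move=> /(lat_hom_local jD); rewrite -mulmxA CD mulmx1.
Qed.

Definition twist_basis n (A : divisor iota) (G : bundle_data iota n) y : 'M[F]_n :=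
  unif y ^ (- coeff y A) *: G y.

Fact twist_basis_unit n A (G : bundle_data iota n) y : twist_basis A G y \in unitmx.
Proof. by rewrite /twist_basis unitmxZ ?local_basis_unit // unitfE expfz_neq0 ?unif_neq0. Qed.

Fact twist_basis_std n A (G : bundle_data iota n) :
  finite_set [set y | twist_basis A G y <> 1%:M].
Proof.
apply: (@sub_finite_set _ _ ([set y : place iota | coeff y A != 0] `|` [set y | G y <> 1%:M])).
  move=> y /=; apply: contra_notP => /not_orP[/negP/negPn/eqP Ay /contrapT Gy].
  by rewrite /twist_basis Ay Gy oppr0 expr0z scale1r.
by rewrite finite_setU; split; [exact: finite_coeff|exact: local_basis_std].
Qed.

Definition twist n A (G : bundle_data iota n) : bundle_data iota n :=
  BundleData (twist_basis_unit A G) (twist_basis_std A G).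

Lemma in_lattice_scale n (G : bundle_data iota n) y f v : f \in ord_ge y 0 ->
  in_lattice G y v -> in_lattice G y (f *: v).
Proof. by move=> hf hv; rewrite /in_lattice -scalemxAl; exact: integral_mxZ. Qed.

Lemma in_lattice_unif_twist n A (G : bundle_data iota n) y v :
  in_lattice (twist A G) y v <-> in_lattice G y (unif y ^ coeff y A *: v).
Proof.
rewrite /in_lattice /= /twist_basis invmxZ; last exact: (twist_basis_unit A G y).
by rewrite invr_expz opprK -scalemxAr -scalemxAl.
Qed.

Lemma in_lattice_twist n A (G : bundle_data iota n) y f v : f != 0 -> y f = coeff y A ->
  in_lattice (twist A G) y v <-> in_lattice G y (f *: v).
Proof.
move=> f0 yf; rewrite in_lattice_unif_twist.
have u0 : unif y ^ coeff y A != 0 by rewrite expfz_neq0 ?unif_neq0.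
split=> h.
  rewrite -[f](divfK u0) -scalerA; apply: in_lattice_scale => //.
  by rewrite ord_geE ?mulf_neq0 ?invr_eq0 // ordM ?invr_eq0 // ordV ord_unifX yf subrr.
rewrite -[unif y ^ _](divfK f0) -scalerA; apply: in_lattice_scale => //.
by rewrite ord_geE ?mulf_neq0 ?invr_eq0 // ordM ?invr_eq0 // ordV ord_unifX yf subrr.
Qed.

Lemma twistD n A B (G : bundle_data iota n) : twist A (twist B G) = twist (A + B) G.
Proof.
apply: bundle_data_eq => y; rewrite /= /twist_basis /= /twist_basis scalerA.
by rewrite -expfzDr ?unif_neq0 // coeffD opprD.
Qed.

Lemma twist0 n (G : bundle_data iota n) : twist 0 G = G.
Proof. by apply: bundle_data_eq => y; rewrite /= /twist_basis coeff0 oppr0 expr0z scale1r. Qed.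

Fact trivial_unit n : forall y : place iota, (1%:M : 'M[F]_n) \in unitmx.
Proof. by move=> y; exact: unitmx1. Qed.
Fact trivial_std n : finite_set [set y : place iota | (1%:M : 'M[F]_n) <> 1%:M].
Proof. by rewrite (_ : [set _ | _] = set0) //; apply/seteqP; split. Qed.
Definition trivial_bundle n : bundle_data iota n := BundleData (@trivial_unit n) (@trivial_std n).

Lemma in_lattice_trivial n y v : in_lattice (trivial_bundle n) y v <-> integral_mx y v.
Proof. by rewrite /in_lattice /= invmx1 mulmx1. Qed.

Lemma in_lattice_line A y (f : F) :
  in_lattice (twist A (trivial_bundle 1)) y (const_mx f) <-> f \in ord_ge y (- coeff y A).
Proof.
rewrite in_lattice_unif_twist in_lattice_trivial [_ \in _]ord_ge_unif opprK mulrC.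
split=> [/(_ 0 0)|h i j]; first by rewrite !mxE.
by rewrite !mxE.
Qed.

Lemma line_bundle_lat A : oiso (line_bundle A) (lat (twist A (trivial_bundle 1))).
Proof.
have inl U (s : line_bundle A U) y : zset U y ->
    in_lattice (twist A (trivial_bundle 1)) y (const_mx (val s)).
  by move=> Uy; apply/in_lattice_line; have /asboolP := valP s; exact.
apply: (@oiso_bij _ _ _ _ _ (fun U (s : line_bundle A U) =>
    LatSec (introT (asboolP _) (inl U s)) : lat (twist A (trivial_bundle 1)) U)).
- by move=> U a s t; apply: val_inj; apply/rowP => i; rewrite !mxE.
- by move=> U V h s; apply: val_inj.
- by move=> U s t /(congr1 val)/rowP/(_ 0); rewrite !mxE => /val_inj.
- move=> U t; have tE : val t = const_mx (val t 0 0).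
    by apply/rowP => i; rewrite mxE [i]zmodp.ord1.
  have tP : val t 0 0 \in lb_pred A U.
    apply/asboolP => y Uy; apply/in_lattice_line; rewrite -tE; exact: lat_secP.
  by exists (LbSec tP); apply: val_inj; rewrite /= -tE.
Qed.

Lemma lat1_line (G : bundle_data iota 1) :
  exists2 A, (forall y, coeff y A = - y (\det (G y))) & oiso (lat G) (line_bundle A).
Proof.
have g0 y : \det (G y) != 0 by have := local_basis_unit G y; rewrite unitmxE unitfE.
have [|A AE] := @divisor_exists _ _ _ (fun y => - y (\det (G y))).
  apply: sub_finite_set (local_basis_std G) => y /= + Gy; rewrite Gy.
  by rewrite det1 (@Defs.ord1 k F iota y) oppr0 eqxx.
exists A => //; apply: oiso_trans (oiso_sym (line_bundle_lat A)).
apply: (@lat_oiso _ _ _ 1%:M); first exact: unitmx1.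
move=> y v; rewrite mulmx1.
have -> : v = const_mx (v 0 0) by apply/rowP => i; rewrite mxE [i]zmodp.ord1.
set f := v 0 0; pose g := G y 0 0.
have detE : \det (G y) = g by rewrite det_mx11.
have Gy := g0 y; rewrite detE in Gy.
have GyE : G y = g%:M by rewrite [LHS]mx11_scalar.
rewrite in_lattice_line AE opprK detE /in_lattice GyE invmx_scalar.
have fgE : (f / g \in ord_ge y 0) = (f \in ord_ge y (y g)).
  have [->|f0] := eqVneq f 0; first by rewrite mul0r !ord_ge0.
  by rewrite !ord_geE ?mulf_neq0 ?invr_eq0 // ordM ?invr_eq0 // ordV subr_ge0.
rewrite -fgE; split=> [/(_ 0 0)|h i j].
  by rewrite mxE big_ord1 !mxE eqxx mulr1n.
by rewrite mxE big_ord1 !mxE [j]zmodp.ord1 eqxx mulr1n.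
Qed.

Lemma vector_bundle1 L : vector_bundle 1 L -> exists A, oiso L (line_bundle A).
Proof.
move=> /(vector_bundle_lat hF hgeom)[G LG]; have [A _ GA] := lat1_line G.
by exists A; exact: oiso_trans GA.
Qed.

Lemma line_bundle_vector A : vector_bundle 1 (line_bundle A).
Proof.
apply: vector_bundle_oiso (oiso_sym (line_bundle_lat A)) _; exact: lat_vector_bundle.
Qed.

(** * The tensor product of a lattice bundle with L_A *)

Section LatticeTensor.
Variables (n : nat) (G : bundle_data iota n) (A : divisor iota).

Lemma scale_in_twist y f v : f \in ord_ge y (- coeff y A) -> in_lattice G y v ->
  in_lattice (twist A G) y (f *: v).
Proof.
move=> hf hv; rewrite in_lattice_unif_twist scalerA; apply: in_lattice_scale => //.
by move: hf; rewrite ord_ge_unif opprK mulrC.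
Qed.

Definition lat_tensor_sec U (s : lat G U) (t : line_bundle A U) : lat (twist A G) U :=
  LatSec (introT (asboolP _) (fun y Uy =>
    scale_in_twist (elimT (asboolP _) (valP t) y Uy) (lat_secP s Uy))).
Local Notation tsec := (@lat_tensor_sec _).

Fact lat_tensor_Dl U (s s' : lat G U) (t : line_bundle A U) : tsec (s + s') t = tsec s t + tsec s' t.
Proof. by apply: val_inj; rewrite /= scalerDr. Qed.
Fact lat_tensor_Dr U (s : lat G U) (t t' : line_bundle A U) : tsec s (t + t') = tsec s t + tsec s t'.
Proof. by apply: val_inj; rewrite /= scalerDl. Qed.
Fact lat_tensor_Zl U (a : reg U) (s : lat G U) (t : line_bundle A U) : tsec (a *: s) t = a *: tsec s t.
Proof. by apply: val_inj; rewrite /= !scalerA mulrC. Qed.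
Fact lat_tensor_Zr U (a : reg U) (s : lat G U) (t : line_bundle A U) : tsec s (a *: t) = a *: tsec s t.
Proof. by apply: val_inj; rewrite /= !scalerA. Qed.
Fact lat_tensor_res U V (h : V `<=` U) (s : lat G U) (t : line_bundle A U) :
  tsec (res h s) (res h t) = res h (tsec s t).
Proof. by apply: val_inj. Qed.
Definition lat_tensor : bihom (lat G) (line_bundle A) (lat (twist A G)) :=
  Bihom lat_tensor_Dl lat_tensor_Dr lat_tensor_Zl lat_tensor_Zr lat_tensor_res.

Lemma lat_tensorE U (s : lat G U) (t : line_bundle A U) : val (lat_tensor _ s t) = val t *: val s.
Proof. by []. Qed.

(** Locally a section of the twist is a pure tensor whose second factor t generates L_A; t is a
    power of a uniformizer, on the open set where it has no zeros or poles relative to A. *)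
Lemma twist_split_local U (s : lat (twist A G) U) y : zset U y ->
  exists (W : zopen iota) (h : W `<=` U) (s' : lat G W) (t : line_bundle A W),
  [/\ zset W y, forall z, zset W z -> z (val t) = - coeff z A, val t != 0
    & res h s = lat_tensor _ s' t].
Proof.
move=> Uy; pose f := unif y ^ (- coeff y A).
have f0 : f != 0 by rewrite expfz_neq0 ?unif_neq0.
have fV : f^-1 != 0 by rewrite invr_eq0.
have [E EE] := principal_exists hF f.
pose S := zset U `&` [set z | coeff z (E + A) = 0].
have fS : finite_set (~` S).
  rewrite setCI finite_setU; split; first exact: zopen_cofinite.
  by apply: sub_finite_set (finite_coeff (E + A)) => z /= /eqP.
pose W := zopen_of hF hgeom fS.
have h : W `<=` U by move=> z [].
have zf z : zset W z -> z f = - coeff z A.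
  by move=> [_ /= /eqP]; rewrite coeffD EE addr_eq0 => /eqP.
have [s' s'E] : exists s' : lat G W, val s' = f^-1 *: val s.
  apply: lat_sec_exists => z Wz; apply/(@in_lattice_twist _ A G z f^-1) => //.
    by rewrite ordV (zf _ Wz) opprK.
  exact: (lat_secP s (h _ Wz)).
have tP : f \in lb_pred A W by apply/asboolP => z /zf <-; exact: ord_ge_self.
exists W, h, s', (LbSec tP); split=> //.
  by split=> //=; rewrite coeffD EE /f ord_unifX addNr.
by apply: val_inj; rewrite /= s'E scalerA divff // scale1r.
Qed.

(** The factoring map is forced on pure tensors, and sections are locally of this form, so it is
    defined by gluing. [cE] shows that c depends only on the product of the two factors, by moving a
    regular function across. *)
Lemma lat_tensorP : is_tensor lat_tensor.
Proof.
split; first exact: lat_sheaf.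
move=> P c sP.
have cE U (s : lat G U) (t : line_bundle A U) (s' : lat G U) (t' : line_bundle A U) :
    val t' != 0 -> (forall z, zset U z -> z (val t') = - coeff z A) ->
    lat_tensor _ s t = lat_tensor _ s' t' -> c U s t = c U s' t'.
  move=> t0 tA; have [a aE] : exists a : reg U, val a = val t / val t'.
    apply: reg_of_regular => z Uz; have := elimT (asboolP _) (valP t) z Uz.
    rewrite -(tA _ Uz) -[0](subrr (z (val t'))) -[- z _]ordV => ht.
    by apply: ord_geM => //; exact: ord_ge_self.
  have -> : t = a *: t' by apply: val_inj; rewrite /= aE divfK.
  move=> /(congr1 val); rewrite !lat_tensorE /= -scalerA => ss'.
  rewrite bmapZr -bmapZl; congr (c U _ t'); apply: val_inj.
  by apply: (scalerI t0); rewrite -ss' /= !scalerA mulrC.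
pose glued U (s : lat (twist A G) U) (r : P U) := forall (W : zopen iota) (h : W `<=` U)
  (s' : lat G W) (t : line_bundle A W), res h s = lat_tensor _ s' t -> res h r = c W s' t.
have glued_uniq U s (r r' : P U) : glued U s r -> glued U s r' -> r = r'.
  move=> hr hr'; apply: sheaf_separated => // y Uy.
  have [W [h [s' [t [Wy _ _ e]]]]] := twist_split_local s Uy.
  by exists W, h; split=> //; rewrite (hr _ _ _ _ e) (hr' _ _ _ _ e).
have glued_ex U s : exists r : P U, glued U s r.
  pose I := {W : zopen iota | exists (h : W `<=` U) (s' : lat G W) (t : line_bundle A W),
    [/\ forall z, zset W z -> z (val t) = - coeff z A, val t != 0 & res h s = lat_tensor _ s' t]}.
  have hI (i : I) : sval i `<=` U by case: i => W [].
  have uex : forall i : I, exists u : lat G (sval i) * line_bundle A (sval i),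
      [/\ forall z, zset (sval i) z -> z (val u.2) = - coeff z A, val u.2 != 0
        & res (hI i) s = lat_tensor _ u.1 u.2].
    move=> i; move: (hI i); case: i => W [h [s' [t hst]]] h'.
    by exists (s', t); rewrite (Prop_irrelevance h' h).
  pose u i := projT1 (cid (uex i)); 
  have uP i : [/\ forall z, zset (sval i) z -> z (val (u i).2) = - coeff z A, val (u i).2 != 0
      & res (hI i) s = lat_tensor _ (u i).1 (u i).2] by rewrite /u; case: cid.
  have [||r [rE _]] := sP U I (fun i => sval i) hI _ (fun i => c _ (u i).1 (u i).2).
  - move=> y Uy; have [W [h [s' [t [Wy h1 h2 h3]]]]] := twist_split_local s Uy.
    have hW : exists (h : W `<=` U) (s' : lat G W) (t : line_bundle A W),
      [/\ forall z, zset W z -> z (val t) = - coeff z A, val t != 0 & res h s = lat_tensor _ s' t].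
      by exists h, s', t.
    by exists (exist _ W hW).
  - move=> i j V hi hj; rewrite -!bmap_res; have [i1 i2 i3] := uP i; have [j1 j2 j3] := uP j.
    apply: cE => //; first by move=> z Vz; apply: j1; exact: hj.
    by have := congr1 val i3; have := congr1 val j3; move=> /= e1 e2; apply: val_inj; rewrite /= -e1 -e2.
  exists r => W h s' t e; apply: sheaf_separated => // y Wy.
  have [V [hV [s'' [t' [Vy h1 h2 h3]]]]] := twist_split_local s (h _ Wy).
  have hi : exists (h : V `<=` U) (s' : lat G V) (t : line_bundle A V),
      [/\ forall z, zset V z -> z (val t) = - coeff z A, val t != 0 & res h s = lat_tensor _ s' t].
    by exists hV, s'', t'.
  pose i : I := exist _ V hi.
  have X1 : zopenI W V `<=` W by exact: zopenIl.
  have X2 : zopenI W V `<=` V by exact: zopenIr.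
  have X3 : zopenI W V `<=` U by move=> z /X1/h.
  exists (zopenI W V), X1; split=> //.
  rewrite (res_comp h X1 X3) -(res_comp (hI i) X2 X3) rE -!bmap_res.
  have [i1 i2 i3] := uP i; apply/esym/cE => //.
    by move=> z [_ Vz]; apply: i1.
  by have := congr1 val i3; have := congr1 val e; move=> /= e1 e2; apply: val_inj; rewrite /= -e1 -e2.
pose f0 U s := projT1 (cid (glued_ex U s)).
have f0P U s : glued U s (f0 U s) by rewrite /f0; case: cid.
have f0l U : linear (f0 U).
  move=> a s1 s2; apply: (glued_uniq U (a *: s1 + s2)) => //.
  move=> W h s' t e; apply: sheaf_separated => // y Wy.
  have [V1 [h1 [u1 [t1 [V1y A1 n1 e1]]]]] := twist_split_local s1 (h _ Wy).
  pose V := zopenI W V1.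
  have X1 : V `<=` W by exact: zopenIl.
  have X2 : V `<=` V1 by exact: zopenIr.
  have X3 : V `<=` U by move=> z /X1/h.
  exists V, X1; split=> //.
  have [u2 u2E] : exists u2 : lat G V, val u2 = (val t1)^-1 *: val s2.
    apply: lat_sec_exists => z Vz.
    apply/(@in_lattice_twist _ A G z (val t1)^-1); rewrite ?invr_eq0 //.
      by rewrite ordV A1 ?opprK //; exact: X2.
    by apply: (lat_secP s2); exact: X3.
  have e2 : res X3 s2 = lat_tensor _ u2 (res X2 t1).
    by apply: val_inj; rewrite /= u2E scalerA divff // scale1r.
  have e1' : res X3 s1 = lat_tensor _ (res X2 u1) (res X2 t1).
    by apply: val_inj; have := congr1 val e1.
  rewrite (res_comp h X1 X3) resD resZ (f0P _ _ _ _ _ _ e1') (f0P _ _ _ _ _ _ e2).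
  rewrite -bmapZl -bmapDl -bmap_res; apply/esym/cE => //.
    by move=> z Vz; apply: A1; exact: (X2 z Vz).
  have E1 : val t1 *: val u1 = val s1 by have := congr1 val e1; move=> /= ->.
  have E2 : val t1 *: val u2 = val s2 by rewrite u2E scalerA divff // scale1r.
  have := congr1 val e; rewrite /= => e'; apply: val_inj.
  rewrite /= -e' scalerDr E2 scalerA [_ * val a]mulrC -scalerA E1.
  by [].
have f0r U V (h : V `<=` U) s : f0 V (res h s) = res h (f0 U s).
  apply: (glued_uniq V (res h s)) => // W h' s' t e.
  have X : W `<=` U by move=> z /h'/h.
  by rewrite (res_comp h h' X); apply: f0P; apply: val_inj; have := congr1 val e.
exists (ohom_of f0l f0r); split=> [U s t|psi psiE U s].
  rewrite /= /linear_fun; apply: (glued_uniq U (lat_tensor _ s t)) => //.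
  move=> W h s' t' e; rewrite -bmap_res.
  have [t0|t0] := eqVneq (val t') 0.
    have -> : t' = 0 by apply: val_inj.
    have c0 V (s0 : lat G V) : c V s0 0 = 0.
      by have := bmapZr c 0 s0 (0 : line_bundle A V); rewrite !scale0r.
    have e0 : val t *: val s = 0 by have := congr1 val e; rewrite /= t0 scale0r.
    rewrite c0; move/eqP: e0; rewrite scaler_eq0 => /orP[] /eqP h0.
      by rewrite (_ : res h t = 0) ?c0 //; apply: val_inj.
    rewrite (_ : res h s = 0); last exact: val_inj.
    by have := bmapZl c 0 (0 : lat G W) (res h t); rewrite !scale0r.
  apply: sheaf_separated => // y Wy.
  have [V [hV [s'' [t'' [Vy A2 n2 e2]]]]] := twist_split_local (lat_tensor _ s' t') Wy.
  exists V, hV; split=> //; rewrite -!bmap_res.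
  have -> := cE _ (res hV (res h s)) (res hV (res h t)) s'' t'' n2 A2.
    by apply/esym/cE => //; rewrite -e2; apply: val_inj.
  by rewrite -e2 -e; apply: val_inj.
rewrite /= /linear_fun; apply: (glued_uniq U s); last exact: f0P.
by move=> W h s' t e; rewrite -hmap_res e psiE.
Qed.

End LatticeTensor.

End LatticeMorphisms.

(** * Projective classes and degrees *)

Section Classes.
Variables (k : finFieldType) (F : fieldType) (iota : {rmorphism k -> F}).
Hypotheses (hF : function_field iota) (hgeom : geometrically_irreducible iota).
Implicit Types (x y : place iota) (U V W : zopen iota) (M N L P : omod iota).
Implicit Types (A B D E : divisor iota) (G H : bundle_data iota 2).
Notation zopenI := (zopenI hF hgeom).

(** As line bundles are the L_A and tensoring with L_A is [twist A], projective classes become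
    isomorphism classes of lattices up to twist. *)
Lemma twist_equiv_lat n M M' (G : bundle_data iota n) : oiso M' (lat G) ->
  twist_equiv M M' <-> exists A, oiso M (lat (twist A G)).
Proof.
move=> MG; split=> [[L /(vector_bundle1 hF hgeom)[A LA] ML]|[A MA]].
  exists A; apply: (@tensor_unique _ _ _ (lat G) (line_bundle A)).
    exact: (tensor_oiso MG LA (oiso_refl M) ML).
  by exists (lat_tensor G A); exact: lat_tensorP.
exists (line_bundle A); first exact: line_bundle_vector.
apply: (@tensor_oiso _ _ _ (lat G) _ (line_bundle A) _ (lat (twist A G))).
- exact: oiso_sym.
- exact: oiso_refl.
- exact: oiso_sym.
- by exists (lat_tensor G A); exact: lat_tensorP.
Qed.

Definition cls (G : bundle_data iota 2) : bclass iota := pclass (lat G).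

Lemma pclassP M G N : oiso M (lat G) ->
  pclass M N <-> exists A, oiso N (lat (twist A G)).
Proof.
move=> MG; split=> [[_ /(twist_equiv_lat _ MG)]//|[A NA]]; split; last first.
  by apply/(twist_equiv_lat _ MG); exists A.
apply: vector_bundle_oiso (oiso_sym NA) _; exact: lat_vector_bundle.
Qed.

Lemma clsP G N : cls G N <-> exists A, oiso N (lat (twist A G)).
Proof. exact: pclassP (oiso_refl _). Qed.

Lemma pclass_cls M G : oiso M (lat G) -> pclass M = cls G.
Proof.
move=> MG; apply/funext => N; apply/propext.
by rewrite (pclassP N MG) clsP.
Qed.

Lemma cls_twist A G : cls (twist A G) = cls G.
Proof.
apply/funext => N; apply/propext; rewrite !clsP; split=> -[B NB].
  by exists (B + A); rewrite -twistD.
by exists (B - A); rewrite twistD subrK.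
Qed.

Lemma cls_oiso G H : oiso (lat G) (lat H) -> cls G = cls H.
Proof. exact: pclass_cls. Qed.

Lemma cls_eq G H : cls G = cls H -> exists A, oiso (lat G) (lat (twist A H)).
Proof.
move=> GH; have : cls G (lat G) by apply/clsP; exists 0; rewrite twist0; exact: oiso_refl.
by rewrite GH => /clsP.
Qed.

Lemma PBun2_cls G : PBun2 (cls G).
Proof. by exists (lat G) => //; exact: lat_vector_bundle. Qed.

Lemma PBun2_mem (v : bclass iota) N G : PBun2 v -> v N -> oiso N (lat G) -> v = cls G.
Proof.
move=> [M vM ->] + NG; have [H MH] := vector_bundle_lat hF hgeom vM.
rewrite (pclass_cls MH) => /clsP[A NA]; rewrite -(cls_twist A H); apply/esym/cls_oiso.
exact: oiso_trans (oiso_sym NG) NA.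
Qed.

Lemma cls_self G : cls G (lat G).
Proof. by apply/clsP; exists 0; rewrite twist0; exact: oiso_refl. Qed.

Lemma representative_cls G : exists A, oiso (representative (cls G)) (lat (twist A G)).
Proof.
apply/clsP; rewrite /representative; case: pselect => [h|[]]; first by case: cid.
by exists (lat G); exact: cls_self.
Qed.

Lemma in_lattice_inv n (G : bundle_data iota n) y (H : 'M[F]_n) v :
  G y *m H = 1%:M -> in_lattice G y v <-> integral_mx y (v *m H).
Proof.
move=> GH; have -> : H = invmx (G y); last by [].
by rewrite -[H]mul1mx -(mulVmx (local_basis_unit G y)) -mulmxA GH mulmx1.
Qed.

Definition mx2 (a b c d : F) : 'M[F]_2 :=
  \matrix_(i, j) (if i == 0 then if j == 0 then a else b else if j == 0 then c else d).
Definition rv2 (a b : F) : 'rV[F]_2 := \row_j (if j == 0 then a else b).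

Lemma rv2_eq (v : 'rV[F]_2) : v = rv2 (v 0 0) (v 0 1).
Proof.
by apply/rowP => j; rewrite mxE; case: j => -[|[|//]] h /=; congr (v 0 _); exact: val_inj.
Qed.

Lemma rv2_mul a b c d e f : rv2 a b *m mx2 c d e f = rv2 (a * c + b * e) (a * d + b * f).
Proof.
apply/rowP => j; rewrite !mxE !big_ord_recl big_ord0 addr0 !mxE /=.
by case: (j == 0).
Qed.

Lemma mx2_mul a b c d a' b' c' d' : mx2 a b c d *m mx2 a' b' c' d' =
  mx2 (a * a' + b * c') (a * b' + b * d') (c * a' + d * c') (c * b' + d * d').
Proof.
apply/matrixP => i j; rewrite !mxE !big_ord_recl big_ord0 addr0 !mxE /=.
by case: (i == 0); case: (j == 0).
Qed.

Lemma mx2_1 : mx2 1 0 0 1 = 1%:M.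
Proof. by apply/matrixP => -[[|[|]] // hi] [[|[|]] // hj]; rewrite !mxE. Qed.

Lemma det_mx2 a b c d : \det (mx2 a b c d) = a * d - b * c.
Proof.
rewrite (expand_det_row _ 0) !big_ord_recl big_ord0 /cofactor !det_mx11 !mxE /=.
by rewrite expr0 mul1r addr0 expr1 mulN1r mulrN.
Qed.

Lemma integral_rv2 y a b : integral_mx y (rv2 a b) <-> a \in ord_ge y 0 /\ b \in ord_ge y 0.
Proof.
split=> [h|[ha hb] i j]; last by rewrite mxE; case: (_ == _).
by have := h 0 0; have := h 0 1; rewrite !mxE.
Qed.

Fact diag_unit A B y : mx2 (unif y ^ (- coeff y A)) 0 0 (unif y ^ (- coeff y B)) \in unitmx.
Proof.
by rewrite unitmxE unitfE det_mx2 mulr0 subr0 mulf_neq0 // expfz_neq0 ?unif_neq0.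
Qed.
Fact diag_std A B :
  finite_set [set y : place iota | mx2 (unif y ^ (- coeff y A)) 0 0 (unif y ^ (- coeff y B)) <> 1%:M].
Proof.
apply: (@sub_finite_set _ _ ([set y : place iota | coeff y A != 0] `|` [set y : place iota | coeff y B != 0])).
  move=> y /=; apply: contra_notP => /not_orP[/negP/negPn/eqP-> /negP/negPn/eqP->].
  by rewrite oppr0 !expr0z mx2_1.
by rewrite finite_setU; split; exact: finite_coeff.
Qed.
Definition diag_bundle A B : bundle_data iota 2 := BundleData (diag_unit A B) (diag_std A B).

Lemma in_lattice_diag A B y a b : in_lattice (diag_bundle A B) y (rv2 a b) <->
  a \in ord_ge y (- coeff y A) /\ b \in ord_ge y (- coeff y B).
Proof.
rewrite (@in_lattice_inv _ _ _ (mx2 (unif y ^ coeff y A) 0 0 (unif y ^ coeff y B))).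
  rewrite rv2_mul !mulr0 addr0 add0r integral_rv2 [in X in _ <-> X]ord_ge_unif opprK.
  by rewrite [in X in _ <-> X](ord_ge_unif y (- coeff y B)) opprK.
by rewrite mx2_mul !mulr0 !mul0r !addr0 !add0r -!expfzDr ?unif_neq0 // !addNr !expr0z mx2_1.
Qed.

Lemma twist_diag A B C : twist C (diag_bundle A B) = diag_bundle (A + C) (B + C).
Proof.
apply: bundle_data_eq => y; rewrite /= /twist_basis /=; apply/matrixP => i j; rewrite !mxE.
by case: (i == 0); case: (j == 0); rewrite ?mulr0 // -expfzDr ?unif_neq0 // -opprD coeffD addrC.
Qed.

Lemma direct_sum_lat D : oiso (direct_sum (line_bundle D) (@structure_sheaf k F iota)) (lat (diag_bundle D 0)).
Proof.
have inl U (s : line_bundle D U * structure_sheaf iota U) y : zset U y ->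
    in_lattice (diag_bundle D 0) y (rv2 (val s.1) (val (s.2 : reg U))).
  move=> Uy; apply/in_lattice_diag; rewrite coeff0 oppr0; split; last exact: reg_ge.
  by have /asboolP := valP s.1; exact.
pose f U (s : direct_sum (line_bundle D) (structure_sheaf iota) U) : lat (diag_bundle D 0) U :=
  LatSec (introT (asboolP _) (inl U s)).
apply: (@oiso_bij _ _ _ _ _ f).
- move=> U a s t; apply: val_inj; apply/rowP => i; rewrite !mxE.
  by case: ifP.
- by move=> U V h s; apply: val_inj.
- move=> U [s1 s2] [t1 t2] /(congr1 val)/rowP h.
  by have := h 0; have := h 1; rewrite !mxE /= => /val_inj -> /val_inj ->.
- move=> U t.
  have tP y : zset U y -> val t 0 0 \in ord_ge y (- coeff y D) /\ val t 0 1 \in ord_ge y 0.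
    move=> Uy; have := lat_secP t Uy; rewrite [val t]rv2_eq => /in_lattice_diag.
    by rewrite coeff0 oppr0 !mxE.
  have t0 : val t 0 0 \in lb_pred D U by apply/asboolP => y /tP[].
  have [t1 t1E] : exists a : reg U, val a = val t 0 1 by apply: reg_of_regular => y /tP[].
  by exists (LbSec t0, t1); apply: val_inj; rewrite /= t1E -rv2_eq.
Qed.

Lemma cc_cls D : cc D = cls (diag_bundle D 0).
Proof. exact: pclass_cls (direct_sum_lat D). Qed.

Section Degree.
Variables (n : nat) (G : bundle_data iota n).

Lemma det_basis_neq0 y : \det (G y) != 0.
Proof. by have := local_basis_unit G y; rewrite unitmxE unitfE. Qed.

Lemma det_divisor_exists : exists E, forall y, coeff y E = - y (\det (G y)).
Proof.
apply: divisor_exists; apply: sub_finite_set (local_basis_std G) => y /= + Gy.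
by rewrite Gy det1 (@Defs.ord1 k F iota y) oppr0 eqxx.
Qed.

Definition det_divisor : divisor iota := projT1 (cid det_divisor_exists).
Lemma coeff_det_divisor y : coeff y det_divisor = - y (\det (G y)).
Proof. by rewrite /det_divisor; case: cid. Qed.

Lemma det_integral y (A : 'M[F]_n) : integral_mx y A -> \det A \in ord_ge y 0.
Proof.
move=> hA; apply: ord_ge_sum => s _; apply: ord_geM0.
  by case: (perm.odd_perm s); rewrite ?expr1 ?expr0 ?ord_geNE ord_ge1.
elim/big_rec: _ => [|i z _ hz]; first exact: ord_ge1.
exact: ord_geM0.
Qed.

(** The frame and the local basis span the same lattice at x, so each is an integral multiple of the
    other. *)
Lemma frame_det V (e : 'I_n -> lat G V) x : frame e -> zset V x ->
  let T := \matrix_i val (e i) in \det T != 0 /\ x (\det T) = x (\det (G x)).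
Proof.
move=> fe Vx T.
have h1 : integral_mx x (T *m invmx (G x)).
  move=> i j; have -> : (T *m invmx (G x)) i j = (val (e i) *m invmx (G x)) 0 j.
    by rewrite !mxE; apply: eq_bigr => l _; rewrite mxE.
  exact: (lat_secP (e i) Vx).
have [b bx bE] : exists2 b : 'M[F]_n, integral_mx x b & G x = b *m T.
  have : forall i, exists2 r : 'rV[F]_n, integral_mx x r & row i (G x) = r *m T.
    move=> i; have hr : in_lattice G x (row i (G x)).
      rewrite /in_lattice -row_mul mulmxV ?local_basis_unit // => a c.
      by rewrite mxE; exact: integral_mx1.
    pose W := zopenI V (zopen_of hF hgeom (in_lattice_open hF G (row i (G x)))).
    have hW : W `<=` V by exact: zopenIl.
    have [s sE] : exists s : lat G W, val s = row i (G x).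
      by apply: lat_sec_exists => y [].
    have [a [aE _]] := fe W hW s; exists (\row_j val (a j)).
      by move=> ? j; rewrite mxE; apply: (reg_ge (U := W)).
    rewrite -sE aE lat_val_sum mulmx_sum_row; apply: eq_bigr => j _.
    by rewrite lat_valZ lat_val_res mxE rowK.
  move=> h; have /choice[r rP] : forall i, exists r : 'rV[F]_n, integral_mx x r /\ row i (G x) = r *m T.
    by move=> i; have [r] := h i; exists r.
  exists (\matrix_i r i); first by move=> i j; rewrite mxE; have [] := rP i.
  by apply/row_matrixP => i; rewrite row_mul rowK; have [] := rP i.
have G0 := det_basis_neq0 x.
have T0 : \det T != 0.
  by apply: contraNneq G0 => T0; rewrite bE det_mulmx T0 mulr0.
split=> //; have := det_integral h1; have := det_integral bx.
rewrite det_mulmx det_inv.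
have b0 : \det b != 0 by apply: contraNneq G0 => b0; rewrite bE det_mulmx b0 mul0r.
rewrite !ord_geE ?mulf_neq0 ?invr_eq0 // ordM ?invr_eq0 // ordV.
have -> : x (\det (G x)) = x (\det b) + x (\det T) by rewrite bE det_mulmx ordM.
by move: (x (\det b)) (x (\det T)) => p q; lia.
Qed.

(** The standard basis of F^n is a rational section of the determinant with divisor [det_divisor].
    Another choice changes the divisor by that of a determinant, of degree 0. *)
Lemma deg_bundle_lat M : oiso M (lat G) -> deg_bundle n M = deg_div det_divisor.
Proof.
move=> [j [j' [jK j'K]]]; apply: xget_unique.
  pose U := zopen_of hF hgeom (lattice_open G).
  have /choice[s sE] : forall i : 'I_n, exists s : M U, val (j U s) = delta_mx 0 i.
    move=> i; have [t tE] : exists t : lat G U, val t = delta_mx 0 i.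
      apply: lat_sec_exists => y /= Gy; rewrite /in_lattice Gy invmx1 mulmx1.
      by move=> a b; rewrite mxE; case: (_ && _); rewrite ?ord_ge1 ?ord_ge0.
    by exists (j' U t); rewrite j'K.
  exists U, s, det_divisor; split=> // x.
  have [_ loc] : vector_bundle n M.
    by apply: vector_bundle_oiso (lat_vector_bundle hF hgeom G); exists j', j.
  have [V Vx [e fe]] := loc x.
  pose W := zopenI U V.
  have hU : W `<=` U by exact: zopenIl.
  have hV : W `<=` V by exact: zopenIr.
  have /choice[a aE] : forall i, exists a : {ffun 'I_n -> reg W},
      res hU (s i) = \sum_l a l *: res hV (e l).
    by move=> i; have [a [aE _]] := fe W hV (res hU (s i)); exists a.
  pose A : 'M[reg W]_n := \matrix_(i, l) a i l.
  have fje := frame_oiso jK j'K fe.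
  have [T0 Tx] := frame_det fje Vx; set T := \matrix_i _ in T0 Tx.
  have AT : map_mx (val : reg W -> F) A *m T = 1%:M.
    apply/row_matrixP => i; rewrite row_mul row1 mulmx_sum_row -sE.
    rewrite -(lat_val_res hU (j U (s i))) -hmap_res aE linear_sum lat_val_sum.
    by apply: eq_bigr => l _; rewrite linearZ lat_valZ hmap_res lat_val_res !mxE rowK.
  have detA : val (\det A) * \det T = 1 by rewrite -det_map_mx -det_mulmx AT det1.
  have A0 : val (\det A) != 0.
    by apply: contra_eq_neq detA => ->; rewrite mul0r eq_sym oner_neq0.
  exists V, W, e, hU, hV, A; split=> //.
  - by move=> i; rewrite aE; apply: eq_bigr => l _; rewrite mxE.
  - rewrite coeff_det_divisor -Tx; have := congr1 (fun f => x f) detA.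
    by rewrite ordM // (@Defs.ord1 k F iota x) => /eqP; rewrite addr_eq0 => /eqP->.
move=> d [U [s [E [sE ->]]]].
pose S := \matrix_i val (j U (s i)).
have SE x : \det S != 0 /\ coeff x E = x (\det S) - x (\det (G x)).
  have [V [W [e [hU [hV [A [Vx fe sA A0 ->]]]]]]] := sE x.
  have fje := frame_oiso jK j'K fe.
  have [T0 Tx] := frame_det fje Vx; set T := \matrix_i _ in T0 Tx.
  have AT : S = map_mx (val : reg W -> F) A *m T.
    apply/row_matrixP => i; rewrite row_mul rowK mulmx_sum_row.
    rewrite -(lat_val_res hU (j U (s i))) -hmap_res sA linear_sum lat_val_sum.
    by apply: eq_bigr => l _; rewrite linearZ lat_valZ hmap_res lat_val_res !mxE rowK.
  have A0' : val (\det A) != 0.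
    by apply/eqP => h; move/eqP: A0; apply; apply: val_inj.
  have -> : \det S = val (\det A) * \det T by rewrite AT det_mulmx det_map_mx.
  by rewrite mulf_neq0 // ordM // Tx addrK.
have -> : E = principal hF (\det S) + det_divisor.
  by apply: divisor_eq => y; rewrite coeffD coeff_principal coeff_det_divisor; have [] := SE y.
have [x _] := zopen_neq0 U; have [S0 _] := SE x.
by rewrite deg_divD deg_principal // add0r.
Qed.

End Degree.
End Classes.

(** * Line subbundles and delta *)

Section Delta.
Variables (k : finFieldType) (F : fieldType) (iota : {rmorphism k -> F}).
Hypotheses (hF : function_field iota) (hgeom : geometrically_irreducible iota).
Implicit Types (x y : place iota) (U V W : zopen iota) (M N L P : omod iota).
Implicit Types (A B D E : divisor iota) (G H : bundle_data iota 2).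
Notation zopenI := (zopenI hF hgeom).

Lemma int_supremum_mem (S : set int) b : S !=set0 -> (forall d, S d -> d <= b) ->
  S (supremum 0 S) /\ forall d, S d -> d <= supremum 0 S.
Proof.
move=> [d0 Sd0] Sb.
pose P n := `[< S (b - n%:Z) >].
have P0 : exists n, P n.
  exists (absz (b - d0)%R); apply/asboolP; rewrite gez0_abs ?subr_ge0; last exact: Sb.
  by rewrite subKr.
case: (ex_minnP P0) => n /asboolP Sn nmin.
have Smax d : S d -> d <= b - n%:Z.
  move=> Sd; have db : 0 <= b - d by rewrite subr_ge0; exact: Sb.
  have : (n <= absz (b - d)%R)%N.
    by apply: nmin; apply/asboolP; rewrite gez0_abs // subKr.
  by rewrite -lez_nat gez0_abs //; lia.
suff -> : supremum 0 S = b - n%:Z by [].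
rewrite /supremum ifF; last by apply/negbTE/set0P; exists d0.
apply: xget_subset1; last exact: is_subset1_supremums.
by split=> [d /Smax//|d]; exact.
Qed.

Lemma det_divisor_twist A G : det_divisor (twist A G) = det_divisor G + A *+ 2.
Proof.
apply: divisor_eq => y; rewrite coeffD coeffMn !coeff_det_divisor /= /twist_basis detZ.
have u0 := expfz_neq0 (- coeff y A) (unif_neq0 y).
rewrite ordM ?expf_neq0 ?det_basis_neq0 // ordX // ord_unifX opprD addrC; congr (_ + _).
by rewrite mulNrn opprK.
Qed.

Lemma det_divisor_diag A B : det_divisor (diag_bundle A B) = A + B.
Proof.
apply: divisor_eq => y; rewrite coeffD coeff_det_divisor /= det_mx2 mulr0 subr0.
by rewrite ordM ?expfz_neq0 ?unif_neq0 // !ord_unifX opprD !opprK.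
Qed.

Lemma det_divisor_line A : det_divisor (twist A (trivial_bundle iota 1)) = A.
Proof.
apply: divisor_eq => y; rewrite coeff_det_divisor /= /twist_basis detZ det1 mulr1 expr1.
by rewrite ord_unifX opprK.
Qed.

Lemma ord_ge_unif_mul y n m f : (unif y ^ n * f \in ord_ge y m) = (f \in ord_ge y (m - n)).
Proof.
rewrite (ord_ge_unif y m) (ord_ge_unif y (m - n)) opprB mulrC mulrA -expfzDr ?unif_neq0 //.
by rewrite mulrC addrC.
Qed.

(* The vector v encodes the map L_A -> [lat G], f |-> f v; it is a line subbundle when moreover
   [line_sat G A v], where w presents the cokernel as the line bundle L_B. *)
Definition line_in G A (v : 'rV[F]_2) :=
  v != 0 /\ forall y f, f \in ord_ge y (- coeff y A) -> in_lattice G y (f *: v).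

Definition line_sat G A (v : 'rV[F]_2) := [/\ v != 0,
  forall y f, f \in ord_ge y (- coeff y A) <-> in_lattice G y (f *: v)
  & exists (B : divisor iota) (w : 'cV[F]_2),
   [/\ v *m w = 0, forall s, s *m w = 0 -> exists f, s = f *: v,
       forall y s, in_lattice G y s -> (s *m w) 0 0 \in ord_ge y (- coeff y B)
     & forall y h, h \in ord_ge y (- coeff y B) ->
         exists2 s, in_lattice G y s & (s *m w) 0 0 = h]].

Lemma line_in_twist G A C v : line_in (twist C G) A v -> line_in G (A - C) v.
Proof.
move=> [v0 h]; split=> // y f; rewrite coeffB => hf.
have := h y (unif y ^ (- coeff y C) * f).
rewrite ord_ge_unif_mul in_lattice_unif_twist scalerA mulrA -expfzDr ?unif_neq0 // addrN expr0z mul1r.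
by apply; apply: ord_ge_le hf; lia.
Qed.

Lemma line_sat_twist G A C v : line_sat G A v -> line_sat (twist C G) (A + C) v.
Proof.
move=> [v0 h [B [w [vw kw iw sw]]]]; split=> // [y f|].
  by rewrite in_lattice_unif_twist scalerA -h ord_ge_unif_mul coeffD opprD.
exists (B + C), w; split=> // y s.
  rewrite in_lattice_unif_twist => /iw; rewrite -scalemxAl mxE ord_ge_unif_mul.
  by rewrite coeffD opprD.
rewrite coeffD opprD -ord_ge_unif_mul => /sw[t ht tw].
exists (unif y ^ (- coeff y C) *: t).
  by rewrite in_lattice_unif_twist scalerA -expfzDr ?unif_neq0 // addrN expr0z scale1r.
by rewrite -scalemxAl mxE tw mulrA -expfzDr ?unif_neq0 // addNr expr0z mul1r.
Qed.

(** Only the injectivity of the inclusion is retained, which suffices for upper bounds on the degree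
    and spares any saturation argument. *)
Lemma line_subbundle_in M G L (j : ohom L M) : oiso M (lat G) -> line_subbundle j ->
  exists A v, line_in G A v /\ deg_bundle 1 L = deg_div A.
Proof.
move=> [i [i' [iK i'K]]] [/(vector_bundle1 hF hgeom)[A LA] [n [Q [p [_ [jinj _ _]]]]]].
have LT := oiso_trans LA (line_bundle_lat A).
have [l [l' [lK l'K]]] := LT.
pose T := twist A (trivial_bundle iota 1).
have [C CE] := lat_hom hF hgeom (ohom_comp i (ohom_comp j l')).
exists A, C; split; last by rewrite (deg_bundle_lat hF hgeom LT) det_divisor_line.
split=> [|y f hf].
  apply/eqP => C0.
  pose U := zopen_of hF hgeom (in_lattice_open hF T (const_mx 1)).
  have [s sE] := @lat_sec_exists _ _ _ _ T U (const_mx 1) (fun y h => h).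
  have := CE U s; rewrite C0 mulmx0 /= /linear_fun /= => s0.
  have : val s = 0.
    have e0 : i U (j U (l' U s)) = 0 by apply: val_inj.
    have e1 : j U (l' U s) = 0 by apply: (can_inj (iK U)); rewrite e0 linear0.
    have e2 : l' U s = 0 by apply: jinj; rewrite e1 linear0.
    by rewrite -(l'K U s) e2 linear0.
  by rewrite sE => /rowP/(_ 0); rewrite !mxE => /eqP; rewrite oner_eq0.
have := lat_hom_local hF hgeom CE (y := y) (v := const_mx f); rewrite in_lattice_line => /(_ hf).
by congr in_lattice; apply/rowP => a; rewrite !mxE big_ord1 !mxE.
Qed.

(** The map s |-> s w identifies the cokernel with L_B, which makes it locally free. *)
Lemma line_sat_subbundle M G A v : oiso M (lat G) -> line_sat G A v ->
  exists (L : omod iota) (j : ohom L M), line_subbundle j /\ deg_bundle 1 L = deg_div A.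
Proof.
move=> [i [i' [iK i'K]]] [v0 h [B [w [vw kw iw sw]]]].
pose TA := twist A (trivial_bundle iota 1); pose TB := twist B (trivial_bundle iota 1).
have row1E (u : 'rV[F]_1) : u = const_mx (u 0 0) by apply/rowP => a; rewrite mxE [a]zmodp.ord1.
have mulv (u : 'rV[F]_1) : u *m v = u 0 0 *: v.
  by apply/rowP => a; rewrite !mxE big_ord1.
have [j jE] : exists j : ohom (lat TA) (lat G), forall U s, val (j U s) = val s *m v.
  apply: lat_hom_of_mx => y u; rewrite [u]row1E in_lattice_line mulv mxE => hu.
  by apply/h.
have [p pE] : exists p : ohom (lat G) (lat TB), forall U s, val (p U s) = val s *m w.
  apply: lat_hom_of_mx => y s /iw hs; rewrite [_ *m _]row1E; exact/in_lattice_line.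
exists (lat TA), (ohom_comp i' j).
split; last by rewrite (deg_bundle_lat hF hgeom (oiso_refl _)) det_divisor_line.
split; first exact: lat_vector_bundle.
exists 1%N, (lat TB), (ohom_comp p i).
split; first exact: lat_vector_bundle.
split.
- move=> U s t /(can_inj (i'K U))/(congr1 val); rewrite /= /linear_fun !jE !mulv => st.
  apply: val_inj; rewrite [val s]row1E [val t]row1E; congr const_mx.
  move/eqP: st; rewrite -subr_eq0 -scalerBl scaler_eq0 (negPf v0) orbF subr_eq0.
  by move/eqP.
- move=> U s; split=> [|[t <-]]; last first.
    by apply: val_inj; rewrite /= /linear_fun /= /linear_fun i'K pE jE -mulmxA vw mulmx0.
  move=> /(congr1 val); rewrite /= /linear_fun pE => /kw[f fE].
  have [t tE] : exists t : lat TA U, val t = const_mx f.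
    apply: lat_sec_exists => y Uy; apply/in_lattice_line/h; rewrite -fE; exact: lat_secP.
  exists t; rewrite /= /linear_fun -[s]iK; congr (i' _ _); apply: val_inj.
  by rewrite jE tE mulv mxE fE.
- move=> U q y Uy; have := lat_secP q Uy; rewrite [val q]row1E in_lattice_line => /sw[s hs sq].
  pose V := zopenI U (zopen_of hF hgeom (in_lattice_open hF G s)).
  have hV : V `<=` U by exact: zopenIl.
  have [t tE] : exists t : lat G V, val t = s by apply: lat_sec_exists => z [].
  exists V, hV; split; first by split.
  exists (i' V t); apply: val_inj; rewrite /= /linear_fun i'K pE tE [LHS]row1E sq.
  by rewrite -row1E.
Qed.

Definition bundle_deg G : int := deg_div (det_divisor G).

Let deltas G : set int := [set d | exists (L : omod iota) (j : ohom L (representative (cls G))),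
    line_subbundle j /\ d = 2 * deg_bundle 1 L - deg_bundle 2 (representative (cls G))].

Let deltaE G : delta (cls G) = supremum 0 (deltas G). Proof. by []. Qed.

Let deltas_in G d : deltas G d -> exists A v, line_in G A v /\ d = 2 * deg_div A - bundle_deg G.
Proof.
move=> [L [j [hj ->]]]; have [C MC] := representative_cls hF hgeom G.
have [A [v [hv dL]]] := line_subbundle_in MC hj.
exists (A - C), v; split; first exact: line_in_twist.
rewrite (deg_bundle_lat hF hgeom MC) dL det_divisor_twist deg_divD deg_divMn deg_divB /bundle_deg.
by lia.
Qed.

Let deltas_sat G A v : line_sat G A v -> deltas G (2 * deg_div A - bundle_deg G).
Proof.
have [C MC] := representative_cls hF hgeom G; move=> /(line_sat_twist C)/(line_sat_subbundle MC)[L [j [hj dL]]].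
exists L, j; split=> //.
rewrite (deg_bundle_lat hF hgeom MC) dL det_divisor_twist !deg_divD /bundle_deg.
by lia.
Qed.

(** The supremum of an empty set is 0 by default, so a nonzero value of delta is attained. In this
    way no line subbundle has to be produced beforehand. *)
Lemma delta_mem G b : (forall A v, line_in G A v -> 2 * deg_div A - bundle_deg G <= b) ->
  delta (cls G) <> 0 -> exists A v, line_in G A v /\ delta (cls G) = 2 * deg_div A - bundle_deg G.
Proof.
move=> Gb d0; have db d : deltas G d -> d <= b by move=> /deltas_in[A [v [/Gb h ->]]].
apply: deltas_in; have [] // := int_supremum_mem _ db.
apply/set0P/eqP => S0; apply: d0; rewrite deltaE S0; exact: supremum0.
Qed.

Lemma delta_le G b : (forall A v, line_in G A v -> 2 * deg_div A - bundle_deg G <= b) ->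
  0 <= b -> delta (cls G) <= b.
Proof.
move=> Gb b0; have [->//|/eqP d0] := eqVneq (delta (cls G)) 0.
by have [A [v [/Gb h ->]]] := delta_mem Gb d0.
Qed.

Lemma delta_eq G A v b : (forall A v, line_in G A v -> 2 * deg_div A - bundle_deg G <= b) ->
  line_sat G A v -> 2 * deg_div A - bundle_deg G = b -> delta (cls G) = b.
Proof.
move=> Gb /deltas_sat h eb; rewrite eb in h.
have db d : deltas G d -> d <= b by move=> /deltas_in[A' [v' [/Gb h' ->]]].
have [Sm Smax] := int_supremum_mem (ex_intro _ _ h) db.
by apply/eqP; rewrite eq_le deltaE (db _ Sm) (Smax _ h).
Qed.

End Delta.

(** * Hecke modifications *)

Section Hecke.
Local Open Scope quotient_scope.
Variables (k : finFieldType) (F : fieldType) (iota : {rmorphism k -> F}).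
Hypotheses (hF : function_field iota) (hgeom : geometrically_irreducible iota).
Variable x : place iota.
Implicit Types (y : place iota) (U V W : zopen iota) (M N L P : omod iota).
Implicit Types (A B D E : divisor iota) (G H : bundle_data iota 2) (f g : F).
Notation zopenI := (zopenI hF hgeom).
Notation kappa := (residue_field x).
Notation O f := (f \in ord_ge x 0).

Fact residue_reg_proof f : O f -> f \in regular [set x].
Proof. by move=> h; apply/asboolP => y ->. Qed.

(** The residue at x, extended by 0 outside the local ring so that it can be applied to coordinates
    in F. *)
Definition residue_val f : kappa :=
  if pselect (O f) is left h then \pi_kappa%qT (Reg (residue_reg_proof h)) else 0.
Notation rs := residue_val.

Lemma residue_valE (a : reg [set x]) : rs (val a) = \pi_kappa%qT a.
Proof.
rewrite /residue_val; case: pselect => [h|]; first by congr (\pi _); apply: val_inj.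
by have /asboolP h := valP a; case; exact: h.
Qed.

Let regO f : O f -> exists a : reg [set x], val a = f.
Proof. by move=> h; exists (Reg (residue_reg_proof h)). Qed.

Lemma residue_valB f g : O f -> O g -> rs (f - g) = rs f - rs g.
Proof.
move=> /regO[a <-] /regO[b <-]; have -> : val a - val b = val (a - b) by [].
by rewrite !residue_valE rmorphB.
Qed.

Lemma residue_valD f g : O f -> O g -> rs (f + g) = rs f + rs g.
Proof.
move=> /regO[a <-] /regO[b <-]; have -> : val a + val b = val (a + b) by [].
by rewrite !residue_valE rmorphD.
Qed.

Lemma residue_valM f g : O f -> O g -> rs (f * g) = rs f * rs g.
Proof.
move=> /regO[a <-] /regO[b <-]; have -> : val a * val b = val (a * b) by [].
by rewrite !residue_valE rmorphM.
Qed.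

Lemma residue_val_eq0 f : O f -> rs f = 0 <-> f \in ord_ge x 1.
Proof. by move=> /regO[a <-]; rewrite residue_valE -residue_eq0; split=> /eqP. Qed.

Lemma residue_val1 : rs 1 = 1.
Proof. by rewrite -[1 : F]/(val (1 : reg [set x])) residue_valE rmorph1. Qed.

Lemma residue_val0 : rs 0 = 0.
Proof. by rewrite -[0 : F]/(val (0 : reg [set x])) residue_valE rmorph0. Qed.

Definition residue_lift (u : kappa) : F := val (repr u).
Lemma residue_lift_int u : O (residue_lift u).
Proof. by have /asboolP h := valP (repr u); exact: h. Qed.
Lemma residue_liftK u : rs (residue_lift u) = u.
Proof. by rewrite residue_valE reprK. Qed.

Lemma residue_inv (u : kappa) : u != 0 -> exists v, v * u = 1.
Proof.
move=> u0; pose f := residue_lift u.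
have Of : O f := residue_lift_int u.
have f1 : f \notin ord_ge x 1.
  apply: contraNN u0 => h; apply/eqP; rewrite -(residue_liftK u).
  by apply/residue_val_eq0.
have f0 : f != 0 by apply: contraNneq f1 => ->; exact: ord_ge0.
have xf : x f = 0 by move: Of f1; rewrite !ord_geE //; lia.
have Ofi : O f^-1 by rewrite ord_geE ?invr_eq0 // ordV xf.
by exists (rs f^-1); rewrite -(residue_liftK u) -residue_valM // mulVf // residue_val1.
Qed.

Lemma residue_oner : (1 : kappa) != 0.
Proof.
rewrite -residue_val1; apply/eqP => /(residue_val_eq0 (ord_ge1 x)).
by rewrite ord_geE ?oner_neq0 // (@Defs.ord1 k F iota x).
Qed.

Lemma eval_at_residue U (a : reg U) : zset U x -> eval_at x a = rs (val a).
Proof.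
move=> Ux; rewrite /eval_at; case: pselect => // h.
by rewrite -residue_valE.
Qed.

(* The points of the projective line over the residue field: [Some u] is the line spanned by
   (u, 1) and [None] the one spanned by (1, 0). *)
Implicit Type c : option kappa.

(** A linear form on the fibre at x whose kernel is the line c. *)
Definition line_form c (v : 'rV[F]_2) : kappa :=
  if c is Some u then rs (v 0 0) - u * rs (v 0 1) else rs (v 0 1).

Lemma line_formP c f v v' : O f -> integral_mx x v -> integral_mx x v' ->
  line_form c (f *: v + v') = rs f * line_form c v + line_form c v'.
Proof.
move=> Of hv hv'; rewrite /line_form !mxE.
have h j : rs (f * v 0 j + v' 0 j) = rs f * rs (v 0 j) + rs (v' 0 j).
  by rewrite residue_valD ?residue_valM //; apply: ord_geM0.
by case: c => [u|]; rewrite !h //; ring.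
Qed.

Definition line_vec c : 'rV[F]_2 := if c is Some u then rv2 (residue_lift u) 1 else rv2 1 0.

Lemma line_vec_int c : integral_mx x (line_vec c).
Proof.
by case: c => [u|]; apply/integral_rv2; split; rewrite ?residue_lift_int ?ord_ge1 ?ord_ge0.
Qed.

Lemma line_form_vec c c' : line_form c (line_vec c') = 0 -> c = c'.
Proof.
have n1 := residue_oner.
case: c c' => [u|] [u'|] //=; rewrite !mxE /= ?residue_liftK residue_val1 ?residue_val0.
- by rewrite mulr1 => /eqP; rewrite subr_eq0 => /eqP->.
- by rewrite mulr0 subr0 => /eqP; rewrite (negPf n1).
- by move=> /eqP; rewrite (negPf n1).
Qed.

Lemma line_form_vec0 c : line_form c (line_vec c) = 0.
Proof.
case: c => [u|]; rewrite /= !mxE /= ?residue_liftK ?residue_val1 ?residue_val0 //.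
by rewrite mulr1 subrr.
Qed.

(** The rows span the inverse image of the line c in the standard lattice at x. *)
Definition hecke_mx c : 'M[F]_2 :=
  if c is Some u then mx2 (unif x) 0 (residue_lift u) 1 else mx2 1 0 0 (unif x).
Definition hecke_inv c : 'M[F]_2 :=
  if c is Some u then mx2 (unif x)^-1 0 (- residue_lift u / unif x) 1
  else mx2 1 0 0 (unif x)^-1.

Lemma hecke_mxK c : hecke_mx c *m hecke_inv c = 1%:M.
Proof.
have u0 := unif_neq0 x.
rewrite -mx2_1; case: c => [u|] /=; rewrite mx2_mul; congr mx2; rewrite ?mulfV //; try by field.
Qed.

Lemma hecke_mx_unit c : hecke_mx c \in unitmx.
Proof. by case/mulmx1_unit: (hecke_mxK c). Qed.

Definition hecke_basis c G y : 'M[F]_2 := if y == x then hecke_mx c *m G y else G y.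
Fact hecke_basis_unit c G y : hecke_basis c G y \in unitmx.
Proof.
by rewrite /hecke_basis; case: eqP => _; rewrite ?unitmx_mul ?hecke_mx_unit local_basis_unit.
Qed.
Fact hecke_basis_std c G : finite_set [set y | hecke_basis c G y <> 1%:M].
Proof.
apply: (@sub_finite_set _ _ ([set x] `|` [set y | G y <> 1%:M])).
  by move=> y /=; rewrite /hecke_basis; case: eqP => [->|_ h]; [left|right].
by rewrite finite_setU; split; [exact: finite_set1|exact: local_basis_std].
Qed.
Definition hecke_bundle c G : bundle_data iota 2 :=
  BundleData (hecke_basis_unit c G) (hecke_basis_std c G).

Lemma ord_ge1_unif f : (f / unif x \in ord_ge x 0) = (f \in ord_ge x 1).
Proof. by rewrite [RHS]ord_ge_unif exprN1. Qed.

Lemma ord_ge1_int f : f \in ord_ge x 1 -> O f.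
Proof. exact: ord_ge_le. Qed.

Lemma hecke_inv_int c (w : 'rV[F]_2) :
  integral_mx x (w *m hecke_inv c) <-> integral_mx x w /\ line_form c w = 0.
Proof.
rewrite [w]rv2_eq; set a := w 0 0; set b := w 0 1.
case: c => [u|]; rewrite /= rv2_mul !integral_rv2 !mxE /= ?mulr0 ?mulr1 ?addr0 ?add0r.
  have -> : a / unif x + b * (- residue_lift u / unif x) = (a - residue_lift u * b) / unif x.
    by rewrite mulrBl mulNr mulrN mulrCA mulrA.
  rewrite ord_ge1_unif; have hl := residue_lift_int u.
  split=> [[h1 h2]|[[h1 h2] h3]].
    have h4 : O (residue_lift u * b) by exact: ord_geM0.
    have h5 : O a by rewrite -[a](subrK (residue_lift u * b)); apply: ord_geD => //; exact: ord_ge1_int.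
    split=> //; move: h1; rewrite -residue_val_eq0; last exact: ord_geB.
    by rewrite residue_valB // residue_valM // residue_liftK.
  have h4 : O (residue_lift u * b) by exact: ord_geM0.
  split=> //; apply/residue_val_eq0; first exact: ord_geB.
  by rewrite residue_valB // residue_valM // residue_liftK.
rewrite ord_ge1_unif; split=> [[h1 h2]|[[h1 h2] h3]].
  by have h3 := ord_ge1_int h2; split=> //; apply/residue_val_eq0.
by split=> //; apply/residue_val_eq0.
Qed.

Lemma in_hecke c G y v : in_lattice (hecke_bundle c G) y v <->
  in_lattice G y v /\ (y = x -> line_form c (v *m invmx (G x)) = 0).
Proof.
have [->|/eqP yx] := eqVneq y x; last first.
  by rewrite /in_lattice /= /hecke_basis ifF ?(introF eqP yx) //; split=> [|[]].
rewrite (@in_lattice_inv _ _ _ _ _ _ (invmx (G x) *m hecke_inv c)).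
  by rewrite mulmxA hecke_inv_int; split=> [[h1 h2]|[h1 h2]]; split=> //; exact: h2.
by rewrite /= /hecke_basis eqxx mulmxA -[_ *m _ *m invmx _]mulmxA mulmxV ?local_basis_unit // mulmx1 hecke_mxK.
Qed.

Lemma hecke_twist c A G : hecke_bundle c (twist A G) = twist A (hecke_bundle c G).
Proof.
apply: bundle_data_eq => y; rewrite /= /twist_basis /= /hecke_basis /= /twist_basis.
by case: eqP => // _; rewrite scalemxAr.
Qed.

Lemma diag_coord A B f g : rv2 f g *m invmx (diag_bundle A B x) =
  rv2 (f * unif x ^ coeff x A) (g * unif x ^ coeff x B).
Proof.
have h : diag_bundle A B x *m mx2 (unif x ^ coeff x A) 0 0 (unif x ^ coeff x B) = 1%:M.
  by rewrite mx2_mul !mulr0 !mul0r !addr0 !add0r -!expfzDr ?unif_neq0 // !addNr !expr0z mx2_1.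
have -> : invmx (diag_bundle A B x) = mx2 (unif x ^ coeff x A) 0 0 (unif x ^ coeff x B).
  rewrite -[RHS]mul1mx -(mulVmx (local_basis_unit (diag_bundle A B) x)) -mulmxA h mulmx1 //.
by rewrite rv2_mul !mulr0 addr0 add0r.
Qed.

Lemma in_hecke_diag c A B y f g : in_lattice (hecke_bundle c (diag_bundle A B)) y (rv2 f g) <->
  [/\ f \in ord_ge y (- coeff y A), g \in ord_ge y (- coeff y B) & y = x ->
    line_form c (rv2 (f * unif x ^ coeff x A) (g * unif x ^ coeff x B)) = 0].
Proof.
rewrite in_hecke in_lattice_diag diag_coord.
by split=> [[[h1 h2] h3]|[h1 h2 h3]].
Qed.

Section HeckeSubsheaves.
Variables (M : omod iota) (G : bundle_data iota 2) (i : ohom M (lat G)) (i' : ohom (lat G) M).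
Hypotheses (iK : forall U, cancel (i U) (i' U)) (i'K : forall U, cancel (i' U) (i U)).

Definition hecke_sub c : forall U, set (M U) :=
  fun U => [set s | zset U x -> line_form c (val (i U s) *m invmx (G x)) = 0].

Arguments hecke_sub : clear implicits.

Let section_exists (v : 'rV[F]_2) : integral_mx x (v *m invmx (G x)) ->
  exists2 U : zopen iota, zset U x & exists s : lat G U, val s = v.
Proof.
move=> hv; pose U := zopen_of hF hgeom (in_lattice_open hF G v).
exists U => //; exact: (@lat_sec_exists _ _ _ _ G U v (fun y h => h)).
Qed.

Lemma hecke_sub_inj c c' : hecke_sub c = hecke_sub c' -> c = c'.
Proof.
move=> cc'; have Gx := local_basis_unit G x.
have [|U Ux [s sE]] := @section_exists (line_vec c' *m G x).
  by rewrite mulmxK //; exact: line_vec_int.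
have : hecke_sub c' U (i' U s).
  by move=> _; rewrite i'K sE mulmxK // line_form_vec0.
rewrite -cc' => /(_ Ux); rewrite i'K sE mulmxK //.
exact: line_form_vec.
Qed.

Let int_at U (s : lat G U) : zset U x -> integral_mx x (val s *m invmx (G x)).
Proof. exact: lat_secP. Qed.

(** The quotient map onto K_x with kernel [hecke_sub c]: the form of c at x, and 0 over open sets
    not containing x. *)
Let sky_of c U (s : lat G U) : kappa :=
  if `[< zset U x >] then line_form c (val s *m invmx (G x)) else 0.

Let sky_ofP c U s : @sky_of c U s \in @sky_pred _ _ _ x U.
Proof. by rewrite /sky_of inE; case: asboolP; rewrite ?orbT ?eqxx. Qed.

Let sky_fun c U (s : lat G U) : skyscraper x U := SkySec (sky_ofP c s).

Let sky_linear c U : linear (@sky_fun c U).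
Proof.
move=> a s t; apply: val_inj; rewrite /= /sky_of; case: asboolP => [Ux|nUx]; last by rewrite mulr0 addr0.
rewrite eval_at_residue // mulmxDl -scalemxAl line_formP //; try exact: int_at.
exact: (reg_ge a).
Qed.

Let sky_res_compat c U V (h : V `<=` U) (s : lat G U) : sky_fun c (res h s) = res h (sky_fun c s).
Proof.
apply: val_inj; rewrite /= /sky_of; case: asboolP => // Vx.
by rewrite asboolT //; exact: h.
Qed.

Let sky_hom c : ohom (lat G) (skyscraper x) := ohom_of (@sky_linear c) (@sky_res_compat c).

Lemma hecke_sub_oiso c : exists j : ohom (lat (hecke_bundle c G)) M,
  (forall U, injective (j U)) /\ forall U, hecke_sub c U = range (j U).
Proof.
have [l lE] : exists l : ohom (lat (hecke_bundle c G)) (lat G), forall U s, val (l U s) = val s *m 1%:M.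
  by apply: lat_hom_of_mx => y v; rewrite mulmx1 in_hecke => -[].
exists (ohom_comp i' l); split=> U.
  move=> s t /(can_inj (@i'K U))/(congr1 val); rewrite !lE !mulmx1; exact: val_inj.
apply/seteqP; split=> [s hs|_ [t _ <-] Ux].
  have [t tE] : exists t : lat (hecke_bundle c G) U, val t = val (i U s).
    apply: lat_sec_exists => y Uy; apply/in_hecke; split; first exact: lat_secP.
    by move=> yx; apply: hs; rewrite -yx.
  exists t => //=; rewrite /linear_fun -[s]iK; congr (i' _ _).
  by apply: val_inj; rewrite lE mulmx1 tE.
rewrite /= /linear_fun i'K lE mulmx1.
by have /in_hecke[_] := lat_secP t Ux; exact.
Qed.

Lemma hecke_sub_hecke (v : bclass iota) c : v (lat (hecke_bundle c G)) -> hecke_subsheaf x v (hecke_sub c).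
Proof.
move=> vN; have [j [jinj jE]] := hecke_sub_oiso c.
exists (lat (hecke_bundle c G)), j, (ohom_comp (sky_hom c) i); split=> //; split=> //.
- move=> U s; have := jE U => /seteqP[h1 h2]; split=> [|[t <-]].
    move=> /(congr1 val) /=; rewrite /linear_fun /= /linear_fun /= /sky_of => h.
    have : hecke_sub c U s by move=> Ux; move: h; rewrite asboolT.
    by move=> /h1[t _ <-]; exists t.
  have := h2 (j U t) (ex_intro2 _ _ t Logic.I erefl) => h.
  apply: val_inj; rewrite /= /linear_fun /= /linear_fun /= /sky_of.
  by case: asboolP => // Ux; exact: h.
- move=> U q y Uy.
  have [yx|yx] := eqVneq y x.
    have Ux : zset U x by rewrite -yx.
    pose w : 'rV[F]_2 := if c is Some _ then rv2 (residue_lift (val q)) 0 else rv2 0 (residue_lift (val q)).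
    have hw : integral_mx x w.
      by rewrite /w; case: (c) => [?|]; apply/integral_rv2; rewrite residue_lift_int ord_ge0.
    have Gx := local_basis_unit G x.
    have [|V0 V0x [s sE]] := @section_exists (w *m G x); first by rewrite mulmxK.
    pose V := zopenI U V0.
    have hV : V `<=` U by exact: zopenIl.
    have hV0 : V `<=` V0 by exact: zopenIr.
    have Vx : zset V x by split.
    exists V, hV; rewrite yx; split=> //.
    exists (i' V (res hV0 s)); apply: val_inj.
    rewrite /= /linear_fun i'K /= /linear_fun /= /sky_of !asboolT //.
    have e1 : line_form c (val (res hV0 s) *m invmx (G x)) = val q; last exact: e1.
    rewrite lat_val_res sE mulmxK // /w /line_form; case: (c) => [u|]; rewrite !mxE /= residue_liftK //.
    by rewrite residue_val0 mulr0 subr0.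
  have fS : finite_set (~` (zset U `&` ~` [set x])).
    by rewrite setCI setCK finite_setU; split; [exact: zopen_cofinite|exact: finite_set1].
  pose V := zopen_of hF hgeom fS.
  have hV : V `<=` U by move=> z [].
  exists V, hV; split; first by split=> //; apply/eqP.
  have nVx : ~ zset V x by move=> [_]; exact.
  exists 0; apply: val_inj; rewrite linear0 /= asboolF //.
Qed.

(** A map to K_x is determined by its values al and be on sections extending the two basis vectors
    at x. They do not both vanish, by surjectivity, so the kernel is the inverse image of a line of
    the fibre. *)
Lemma hecke_hecke_sub (v : bclass iota) (S : forall U, set (M U)) :
  (forall N N', oiso N N' -> v N -> v N') -> hecke_subsheaf x v S ->
  exists2 c, S = hecke_sub c & v (lat (hecke_bundle c G)).
Proof.
move=> viso [B [j [p [vB [jinj jker psurj] SE]]]].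
have Gx := local_basis_unit G x.
have [|U1 U1x [e1 e1E]] := @section_exists (rv2 1 0 *m G x).
  by rewrite mulmxK //; apply/integral_rv2; rewrite ord_ge1 ord_ge0.
have [|U2 U2x [e2 e2E]] := @section_exists (rv2 0 1 *m G x).
  by rewrite mulmxK //; apply/integral_rv2; rewrite ord_ge1 ord_ge0.
pose q := ohom_comp p i'.
pose al : kappa := val (q U1 e1); pose be : kappa := val (q U2 e2).
have res_sky U V (h : V `<=` U) (s : skyscraper x U) : zset V x -> val (res h s) = val s.
  by move=> Vx; rewrite /= asboolT.
have qE U (s : lat G U) : zset U x -> let w := val s *m invmx (G x) in
    val (q U s) = rs (w 0 0) * al + rs (w 0 1) * be.
  move=> Ux w; have hw := int_at s Ux.
  pose W0 := zopen_of hF hgeom (integral_mx_open hF w).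
  pose W := zopenI U (zopenI W0 (zopenI U1 U2)).
  have Wx : zset W x by split=> //; split=> //; split.
  have hU : W `<=` U by move=> y [].
  have h1 : W `<=` U1 by move=> y [_ [_ []]].
  have h2 : W `<=` U2 by move=> y [_ [_ []]].
  have hc l : exists a : reg W, val a = w 0 l.
    by apply: reg_of_regular => y [_ [h _]]; exact: h.
  have [a aE] := hc 0; have [b bE] := hc 1.
  have sE : res hU s = a *: res h1 e1 + b *: res h2 e2.
    apply: val_inj; rewrite /= e1E e2E aE bE !scalemxAl -mulmxDl.
    have -> : w 0 0 *: rv2 1 0 + w 0 1 *: rv2 0 1 = w.
      by rewrite [RHS]rv2_eq; apply/rowP => l; rewrite !mxE; case: ifP => _; ring.
    by rewrite mulmxKV.
  rewrite -(res_sky _ _ hU (q U s) Wx) -hmap_res sE linearD !linearZ !hmap_res.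
  change (val (a *: res h1 (q U1 e1) + b *: res h2 (q U2 e2)) = rs (w 0 0) * al + rs (w 0 1) * be).
  rewrite [LHS]/= !asboolT // !eval_at_residue //.
  by rewrite aE bE.
have ab0 : ~ (al = 0 /\ be = 0).
  move=> [al0 be0].
  have h1 : (1 : kappa) \in @sky_pred _ _ _ x U1 by rewrite inE asboolT ?orbT.
  have [V [hV [Vx [t tE]]]] := psurj U1 (SkySec h1) x U1x.
  have := congr1 val tE; rewrite res_sky //= => t1.
  have := qE V (i V t) Vx; rewrite /= /linear_fun iK t1 al0 be0 !mulr0 addr0.
  by move=> /eqP; rewrite (negPf residue_oner).
have [c cP] : exists c, forall w : 'rV[F]_2,
    (rs (w 0 0) * al + rs (w 0 1) * be = 0) <-> line_form c w = 0.
  have [al0|/residue_inv[r ra]] := eqVneq al 0.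
    have [be0|/residue_inv[r rb]] := eqVneq be 0; first by case: ab0.
    exists None => w; rewrite al0 mulr0 add0r /=; split=> [h|->]; last by rewrite mul0r.
    by rewrite -[rs _]mulr1 -rb mulrCA h mulr0.
  (* Here r inverts al, and the kernel of (a, b) |-> a al + b be is spanned by (- be / al, 1). *)
  exists (Some (- (be * r))) => w /=; set a := rs _; set b := rs _.
  have e1' : a * al + b * be = al * (a - - (be * r) * b).
    by rewrite -[b * be]mulr1 -ra; ring.
  rewrite e1'; split=> [h|->]; last by rewrite mulr0.
  by rewrite -[LHS]mul1r -ra -mulrA h mulr0.
have SP U s : S U s <-> hecke_sub c U s.
  rewrite SE; split=> [[t _ <-] Ux|hs].
    apply/cP; rewrite -(qE U (i U (j U t)) Ux) /= /linear_fun iK.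
    by have [_ ->] := jker U (j U t); last by exists t.
  have [h _] := jker U s; have [|t <-] := h; last by exists t.
  apply: val_inj; have [Ux|nUx] := pselect (zset U x).
    by have := qE U (i U s) Ux; rewrite /= /linear_fun iK => ->; apply/cP/hs.
  by have := valP (p U s); rewrite inE asboolF // orbF => /eqP.
exists c.
  by apply: functional_extensionality_dep => U; apply/seteqP; split=> s /SP.
have hB U (b : B U) : forall y, zset U y -> in_lattice (hecke_bundle c G) y (val (i U (j U b))).
  move=> y Uy; apply/in_hecke; split; first exact: lat_secP.
  move=> yx; have : hecke_sub c U (j U b) by apply/SP; rewrite SE; exists b.
  by apply; rewrite -yx.
apply: viso vB.
apply: (@oiso_bij _ _ _ _ _ (fun U b => LatSec (introT (asboolP _) (hB U b)) : lat (hecke_bundle c G) U)).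
- by move=> U a s t; apply: val_inj; rewrite /= !linearP.
- by move=> U V h s; apply: val_inj; rewrite /= !hmap_res.
- move=> U s t /(congr1 val) /= /val_inj/(can_inj (@iK U)); exact: jinj.
- move=> U t.
  have [l lE] : exists l : lat G U, val l = val t.
    by apply: lat_sec_exists => y Uy; have /in_hecke[] := lat_secP t Uy.
  have : S U (i' U l).
    apply/SP => Ux; rewrite i'K lE.
    by have /in_hecke[_] := lat_secP t Ux; exact.
  rewrite SE => -[b _ bE]; exists b; apply: val_inj; rewrite /= bE i'K; exact: lE.
Qed.

End HeckeSubsheaves.

End Hecke.

(** * Edges at classes of diagonal bundles *)

Section Edges.
Variables (k : finFieldType) (F : fieldType) (iota : {rmorphism k -> F}).
Hypotheses (hF : function_field iota) (hgeom : geometrically_irreducible iota).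
Variable x : place iota.
Implicit Types (y : place iota) (A B D E : divisor iota) (G H : bundle_data iota 2) (f g : F).
Notation kappa := (residue_field x).
Implicit Type c : option kappa.
Notation rs := (residue_val x).
Notation dx := (deg_place x)%:Z.

Lemma card_eq_bij (T U : Type) (f : T -> U) : injective f -> (forall u, exists t, f t = u) ->
  ([set: T] #= [set: U])%card.
Proof.
move=> fi fs; have <- : f @` [set: T] = [set: U].
  by apply/seteqP; split=> // u _; have [t <-] := fs u; exists t.
by apply/card_esym/inj_card_eq => a b _ _; exact: fi.
Qed.

Lemma card_finType (T : finType) : ([set: T] #= `I_#|T|)%card.
Proof.
apply: card_eq_trans (card_esym card_II); apply: (@card_eq_bij _ _ enum_rank).
  exact: enum_rank_inj.
by move=> i; exists (enum_val i); exact: enum_valK.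
Qed.

Lemma residue_card : ([set: kappa] #= `I_(#|k| ^ deg_place x))%card.
Proof.
have [e _ eP] := deg_place_residue hF x.
pose phi (c : {ffun 'I_(deg_place x) -> k}) : kappa := \sum_i c i *: (e i : residue_vect x).
have <- : #|{ffun 'I_(deg_place x) -> k}| = (#|k| ^ deg_place x)%N by rewrite card_ffun card_ord.
apply: card_eq_trans (card_finType _); apply: card_esym; apply: (@card_eq_bij _ _ phi).
  move=> c d cd; have [c' [_ cu]] := eP (phi c) Logic.I.
  have -> : c = c' by apply/esym/cu; exact: subrr.
  by apply: cu; rewrite cd; exact: subrr.
move=> u; have [c [h _]] := eP u Logic.I; exists c.
by apply/esym/eqP; rewrite -subr_eq0; apply/eqP; exact: h.
Qed.

Lemma finite_points (S : set (option kappa)) : finite_set S.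
Proof.
have h : finite_set ([set None] `|` (Some @` [set: kappa])).
  rewrite finite_setU; split; first exact: finite_set1.
  by apply: finite_image; exists (#|k| ^ deg_place x)%N; exact: residue_card.
by apply: sub_finite_set h => -[u|] _; [right; exists u|left].
Qed.

Definition neighbour G c : bclass iota := cls (hecke_bundle c G).

(** The admissible subsheaves of any representative correspond one to one to the points c, and
    twisting the representative commutes with the modification at c, so multiplicities are counted
    on the projective line. *)
Lemma mult_cls G v n : PBun2 v -> ([set c | v = neighbour G c] #= `I_n)%card ->
  mult x (cls G) v = n.
Proof.
move=> vP vn; have [A [i [i' [iK i'K]]]] := representative_cls hF hgeom G.
have viso N N' : oiso N N' -> v N -> v N'.
  case: vP => M' M'b -> NN'; have [H MH] := vector_bundle_lat hF hgeom M'b.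
  rewrite !(pclassP hF hgeom _ MH) => -[B NB]; exists B.
  exact: oiso_trans (oiso_sym NN') NB.
have vE c : v (lat (hecke_bundle c (twist A G))) <-> v = neighbour G c.
  rewrite hecke_twist; split=> [vN|->].
    by rewrite (PBun2_mem hF hgeom vP vN (oiso_refl _)) cls_twist.
  by rewrite /neighbour -(cls_twist hF hgeom A); exact: cls_self.
have SE : hecke_subsheaf x (M := representative (cls G)) v =
    (@hecke_sub _ _ _ x _ _ i) @` [set c | v = neighbour G c].
  apply/seteqP; split=> S.
    move=> /(hecke_hecke_sub hF hgeom iK i'K viso)[c -> vc].
    by exists c => //; apply/vE.
  by move=> [c /= /vE vc <-]; exact: (hecke_sub_hecke hF hgeom iK i'K vc).
have cardS : (hecke_subsheaf x (M := representative (cls G)) v #= `I_n)%card.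
  rewrite SE; apply: card_eq_trans vn; apply: inj_card_eq => c c' _ _.
  exact: (hecke_sub_inj hF hgeom i'K).
rewrite /mult /mult_bundle; apply: xget_unique; first exact: cardS.
move=> m /= hm; apply/esym/card_eq_II.
exact: card_eq_trans (card_esym cardS) hm.
Qed.

Lemma edgesP G t : hecke_edges x (cls G) t <->
  t.1.1 = cls G /\ exists c, t.1.2 = neighbour G c /\
    ([set c' | neighbour G c = neighbour G c'] #= `I_(t.2))%card.
Proof.
case: t => [[a v] m]; split=> [[/= -> vP mE m0]|[/= -> [c [-> cm]]]].
  split=> //; have [n hn] := finite_points [set c | v = neighbour G c].
  rewrite (mult_cls vP hn) in mE; rewrite mE in m0 *.
  have [c vc] : exists c, v = neighbour G c.
    apply: contrapT => h; apply: m0; apply: card_eq_II.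
    rewrite (_ : [set c | v = neighbour G c] = set0) in hn; last first.
      by apply/seteqP; split=> // c vc; apply: h; exists c.
    apply: card_eq_trans (card_esym hn) _.
    by rewrite card_eq_sym card_eq0; apply/eqP/seteqP; split.
  by exists c; split=> //; rewrite -vc.
split=> //=; first exact: PBun2_cls.
  by rewrite (mult_cls (PBun2_cls hF hgeom _) cm).
move=> m0; have : [set c' | neighbour G c = neighbour G c'] c by [].
by move: cm; rewrite m0 II0 => /card_esym; rewrite card_eq_sym card_eq0 => /eqP->.
Qed.

End Edges.

(** * Classes of sums of two line bundles *)

Section DiagonalClasses.
Variables (k : finFieldType) (F : fieldType) (iota : {rmorphism k -> F}).
Hypotheses (hF : function_field iota) (hgeom : geometrically_irreducible iota).
Implicit Types (x y : place iota) (A B C D E : divisor iota) (f g : F).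
Notation cc := (@cc k F iota).

Lemma cls_diag A B : cls (diag_bundle A B) = cc (A - B).
Proof.
rewrite (cc_cls hF hgeom) -(cls_twist hF hgeom (- B)) twist_diag.
by rewrite (_ : B - B = 0) ?subrr.
Qed.

Lemma cls_diag_swap A B : cls (diag_bundle A B) = cls (diag_bundle B A).
Proof.
apply: (cls_oiso hF hgeom); apply: (@lat_oiso _ _ _ _ _ _ (mx2 0 1 1 0)).
  by rewrite unitmxE unitfE det_mx2 mulr0 sub0r mulr1 oppr_eq0 oner_neq0.
move=> y v; rewrite [v]rv2_eq rv2_mul !mulr0 !mulr1 add0r addr0 !in_lattice_diag.
by split=> -[].
Qed.

Lemma cc_opp D : cc (- D) = cc D.
Proof. by rewrite -[RHS]/(cc D) -[D in RHS]subr0 -cls_diag cls_diag_swap cls_diag sub0r. Qed.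

Lemma cc_lin_equiv D E : lin_equiv D E -> cc D = cc E.
Proof.
move=> [f f0 fE]; rewrite -[D]subr0 -[E]subr0 -!cls_diag.
apply: (cls_oiso hF hgeom); apply: (@lat_oiso _ _ _ _ _ _ (mx2 f 0 0 1)).
  by rewrite unitmxE unitfE det_mx2 mulr1 mulr0 subr0.
move=> y v; rewrite [v]rv2_eq rv2_mul !mulr0 mulr1 addr0 add0r !in_lattice_diag.
set a := v 0 0; suff -> : (a \in ord_ge y (- coeff y D)) = (a * f \in ord_ge y (- coeff y E)) by [].
have [->|a0] := eqVneq a 0; first by rewrite mul0r !ord_ge0.
rewrite !ord_geE ?mulf_neq0 // ordM // -fE coeffB.
by move: (y a) (coeff y D) (coeff y E) => p q r; lia.
Qed.

(** The cokernel is presented by the second coordinate, whose image is L_B. *)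
Lemma line_sat_fst G A B :
  (forall y f, f \in ord_ge y (- coeff y A) <-> in_lattice G y (rv2 f 0)) ->
  (forall y f g, in_lattice G y (rv2 f g) -> g \in ord_ge y (- coeff y B)) ->
  (forall y g, g \in ord_ge y (- coeff y B) -> exists f, in_lattice G y (rv2 f g)) ->
  line_sat G A (rv2 1 0).
Proof.
move=> h1 h2 h3.
have scale_fst f : f *: rv2 1 0 = rv2 f 0.
  by apply/rowP => j; rewrite !mxE; case: ifP; rewrite ?mulr1 ?mulr0.
pose w : 'cV[F]_2 := delta_mx 1 0.
have mulw (s : 'rV[F]_2) : s *m w = const_mx (s 0 1).
  by apply/matrixP => i j; rewrite -colE !mxE [i]zmodp.ord1.
split=> [|y f|]; first by apply/eqP => /rowP/(_ 0); rewrite !mxE => /eqP; rewrite oner_eq0.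
  by rewrite scale_fst; exact: h1.
exists B, w; split.
- by rewrite mulw !mxE /=; apply/matrixP => i j; rewrite !mxE.
- move=> s; rewrite mulw => /matrixP/(_ 0 0); rewrite !mxE => s1.
  by exists (s 0 0); rewrite scale_fst [LHS]rv2_eq s1.
- by move=> y s hs; rewrite mulw mxE; apply: (h2 y (s 0 0)); rewrite -rv2_eq.
- move=> y g /h3[f hf]; exists (rv2 f g) => //.
  by rewrite mulw !mxE.
Qed.

Lemma line_in_ord G A v y : line_in G A v -> exists2 a, in_lattice G y (a *: v) &
  a != 0 /\ y a = - coeff y A.
Proof.
move=> [_ h]; have u0 := expfz_neq0 (- coeff y A) (unif_neq0 y).
exists (unif y ^ (- coeff y A)); last by rewrite ord_unifX.
by apply: h; rewrite ord_geE // ord_unifX.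
Qed.

(** A nonzero map L_A -> L_D given by f bounds deg A by deg D, and it is an isomorphism when the
    degrees agree. All degree estimates for line subsheaves come from this. *)
Lemma divle_principal A D f : f != 0 -> (forall y, coeff y A <= coeff y D + y f) ->
  deg_div A <= deg_div D /\ (deg_div D <= deg_div A -> forall y, coeff y A = coeff y D + y f).
Proof.
move=> f0 h; have le : forall y, coeff y A <= coeff y (D + principal hF f).
  by move=> y; rewrite coeffD coeff_principal.
have dE : deg_div (D + principal hF f) = deg_div D by rewrite deg_divD deg_principal // addr0.
split=> [|DA y]; first by rewrite -dE; exact: deg_div_le.
by rewrite (deg_div_eq hF le) ?dE // coeffD coeff_principal.
Qed.

Lemma line_in_diag D E A (v : 'rV[F]_2) : line_in (diag_bundle D E) A v ->
  (v 0 0 != 0 -> forall y, coeff y A <= coeff y D + y (v 0 0)) /\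
  (v 0 1 != 0 -> forall y, coeff y A <= coeff y E + y (v 0 1)).
Proof.
move=> hv; split=> v0 y; have [a + [a0 ya]] := line_in_ord y hv;
  rewrite [_ *: _]rv2_eq in_lattice_diag !mxE => -[].
  move=> + _; rewrite ord_geE ?mulf_neq0 // ordM // ya.
  by move: (coeff y A) (coeff y D) (y (v 0 0)) => p q r; lia.
move=> _; rewrite ord_geE ?mulf_neq0 // ordM // ya.
by move: (coeff y A) (coeff y E) (y (v 0 1)) => p q r; lia.
Qed.

Lemma rv2_neq0 (v : 'rV[F]_2) : v != 0 -> v 0 1 = 0 -> v 0 0 != 0.
Proof.
move=> v0 v1; apply: contraNneq v0 => e; rewrite [v]rv2_eq v1 e.
by apply/eqP/rowP => j; rewrite !mxE; case: ifP.
Qed.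

Lemma line_in_diag_deg D E A (v : 'rV[F]_2) : deg_div E <= deg_div D ->
  line_in (diag_bundle D E) A v -> deg_div A <= deg_div D.
Proof.
move=> ED hv; have [v0 _] := hv; have [h1 h2] := line_in_diag hv.
have [e|v1] := eqVneq (v 0 1) 0.
  have f0 := rv2_neq0 v0 e.
  by have [] := divle_principal f0 (h1 f0).
by have [h _] := divle_principal v1 (h2 v1); exact: le_trans h ED.
Qed.

Lemma delta_cc E : 0 <= deg_div E -> delta (cc E) = deg_div E.
Proof.
move=> E0; rewrite (cc_cls hF hgeom).
have dG : bundle_deg (diag_bundle E 0) = deg_div E by rewrite /bundle_deg det_divisor_diag addr0.
apply: (@delta_eq _ _ _ hF hgeom _ E (rv2 1 0)).
- move=> A v /line_in_diag_deg; rewrite dG deg_div0 => /(_ E0).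
  by move: (deg_div A) (deg_div E) => a e; lia.
- apply: (@line_sat_fst _ _ 0) => y f.
  + by rewrite in_lattice_diag; split=> [h|[]//]; split=> //; exact: ord_ge0.
  + by move=> g; rewrite in_lattice_diag => -[].
  + by move=> hf; exists 0; rewrite in_lattice_diag; split=> //; exact: ord_ge0.
- by rewrite dG; move: (deg_div E) => e; lia.
Qed.

End DiagonalClasses.

(** * Line subsheaves of the modifications of L_D + O *)

Section Neighbours.
Variables (k : finFieldType) (F : fieldType) (iota : {rmorphism k -> F}).
Hypotheses (hF : function_field iota) (hgeom : geometrically_irreducible iota).
Variables (x : place iota) (D : divisor iota).
Implicit Types (y : place iota) (A B C E : divisor iota) (f g : F).
Notation kappa := (residue_field x).
Implicit Type c : option kappa.
Notation rs := (residue_val x).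
Notation dx := (deg_place x)%:Z.
Notation cc := (@cc k F iota).
Notation O f := (f \in ord_ge x 0).
Notation N c := (@neighbour k F iota x (diag_bundle D 0) c).
Notation HB c := (@hecke_bundle k F iota x c (diag_bundle D 0)).

Lemma residue_val_unit f : f != 0 -> x f = 0 -> rs f != 0.
Proof.
move=> f0 xf; have Of : O f by rewrite ord_geE // xf.
apply/eqP => /(residue_val_eq0 Of); rewrite ord_geE // xf.
by [].
Qed.

Lemma residue_mulI (a b : kappa) : a != 0 -> a * b = 0 -> b = 0.
Proof. by move=> /residue_inv[r ra] ab; rewrite -[b]mul1r -ra -mulrA ab mulr0. Qed.

(** The line is the fibre of the first summand, so only the second summand acquires a zero at x. *)
Lemma hecke_None_diag A B : oiso (lat (hecke_bundle (None : option kappa) (diag_bundle A B)))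
  (lat (diag_bundle A (B - pt x))).
Proof.
apply: (@lat_oiso _ _ _ _ _ _ 1%:M); first exact: unitmx1.
move=> y v; rewrite mulmx1 [v]rv2_eq in_hecke_diag in_lattice_diag /=.
rewrite coeffB coeff_pt opprB.
set f := v 0 0; set g := v 0 1.
have [yx|yx] := eqVneq y x; last first.
  rewrite mulr0n sub0r; split=> [[h1 h2 _]//|[h1 h2]]; split=> // e.
  by rewrite e eqxx in yx.
rewrite yx mulr1n mxE /=.
have gE : (g * unif x ^ coeff x B \in ord_ge x 1) = (g \in ord_ge x (1 - coeff x B)).
  by rewrite mulrC ord_ge_unif_mul.
have gO : (O (g * unif x ^ coeff x B)) = (g \in ord_ge x (- coeff x B)).
  by rewrite mulrC ord_ge_unif_mul sub0r.
split=> [[h1 h2 /(_ erefl) h3]|[h1 h2]]; first by split=> //; rewrite -gE; apply/residue_val_eq0; rewrite ?gO.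
have h3 : g \in ord_ge x (- coeff x B) by apply: ord_ge_le h2; lia.
by split=> // _; apply/residue_val_eq0; rewrite ?gO ?gE.
Qed.

Lemma hecke_Some_diag (u : kappa) A B : u = 0 ->
  oiso (lat (hecke_bundle (Some u) (diag_bundle A B))) (lat (diag_bundle (A - pt x) B)).
Proof.
move=> ->; apply: (@lat_oiso _ _ _ _ _ _ 1%:M); first exact: unitmx1.
move=> y v; rewrite mulmx1 [v]rv2_eq in_hecke_diag in_lattice_diag /=.
rewrite coeffB coeff_pt opprB.
set f := v 0 0; set g := v 0 1.
have [yx|yx] := eqVneq y x; last first.
  rewrite mulr0n sub0r; split=> [[h1 h2 _]//|[h1 h2]]; split=> // e.
  by rewrite e eqxx in yx.
rewrite yx mulr1n !mxE /= mul0r subr0.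
have fE : (f * unif x ^ coeff x A \in ord_ge x 1) = (f \in ord_ge x (1 - coeff x A)).
  by rewrite mulrC ord_ge_unif_mul.
have fO : (O (f * unif x ^ coeff x A)) = (f \in ord_ge x (- coeff x A)).
  by rewrite mulrC ord_ge_unif_mul sub0r.
split=> [[h1 h2 /(_ erefl) h3]|[h1 h2]]; first by split=> //; rewrite -fE; apply/residue_val_eq0; rewrite ?fO.
have h3 : f \in ord_ge x (- coeff x A) by apply: ord_ge_le h1; lia.
by split=> // _; apply/residue_val_eq0; rewrite ?fO ?fE.
Qed.

Lemma neighbour_None : N None = cc (D + pt x).
Proof.
rewrite /neighbour (cls_oiso hF hgeom (hecke_None_diag D 0)) cls_diag //.
by rewrite sub0r opprK.
Qed.

Lemma neighbour_Some0 : N (Some 0) = cc (D - pt x).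
Proof.
by rewrite /neighbour (cls_oiso hF hgeom (hecke_Some_diag D 0 erefl)) cls_diag // subr0.
Qed.

Lemma bundle_deg_hecke c : bundle_deg (HB c) = deg_div D - dx.
Proof.
rewrite /bundle_deg; have -> : det_divisor (HB c) = D - pt x.
  apply: divisor_eq => y; rewrite coeff_det_divisor coeffB coeff_pt /= /hecke_basis.
  have dd : y (\det (diag_bundle D 0 y)) = - coeff y D.
    by rewrite -[LHS]opprK -coeff_det_divisor det_divisor_diag addr0.
  case: (eqVneq y x) => [yx|yx]; last by rewrite mulr0n subr0 dd opprK.
  rewrite mulr1n det_mulmx ordM ?det_basis_neq0 //; last first.
    by have := hecke_mx_unit c; rewrite unitmxE unitfE.
  rewrite dd opprD opprK addrC; congr (_ - _).
  rewrite yx /hecke_mx; case: (c) => [u|]; rewrite det_mx2 ?mul0r ?subr0 ?mulr1 ?mul1r;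
  by rewrite ord_unif.
by rewrite deg_divB deg_pt.
Qed.

Lemma line_in_hecke c A v : line_in (HB c) A v -> line_in (diag_bundle D 0) A v.
Proof. by move=> [v0 h]; split=> // y f /h /in_hecke[]. Qed.

Lemma line_in_hecke_le c A v : 0 <= deg_div D -> line_in (HB c) A v -> deg_div A <= deg_div D.
Proof. by move=> D0 /line_in_hecke/(line_in_diag_deg hF hgeom); rewrite deg_div0; apply. Qed.

Lemma line_in_hecke_bound c : 0 <= deg_div D ->
  forall A v, line_in (HB c) A v -> 2 * deg_div A - bundle_deg (HB c) <= deg_div D + dx.
Proof.
by move=> D0 A v /(line_in_hecke_le D0); rewrite bundle_deg_hecke; lia.
Qed.

Lemma line_in_hecke_form c A (v : 'rV[F]_2) : line_in (HB c) A v -> exists2 a, a != 0 &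
  x a = - coeff x A /\ line_form c (rv2 (a * v 0 0 * unif x ^ coeff x D) (a * v 0 1)) = 0.
Proof.
move=> hv; have [a + [a0 xa]] := line_in_ord x hv; rewrite [_ *: _]rv2_eq in_hecke_diag !mxE coeff0 expr0z mulr1.
by move=> [_ _ /(_ erefl) h]; exists a.
Qed.

(* A line subsheaf with vanishing second component lies in the summand L_D; unless c is the
   point [None] of that summand, it vanishes at x. *)
Lemma line_in_fst (u : kappa) A (v : 'rV[F]_2) : line_in (HB (Some u)) A v -> v 0 1 = 0 ->
  deg_div A <= deg_div D - dx.
Proof.
move=> hv v1; have [v0 _] := hv; have f0 := rv2_neq0 v0 v1.
have [a a0 [xa]] := line_in_hecke_form hv.
have [/(_ f0) hA _] := line_in_diag (line_in_hecke hv).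
rewrite v1 mulr0 /line_form !mxE /= residue_val0 mulr0 subr0 => h.
set b := _ * _ in h.
have b0 : b != 0 by rewrite !mulf_neq0 // expfz_neq0 ?unif_neq0.
have xb : x b = - coeff x A + x (v 0 0) + coeff x D.
  by rewrite /b !ordM ?mulf_neq0 ?expfz_neq0 ?unif_neq0 // xa ord_unifX.
have Ob : O b by rewrite ord_geE // xb; have := hA x; lia.
have b1 : 1 <= x b by move/(residue_val_eq0 Ob): h; rewrite ord_geE.
have [] := @divle_principal _ _ _ hF hgeom A (D - pt x) (v 0 0) f0.
  move=> y; rewrite coeffB coeff_pt; have [<-|yx] := eqVneq x y; last by rewrite subr0; exact: hA.
  by move: b1; rewrite xb; lia.
by rewrite deg_divB deg_pt.
Qed.

(** The second component is a nonzero map from L_A to O; in degree 0 it is an isomorphism. *)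
Lemma line_in_snd c A (v : 'rV[F]_2) : line_in (HB c) A v -> v 0 1 != 0 ->
  deg_div A <= 0 /\ (0 <= deg_div A -> forall y, coeff y A = y (v 0 1)).
Proof.
move=> hv v1; have [_ /(_ v1) hA] := line_in_diag (line_in_hecke hv).
have [] := divle_principal hF hgeom v1 hA; rewrite deg_div0 => h1 h2; split=> // A0 y.
by rewrite (h2 A0) coeff0 add0r.
Qed.

Lemma top_line_pos c A v : 0 < deg_div D -> line_in (HB c) A v -> deg_div A = deg_div D -> c = None.
Proof.
case: c => // u D0 hv AD; have [e|v1] := eqVneq (v 0 1) 0.
  have := line_in_fst hv e; rewrite AD; have := deg_place_gt0 hF x; lia.
by have [] := line_in_snd hv v1; rewrite AD; lia.
Qed.

(** A line subsheaf of degree 0 maps isomorphically or by zero to each summand. If one component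
    vanishes, c is the fibre of the other summand; if none does, their quotient has divisor D, and c
    is the line spanned by their values at x. *)
Lemma top_line_zero c A (v : 'rV[F]_2) : deg_div D = 0 -> line_in (HB c) A v -> deg_div A = 0 ->
  [\/ c = None, v 0 0 = 0 /\ c = Some 0 |
      [/\ v 0 0 != 0, v 0 1 != 0, (forall y, coeff y D = y (v 0 1 / v 0 0)) &
       exists2 a, a != 0 & x a = - coeff x A /\
         line_form c (rv2 (a * v 0 0 * unif x ^ coeff x D) (a * v 0 1)) = 0 /\ x (a * v 0 1) = 0]].
Proof.
move=> D0 hv A0; have [e|v1] := eqVneq (v 0 1) 0.
  case: c hv => [u hv|_]; last by constructor 1.
  by have := line_in_fst hv e; rewrite A0 D0; have := deg_place_gt0 hF x; lia.
have [_] := line_in_snd hv v1; rewrite A0 => /(_ (lexx _)) hA.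
have [a a0 [xa h]] := line_in_hecke_form hv.
have av0 : a * v 0 1 != 0 by rewrite mulf_neq0.
have xav : x (a * v 0 1) = 0 by rewrite ordM // xa hA addNr.
have rav := residue_val_unit av0 xav.
have [e|v0] := eqVneq (v 0 0) 0.
  move: h; rewrite e mulr0 mul0r; case: c hv => [u|] hv; rewrite /line_form !mxE /= ?residue_val0.
    rewrite sub0r => /eqP; rewrite oppr_eq0 mulrC => /eqP/(residue_mulI rav) ->.
    by constructor 2.
  by move=> /eqP; rewrite (negPf rav).
constructor 3; split=> //; last by exists a.
have [/(_ v0) h1 _] := line_in_diag (line_in_hecke hv).
have [_ h2] := divle_principal hF hgeom v0 h1.
have {}h2 y : coeff y A = coeff y D + y (v 0 0) by apply: h2; rewrite D0 A0.
by move=> y; rewrite ordM ?invr_eq0 // ordV -hA h2 addrK.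
Qed.

End Neighbours.

(** * Neighbours of c_D *)

Section TopNeighbours.
Variables (k : finFieldType) (F : fieldType) (iota : {rmorphism k -> F}).
Hypotheses (hF : function_field iota) (hgeom : geometrically_irreducible iota).
Variable x : place iota.
Implicit Types (y : place iota) (A B C D E : divisor iota) (f g : F).
Notation kappa := (residue_field x).
Implicit Type c : option kappa.
Notation rs := (residue_val x).
Notation dx := (deg_place x)%:Z.
Notation cc := (@cc k F iota).
Notation O f := (f \in ord_ge x 0).
Notation N D c := (@neighbour k F iota x (diag_bundle D 0) c).
Notation HB D c := (@hecke_bundle k F iota x c (diag_bundle D 0)).

Lemma dx_gt0 : 0 < dx. Proof. by rewrite ltz_nat; exact: deg_place_gt0. Qed.

Lemma edge_intro D c n : ([set c' | N D c = N D c'] #= `I_n)%card ->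
  hecke_edges x (cc D) (cc D, N D c, n).
Proof.
by move=> cn; rewrite (cc_cls hF hgeom D); apply/edgesP => //; split=> //; exists c.
Qed.

Lemma edge_elim D t : hecke_edges x (cc D) t -> exists c, forall n,
  ([set c' | N D c = N D c'] #= `I_n)%card -> t = (cc D, N D c, n).
Proof.
rewrite (cc_cls hF hgeom D) => /(edgesP hF hgeom)[+ [c]].
case: t => [[a v] m] /= -> [-> cm]; exists c => n cn; congr (_, _).
by apply: card_eq_II; exact: card_eq_trans (card_esym cm) cn.
Qed.

Lemma delta_None D : 0 <= deg_div D -> delta (N D None) = deg_div D + dx.
Proof.
move=> D0; have dx0 := dx_gt0; rewrite (neighbour_None hF hgeom) (delta_cc hF hgeom).
  by rewrite deg_divD deg_pt.
by rewrite deg_divD deg_pt //; move: D0; move: (deg_div D) => d; lia.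
Qed.

Lemma delta_neighbour_le D c : 0 <= deg_div D -> delta (N D c) <= deg_div D + dx.
Proof.
move=> D0; apply: (delta_le hF hgeom); first exact: line_in_hecke_bound.
by apply: addr_ge0 => //; exact: ltW dx_gt0.
Qed.

(** The value is positive, hence attained; since the modified bundle has degree deg D - d_x,
    attaining deg D + d_x means deg A = deg D. *)
Lemma delta_top D c : 0 <= deg_div D -> delta (N D c) = deg_div D + dx ->
  exists A v, line_in (HB D c) A v /\ deg_div A = deg_div D.
Proof.
move=> D0 dN; have dx0 := dx_gt0.
have [|A [v [hv e]]] := delta_mem hF hgeom (line_in_hecke_bound (c := c) hF hgeom D0).
  rewrite -/(neighbour _ _) dN; move: (deg_div D) D0 => d d0 h; lia.
exists A, v; split=> //; move: e; rewrite -/(neighbour _ _) dN bundle_deg_hecke //.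
by move: (deg_div A) (deg_div D) => a d; lia.
Qed.

(** The trace of L_D on the modification is L_(D - x), of the same degree as the modified bundle,
    and it is saturated with cokernel O. Any other line subsheaf maps nontrivially to O, so it
    contributes at most d_x - deg D, which is negative. *)
Lemma delta_Some D (u : kappa) : dx < deg_div D -> delta (N D (Some u)) = deg_div D - dx.
Proof.
move=> Dx; have dx0 := dx_gt0.
apply: (@delta_eq _ _ _ hF hgeom _ (D - pt x) (rv2 1 0)).
- move=> A v hv; rewrite bundle_deg_hecke //.
  have [e|v1] := eqVneq (v 0 1) 0.
    by have := line_in_fst hF hgeom hv e; move: (deg_div A) (deg_div D) Dx => a d; lia.
  by have [] := line_in_snd hF hgeom hv v1; move: (deg_div A) (deg_div D) Dx => a d; lia.
- apply: (@line_sat_fst _ _ _ _ _ 0).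
  + move=> y f; rewrite in_hecke_diag coeffB coeff_pt opprB.
    have [<-|xy] := eqVneq x y; last first.
      rewrite mulr0n sub0r; split=> [h|[]//]; split=> //; first exact: ord_ge0.
      by move=> e; rewrite e eqxx in xy.
    have fE : (f * unif x ^ coeff x D \in ord_ge x 1) = (f \in ord_ge x (1 - coeff x D)).
      by rewrite mulrC ord_ge_unif_mul.
    have fO : (O (f * unif x ^ coeff x D)) = (f \in ord_ge x (- coeff x D)).
      by rewrite mulrC ord_ge_unif_mul sub0r.
    rewrite mulr1n /line_form !mxE /= mul0r residue_val0 mulr0 subr0 -fE.
    split=> [h|[h1 _ /(_ erefl)] h2]; last by apply/residue_val_eq0; rewrite ?fO.
    split; [|exact: ord_ge0|].
      by move: h; rewrite fE; apply: ord_ge_le; move: (coeff x D) => d; lia.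
    by move=> _; apply/residue_val_eq0 => //; exact: ord_ge1_int.
  + by move=> y f g; rewrite in_hecke_diag => -[].
  + move=> y g hg; have [yx|yx] := eqVneq y x; last first.
      exists 0; rewrite in_hecke_diag; split=> //; first exact: ord_ge0.
      by move=> e; rewrite e eqxx in yx.
    move: hg; rewrite yx coeff0 oppr0 => hg.
    (* The lift of g must have its value at x on the line spanned by (u, 1). *)
    exists (residue_lift u * g * unif x ^ (- coeff x D)); rewrite in_hecke_diag coeff0 oppr0.
    have lg : O (residue_lift u * g) by apply: ord_geM0 => //; exact: residue_lift_int.
    split=> // [|_]; first by rewrite mulrC ord_ge_unif_mul opprK addNr.
    rewrite -mulrA -expfzDr ?unif_neq0 // addNr !expr0z !mulr1 /line_form !mxE /=.
    by rewrite residue_valM ?residue_lift_int // residue_liftK subrr.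
- by rewrite bundle_deg_hecke // deg_divB deg_pt; move: (deg_div D) => d; lia.
Qed.

(** A section h of L_D with value u at x gives the automorphism (f, g) |-> (f - g h, g) of L_D + O,
    which moves the line of u to the line of 0. *)
Lemma neighbour_large D (u : kappa) :
  Num.max (2 * (genus iota)%:Z - 2) 0 + dx < deg_div D -> N D (Some u) = N D (Some 0).
Proof.
move=> Dl; pose l := residue_lift u.
have u0 n := expfz_neq0 n (unif_neq0 x).
have Ol : O l := residue_lift_int u.
have [|h hD hx] := @section_prescribed _ _ _ hF hgeom x D (unif x ^ (- coeff x D) * l) Dl.
  by rewrite ord_ge_unif_mul opprK addNr.
have hu : rs (h * unif x ^ coeff x D) = u.
  have Oh : O (h * unif x ^ coeff x D) by rewrite mulrC ord_ge_unif_mul sub0r.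
  rewrite -(residue_liftK u) -/l; apply/eqP; rewrite -subr_eq0 -residue_valB //; apply/eqP.
  apply/residue_val_eq0; first exact: ord_geB.
  move: hx; rewrite -ord_ge_unif_mul mulrBr mulrA -expfzDr ?unif_neq0 // addrN expr0z mul1r.
  by rewrite mulrC.
apply: (cls_oiso hF hgeom); apply: (@lat_oiso _ _ _ _ _ _ (mx2 1 0 (- h) 1)).
  by rewrite unitmxE unitfE det_mx2 mul0r subr0 mulr1 oner_neq0.
move=> y v; rewrite [v]rv2_eq rv2_mul !mulr1 !mulr0 add0r !in_hecke_diag.
set f := v 0 0; set g := v 0 1; rewrite !coeff0 oppr0 !expr0z !mulr1.
have key : g \in ord_ge y 0 -> g * - h \in ord_ge y (- coeff y D).
  by move=> hg; rewrite mulrN ord_geNE; exact: ord_geM0.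
have fx z : O z -> f \in ord_ge x (- coeff x D) ->
    line_form (Some u) (rv2 (f * unif x ^ coeff x D) z) = 0 <->
    line_form (Some (0 : kappa)) (rv2 ((f + z * - h) * unif x ^ coeff x D) z) = 0.
  move=> Oz hf; rewrite /line_form !mxE /= mul0r subr0.
  have Of : O (f * unif x ^ coeff x D) by rewrite mulrC ord_ge_unif_mul sub0r.
  have Oh : O (h * unif x ^ coeff x D) by rewrite mulrC ord_ge_unif_mul sub0r.
  have -> : (f + z * - h) * unif x ^ coeff x D =
     f * unif x ^ coeff x D - z * (h * unif x ^ coeff x D).
    by rewrite mulrDl mulrN mulNr mulrA.
  rewrite residue_valB //; last exact: ord_geM0.
  by rewrite (residue_valM Oz Oh) hu [rs z * u]mulrC.
split=> -[h1 h2 h3]; split=> //.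
- by apply: ord_geD => //; exact: key.
- by move=> yx; rewrite yx in h1 h2; apply/fx => //; exact: h3.
- by rewrite -[f](addrK (g * - h)); apply: ord_geB => //; exact: key.
- move=> yx; have h1' : f \in ord_ge y (- coeff y D).
    by rewrite -[f](addrK (g * - h)); apply: ord_geB => //; exact: key.
  by rewrite yx in h1' h2; apply/fx => //; exact: h3.
Qed.

Notation resk l := (rs (iota l)).

Lemma residue_const_inj : injective (fun l : k => resk l).
Proof.
move=> l m /eqP; rewrite -subr_eq0 -residue_valB ?ord_ge_const // -rmorphB => lm.
apply/eqP; rewrite -subr_eq0; apply: contraLR lm => lm.
by apply: residue_val_unit; rewrite ?fmorph_eq0 // ord_const.
Qed.

(** The automorphism (f, g) |-> (g, f - l g) of O + O moves the line of (l, 1) to that of (1, 0). *)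
Lemma neighbour_const (l : k) : N 0 (Some (resk l)) = N 0 None.
Proof.
apply: (cls_oiso hF hgeom); apply: (@lat_oiso _ _ _ _ _ _ (mx2 0 1 1 (- iota l))).
  by rewrite unitmxE unitfE det_mx2 mul0r sub0r mulr1 oppr_eq0 oner_neq0.
move=> y v; rewrite [v]rv2_eq rv2_mul !mulr1 !mulr0 add0r !in_hecke_diag !coeff0 !oppr0 !expr0z !mulr1.
set f := v 0 0; set g := v 0 1.
have key : g \in ord_ge y 0 -> g * - iota l \in ord_ge y 0.
  by move=> hg; rewrite mulrN ord_geNE mulrC; apply: ord_geM0 => //; exact: ord_ge_const.
have fx : O f -> O g -> line_form (Some (resk l)) (rv2 f g) = 0 <->
    line_form (None : option kappa) (rv2 g (f + g * - iota l)) = 0.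
  move=> Of Og; rewrite /line_form !mxE /= mulrN [g * _]mulrC.
  rewrite residue_valB ?residue_valM ?ord_ge_const //.
  by apply: ord_geM0 => //; exact: ord_ge_const.
split=> -[h1 h2 h3]; split=> //.
- by apply: ord_geD => //; exact: key.
- by move=> yx; rewrite yx in h1 h2; apply/fx => //; exact: h3.
- by rewrite -[f](addrK (g * - iota l)); apply: ord_geB => //; exact: key.
- move=> yx; have h1' : f \in ord_ge y 0.
    by rewrite -[f](addrK (g * - iota l)); apply: ord_geB => //; exact: key.
  by rewrite yx in h1 h1'; apply/fx => //; exact: h3.
Qed.

(** When both components are nonzero their quotient has trivial divisor, so it is a constant l in k,
    and the line at x is spanned by (l, 1). *)
Lemma top_zero c : delta (N 0 c) = dx -> c = None \/ exists l, c = Some (resk l).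
Proof.
have d0 := deg_div0 iota => dN.
have [||A [v [hv A0]]] := @delta_top 0 c; [by rewrite d0|by rewrite d0 add0r|rewrite d0 in A0].
have [|[_ ->]|[v0 v1 fg [a a0 [xa [h xav]]]]] := top_line_zero hF hgeom d0 hv A0; first by left.
  by right; exists 0; rewrite rmorph0 residue_val0.
have [l le] : exists l, v 0 0 / v 0 1 = iota l.
  apply: (regular_const hF hgeom) => y.
  have := fg y; rewrite coeff0 -[_ / _]invrK invf_div ordV => /esym/eqP.
  by rewrite oppr_eq0 => /eqP e; rewrite ord_geE ?mulf_neq0 ?invr_eq0 // e.
have av1 : a * v 0 1 != 0 by rewrite mulf_neq0.
have rav := residue_val_unit av1 xav.
have Oav : O (a * v 0 1) by rewrite ord_geE // xav.
move: h; rewrite coeff0 expr0z mulr1 (_ : a * v 0 0 = iota l * (a * v 0 1)); last first.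
  by rewrite -le mulrCA divfK.
case: c {dN hv} => [u|]; rewrite /line_form !mxE /=; last by move=> /eqP; rewrite (negPf rav).
rewrite residue_valM ?ord_ge_const // -mulrBl mulrC => /(residue_mulI rav)/eqP.
by rewrite subr_eq0 => /eqP <-; right; exists l.
Qed.

Lemma neighbour_set_zero : ([set c | N 0 None = N 0 c] #= `I_(#|k|.+1))%card.
Proof.
have dN : delta (N 0 None) = dx by rewrite delta_None ?deg_div0 // add0r.
pose g (o : option k) : option kappa := omap (fun l => resk l) o.
have -> : [set c | N 0 None = N 0 c] = g @` [set: option k].
  apply/seteqP; split=> c /=.
    move=> h; have [|->|[l ->]] := @top_zero c; first by rewrite -h.
      by exists None.
    by exists (Some l).
  by move=> [[l|] _ <-] //=; rewrite neighbour_const.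
have gi : (g @` [set: option k] #= [set: option k])%card.
  by apply: inj_card_eq => -[l|] [m|] _ _ //= [] /residue_const_inj ->.
by apply: card_eq_trans gi _; rewrite -card_option; exact: card_finType.
Qed.

(** Two nonzero components would exhibit D as a principal divisor. *)
Lemma top_deg0 D c : deg_div D = 0 -> ~ lin_equiv D 0 -> delta (N D c) = dx ->
  c = None \/ c = Some 0.
Proof.
move=> D0 nD dN.
have [||A [v [hv A0]]] := @delta_top D c; [by rewrite D0|by rewrite D0 add0r|rewrite D0 in A0].
have [|[_ ->]|[v0 v1 fg _]] := top_line_zero hF hgeom D0 hv A0; [by left|by right|].
by case: nD; exists (v 0 1 / v 0 0); rewrite ?mulf_neq0 ?invr_eq0 // subr0.
Qed.

Lemma delta_Some0 D : deg_div D = 0 -> delta (N D (Some 0)) = dx.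
Proof.
move=> D0; have dx0 := dx_gt0.
rewrite (neighbour_Some0 hF hgeom) -(cc_opp hF hgeom) opprB (delta_cc hF hgeom) deg_divB deg_pt // D0 subr0 //.
Qed.

Lemma neighbour_Some0_opp D : N D (Some 0) = cc (- D + pt x).
Proof. by rewrite (neighbour_Some0 hF hgeom) -(cc_opp hF hgeom) opprB addrC. Qed.

(** This decides whether the two summands give one neighbour of multiplicity 2 or two of
    multiplicity 1. If 2D is principal, then D + x and x - D are linearly equivalent. Conversely,
    the entries of an isomorphism between L_D + L_(-x) and a twist of L_(D - x) + O by B are
    compared by degree. *)
Lemma neighbour_None_Some0 D : deg_div D = 0 ->
  N D None = N D (Some 0) <-> lin_equiv (D *+ 2) 0.
Proof.
move=> D0; split; last first.
  move=> [f f0 fE]; rewrite neighbour_Some0_opp (neighbour_None hF hgeom).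
  apply: (cc_lin_equiv hF hgeom); exists f => // y; rewrite -fE.
  by rewrite subr0 mulr2n opprD opprK !coeffD !coeffN; move: (coeff y D) (coeff y (pt x)) => p q; lia.
rewrite /neighbour (cls_oiso hF hgeom (hecke_None_diag x D 0)).
rewrite (cls_oiso hF hgeom (hecke_Some_diag D 0 erefl)) sub0r.
move=> /(cls_eq hF hgeom)[B]; rewrite twist_diag add0r => DB.
have dB : deg_div B = 0.
  have := deg_bundle_lat hF hgeom DB.
  rewrite (deg_bundle_lat hF hgeom (oiso_refl _)) !det_divisor_diag !deg_divD deg_divN D0.
  by move: (deg_div B) (deg_div (pt x)) => b p; lia.
have [M Mu MP] := oiso_lat hF hgeom DB.
have ME : M = mx2 (M 0 0) (M 0 1) (M 1 0) (M 1 1).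
  by apply/matrixP => -[[|[|]] // hi] [[|[|]] // hj]; rewrite !mxE /=; congr (M _ _); exact: val_inj.
move: Mu MP; rewrite ME; move: (M 0 0) (M 0 1) (M 1 0) (M 1 1) => a b c d {ME M}.
rewrite unitmxE unitfE det_mx2 => Mu MP.
have fst_sub y : forall e : F, e \in ord_ge y (- coeff y D) ->
    e * a \in ord_ge y (- coeff y (D - pt x + B)) /\ e * b \in ord_ge y (- coeff y B).
  move=> e he; have := proj1 (MP y (rv2 e 0)); rewrite rv2_mul !mul0r !addr0 !in_lattice_diag.
  by apply; split=> //; exact: ord_ge0.
have snd_sub y : forall e : F, e \in ord_ge y (- coeff y (- pt x)) ->
    e * c \in ord_ge y (- coeff y (D - pt x + B)).
  move=> e he; have := proj1 (MP y (rv2 0 e)); rewrite rv2_mul !mul0r !add0r !in_lattice_diag.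
  by case=> //; split=> //; exact: ord_ge0.
have un y n : unif y ^ n != 0 by rewrite expfz_neq0 ?unif_neq0.
(* The entry a is a map from L_D to L_(D - x + B), whose degree is smaller by d_x because deg B = 0.
   With a = 0, the entries b and c are isomorphisms, which gives D - B = (b) and - D - B = (c), so
   2D = (b/c). *)
have a0 : a = 0.
  apply/eqP/negPn/negP => a0.
  have [] := @divle_principal _ _ _ hF hgeom D (D - pt x + B) a a0.
    move=> y; have [|+ _] := fst_sub y (unif y ^ (- coeff y D)); first by rewrite ord_geE // ord_unifX.
    rewrite ord_geE ?mulf_neq0 // ordM // ord_unifX.
    by move: (coeff y D) (coeff y (D - pt x + B)) (y a) => p q r; lia.
  by rewrite !deg_divD deg_divN deg_pt // dB D0; have := dx_gt0; lia.
rewrite a0 mul0r sub0r oppr_eq0 mulf_eq0 negb_or in Mu; have /andP[b0 c0] := Mu.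
have DE y : coeff y D = coeff y B + y b.
  have [] := @divle_principal _ _ _ hF hgeom D B b b0; last by rewrite D0 dB => _; apply.
  move=> z; have [|_] := fst_sub z (unif z ^ (- coeff z D)); first by rewrite ord_geE // ord_unifX.
  rewrite ord_geE ?mulf_neq0 // ordM // ord_unifX.
  by move: (coeff z D) (coeff z B) (z b) => p q r; lia.
have xE y : coeff y (- pt x) = coeff y (D - pt x + B) + y c.
  have [] := @divle_principal _ _ _ hF hgeom (- pt x) (D - pt x + B) c c0; last first.
    by rewrite !deg_divD D0 dB add0r addr0 => _; apply.
  move=> z; have := snd_sub z (unif z ^ (- coeff z (- pt x))).
  rewrite !ord_geE ?mulf_neq0 // ordM // ord_unifX lexx => /(_ isT).
  by move: (coeff z (- pt x)) (coeff z (D - pt x + B)) (z c) => p q r; lia.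
exists (b / c); first by rewrite mulf_neq0 ?invr_eq0.
move=> y; rewrite subr0 mulr2n ordM ?invr_eq0 // ordV coeffD.
have := DE y; have := xE y; rewrite !coeffD.
by move: (coeff y D) (coeff y (- pt x)) (coeff y B) (y b) (y c) => p q r s t; lia.
Qed.

Lemma neighbour_set1 D c : (forall c', N D c' = N D c -> c' = c) ->
  ([set c' | N D c = N D c'] #= `I_1)%card.
Proof.
move=> h; rewrite (_ : [set c' | _] = [set c]); first exact: card_set1.
by apply/seteqP; split=> c' /= => [e|->//]; exact: h.
Qed.

Lemma neighbour_set2 D : (forall c', N D c' = N D None -> c' = None \/ c' = Some 0) ->
  N D None = N D (Some 0) -> ([set c' | N D None = N D c'] #= `I_2)%card.
Proof.
move=> h e; pose g (b : bool) : option kappa := if b then None else Some 0.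
rewrite (_ : [set c' | _] = g @` [set: bool]).
  have gi : (g @` [set: bool] #= [set: bool])%card by apply: inj_card_eq => -[] [].
  by apply: card_eq_trans gi _; rewrite -card_bool; exact: card_finType.
apply/seteqP; split=> c' /=; last by move=> [[] _ <-].
by move=> e'; have [] := h c' (esym e') => ->; [exists true|exists false].
Qed.

Lemma top_pos D c : 0 < deg_div D -> delta (N D c) = deg_div D + dx -> c = None.
Proof.
move=> D0 dN; have [A [v [hv AD]]] := delta_top (ltW D0) dN.
exact: (top_line_pos hF hgeom D0 hv AD).
Qed.

(** The multiplicity of a neighbour is the number of points giving it, and only points whose
    neighbour has maximal delta matter. They are the single point [None] in positive degree, the
    #|k|+1 points defined over k when [D] = 0, and the two summands otherwise. In the latter case
    2-torsion merges the two neighbours. *)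
Lemma edges_top D : 0 <= deg_div D -> forall t,
  hecke_edges x (cc D) t /\ delta t.1.2 = deg_div D + dx <-> top_edges x D t.
Proof.
move=> D0 t; have dx0 := dx_gt0.
have lin_deg : lin_equiv D 0 -> deg_div D = 0.
  move=> [f f0 fE]; rewrite -(deg_principal hF hgeom f0); congr deg_div.
  by apply: divisor_eq => y; rewrite coeff_principal -fE subr0.
have [Dpos|] := ltP 0 (deg_div D).
  have card1 : ([set c' | N D None = N D c'] #= `I_1)%card.
    by apply: neighbour_set1 => c' e; apply: (top_pos Dpos); rewrite e delta_None.
  split=> [[/edge_elim[c ct] dt]|].
    constructor 4; split=> //.
    have [n hn] := finite_points hF [set c' | N D c = N D c'].
    have cN : c = None by apply: (top_pos Dpos); move: dt; rewrite (ct _ hn).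
    by rewrite cN in ct; rewrite (ct _ card1) (neighbour_None hF hgeom).
  case=> [[/lin_deg e]|[e]|[e]|[_ ->]]; try by rewrite e ltxx in Dpos.
  rewrite -(neighbour_None hF hgeom); split; first exact: edge_intro.
  exact: delta_None.
move=> Dle; have {Dle}Dz : deg_div D = 0 by apply/eqP; rewrite eq_le Dle.
rewrite Dz add0r.
have [Dlin|Dlin] := pselect (lin_equiv D 0).
  have ccD : cc D = cc 0 := cc_lin_equiv hF hgeom Dlin.
  have D2 : lin_equiv (D *+ 2) 0.
    move: Dlin => [f f0 fE]; exists (f * f); first by rewrite mulf_neq0.
    by move=> y; rewrite ordM // -fE !subr0 mulr2n coeffD.
  rewrite ccD; split=> [[/edge_elim[c ct] dt]|].
    constructor 1; split=> //.
    have [n hn] := finite_points hF [set c' | N 0 c = N 0 c'].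
    have cN : N 0 c = N 0 None.
      have [|->//|[l ->]] := @top_zero c; first by move: dt; rewrite (ct _ hn).
      exact: neighbour_const.
    rewrite (ct #|k|.+1); first by rewrite cN (neighbour_None hF hgeom) add0r.
    by rewrite cN; exact: neighbour_set_zero.
  case=> [[_ ->]|[_ _ /(_ Dlin)//]|[_ /(_ D2)//]|[]]; last by rewrite Dz.
  rewrite -[pt x]add0r -(neighbour_None hF hgeom); split; first exact/edge_intro/neighbour_set_zero.
  by rewrite delta_None ?deg_div0 // add0r.
have dNone : delta (N D None) = dx by rewrite delta_None ?Dz // add0r.
have dSome := delta_Some0 Dz.
have topN c' : N D c' = N D None -> c' = None \/ c' = Some 0.
  by move=> e; apply: (top_deg0 Dz Dlin); rewrite e.
have [D2|D2] := pselect (lin_equiv (D *+ 2) 0).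
  have NS : N D None = N D (Some 0) by apply/neighbour_None_Some0.
  have card2 := neighbour_set2 topN NS.
  split=> [[/edge_elim[c ct] dt]|].
    constructor 2; split=> //.
    have [n hn] := finite_points hF [set c' | N D c = N D c'].
    have cN : N D c = N D None.
      by have [|->//|->] := @top_deg0 D c Dz Dlin; first by move: dt; rewrite (ct _ hn).
    by rewrite (ct 2%N) cN // (neighbour_None hF hgeom).
  case=> [[]//|[_ _ _ ->]|[_ /(_ D2)//]|[]]; last by rewrite Dz.
  by rewrite -(neighbour_None hF hgeom); split; first exact: edge_intro.
have NS : N D None <> N D (Some 0) by move/neighbour_None_Some0 => h; apply: D2; exact: h.
have cardN : ([set c' | N D None = N D c'] #= `I_1)%card.
  by apply: neighbour_set1 => c' e; have [//|e'] := topN c' e; case: NS; rewrite -e e'.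
have cardS : ([set c' | N D (Some 0) = N D c'] #= `I_1)%card.
  apply: neighbour_set1 => c' e; have [|e'|//] := @top_deg0 D c' Dz Dlin; first by rewrite e.
  by case: NS; rewrite -e e'.
split=> [[/edge_elim[c ct] dt]|].
  constructor 3; split=> //.
  have [n hn] := finite_points hF [set c' | N D c = N D c'].
  have [|e|e] := @top_deg0 D c Dz Dlin; first by move: dt; rewrite (ct _ hn).
    by left; rewrite e in ct; rewrite (ct _ cardN) (neighbour_None hF hgeom).
  by right; rewrite e in ct; rewrite (ct _ cardS) neighbour_Some0_opp.
case=> [[]//|[_ /D2//]|[_ _ [->|->]]|[]]; last by rewrite Dz.
  by rewrite -(neighbour_None hF hgeom); split; first exact: edge_intro.
by rewrite -neighbour_Some0_opp; split; first exact: edge_intro.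
Qed.

Lemma neighbour_other D v : 0 <= deg_div D ->
  (exists m, hecke_edges x (cc D) (cc D, v, m)) ->
  ~ (exists m, top_edges x D (cc D, v, m)) ->
  delta v < deg_div D + dx /\ (dx < deg_div D -> delta v = deg_div D - dx).
Proof.
move=> D0 [m hm] nt; have ntop : delta v <> deg_div D + dx.
  by move=> dv; apply: nt; exists m; apply/edges_top => //; split.
have [c ct] := edge_elim hm.
have [n hn] := finite_points hF [set c' | N D c = N D c'].
have [vc _] := ct _ hn; rewrite vc in ntop *; split.
  by rewrite lt_neqAle delta_neighbour_le // andbT; apply/eqP.
move=> Dx; case: c vc ntop {ct hn} => [u _ _|_ h]; first exact: delta_Some.
by case: h; exact: delta_None.
Qed.

(** All points other than [None] give the same neighbour, and their number is that of the residue
    field; delta separates this neighbour from the one at [None]. *)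
Lemma edges_large D : Num.max (2 * (genus iota)%:Z - 2) 0 + dx < deg_div D ->
  forall t, hecke_edges x (cc D) t <->
    t = (cc D, cc (D - pt x), (#|k| ^ deg_place x)%N) \/ t = (cc D, cc (D + pt x), 1%N).
Proof.
move=> Dl t; have dx0 := dx_gt0.
have Dx : dx < deg_div D.
  by apply: le_lt_trans Dl; rewrite lerDr le_max lexx orbT.
have Dpos : 0 < deg_div D := lt_trans dx0 Dx.
have NoneSome (u : kappa) : N D (Some u) <> N D None.
  move=> /(congr1 (@delta k F iota)); rewrite delta_Some // delta_None ?ltW //.
  by move: (deg_div D) => d; lia.
have card1 : ([set c' | N D None = N D c'] #= `I_1)%card.
  by apply: neighbour_set1 => -[u /NoneSome|].
have cardq : ([set c' | N D (Some 0) = N D c'] #= `I_(#|k| ^ deg_place x))%card.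
  rewrite (_ : [set c' | _] = Some @` [set: kappa]).
    by apply: card_eq_trans (residue_card hF x); apply: inj_card_eq => u w _ _ [].
  apply/seteqP; split=> [[u|] /= h|_ [u _ <-]]; first by exists u.
    by have := NoneSome 0; rewrite h.
  by rewrite /= (neighbour_large u Dl).
rewrite -(neighbour_None hF hgeom) -(neighbour_Some0 hF hgeom); split.
  move=> /edge_elim[[u|] ct]; last by right; exact: ct.
  by rewrite (neighbour_large u Dl) in ct; left; exact: ct.
by case=> ->; exact: edge_intro.
Qed.

End TopNeighbours.

Theorem theorem8p5 (k : finFieldType) (F : fieldType) (iota : {rmorphism k -> F})
    (hF : function_field iota) (hgeom : geometrically_irreducible iota)
    (x : place iota) (D : divisor iota) (hD : 0 <= deg_div D) :
  (forall t, hecke_edges x (cc D) t /\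
      delta t.1.2 = deg_div D + (deg_place x)%:Z <-> top_edges x D t) /\
  (forall v, (exists m, hecke_edges x (cc D) (cc D, v, m)) ->
      ~ (exists m, top_edges x D (cc D, v, m)) ->
      delta v < delta (cc D) + (deg_place x)%:Z /\
      ((deg_place x)%:Z < deg_div D ->
        delta v = deg_div D - (deg_place x)%:Z)) /\
  (Num.max (2 * (genus iota)%:Z - 2) 0 + (deg_place x)%:Z < deg_div D ->
    forall t, hecke_edges x (cc D) t <->
      t = (cc D, cc (D - pt x), (#|k| ^ deg_place x)%N) \/
      t = (cc D, cc (D + pt x), 1%N)).
Proof.
split; first exact: edges_top.
split; last exact: edges_large.
by move=> v hv nv; rewrite (delta_cc hF hgeom hD); exact: neighbour_other.
Qed.
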